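(* Let $(A,\mathfrak m)$ be an $\mathfrak m$-adically complete Noetherian local ring with infinite residue field $A/\mathfrak m$, let $d=\dim A$, and let $M$ be a finitely generated $A$-module with $\dim_A M = d \ge 3$. Then: (1) $\mathrm{e}_Q^2(M) \le \mathrm{T}_Q^2(M)$ for every parameter ideal $Q$ of $A$. (2) If $M$ is unmixed, then $$-\sum_{j=2}^{d-1}\binom{d-3}{j-2}\operatorname{hdeg}_Q(M_j)\ \le\ \mathrm{e}_Q^2(M)$$ for every parameter ideal $Q$ of $A$.
   Context: Let $(A,\mathfrak m)$ be an $\mathfrak m$-adically complete Noetherian local ring with $d=\dim A>0$ and infinite residue field, let $\ell_A$ denote length, and let $E=\mathrm{E}_A(A/\mathfrak m)$ be the injective envelope of $A/\mathfrak m$. Let $\mathrm{H}^j_{\mathfrak m}$ denote local cohomology. For a finitely generated $A$-module $M$ and $j\in\mathbb Z$ put $M_j=\operatorname{Hom}_A(\mathrm{H}^j_{\mathfrak m}(M),E)$; this is a finitely generated $A$-module with $\dim_A M_j\le j$ (with $\dim_A(0)=-\infty$). A parameter ideal of $A$ is an ideal generated by a system of parameters of $A$ (i.e. an $\mathfrak m$-primary ideal generated by $d$ elements). Hilbert coefficients: for an $\mathfrak m$-primary ideal $I$ and a finitely generated $A$-module $M$ with $s=\dim_A M$, the integers $\mathrm{e}_I^i(M)$, $0\le i\le s$, are defined by $\ell_A(M/I^{n+1}M)=\sum_{i=0}^{s}(-1)^i\mathrm{e}_I^i(M)\binom{n+s-i}{s-i}$ for all $n\gg0$. Homological degree: defined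 by induction on $s=\dim_A M$ by $\operatorname{hdeg}_I(M)=\ell_A(M)$ if $s\le 0$, and $\operatorname{hdeg}_I(M)=\mathrm{e}_I^0(M)+\sum_{j=0}^{s-1}\binom{s-1}{j}\operatorname{hdeg}_I(M_j)$ if $s>0$. Homological torsions: if $s=\dim_A M\ge2$, then for $1\le i\le s-1$, $\mathrm{T}_I^i(M)=\sum_{j=1}^{s-i}\binom{s-i-1}{j-1}\operatorname{hdeg}_I(M_j)$. $M$ is called unmixed if $\dim A/\mathfrak p=\dim_A M$ for all $\mathfrak p\in\operatorname{Ass}_A M$. *)

(* Defs.v *)
From HB Require Import structures.
From mathcomp Require Import all_boot all_order all_algebra.
From mathcomp Require Import generic_quotient ring_quotient.
From mathcomp Require Import boolp classical_sets functions cardinality.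
From mathcomp Require Import constructive_ereal.

Set Implicit Arguments.
Unset Strict Implicit.
Unset Printing Implicit Defensive.

Import Order.TTheory GRing.Theory Num.Theory.
Local Open Scope ring_scope.
Local Open Scope quotient_scope.

(* [submodClosed M] is the type of submodules of [M]; in particular the ideals
   of [A] are the elements of [submodClosed A^o]. *)

(* Hilbert's choice operator, usable on types such as [lmodType A]: a value
   satisfying [P] if there is one, and [x0] otherwise. *)
Definition pick_such (T : Type) (x0 : T) (P : T -> Prop) : T :=
  if pselect (exists x, P x) is left h then projT1 (cid h) else x0.

(* The supremum of a set of naturals in Z extended by -oo and +oo;
   -oo for the empty set. *)
Definition sup_nat (P : nat -> Prop) : \bar int :=
  supremum -oo%E [set x | exists2 n : nat, P n & x = n%:Z%:E]%classic.

Section Modules.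
Variables (A : comNzRingType) (M : lmodType A).

Record submodule_type (S : submodClosed M) :=
  Submodule { submodule_val : M; _ : submodule_val \in S }.
HB.instance Definition _ S := [isSub for @submodule_val S].
HB.instance Definition _ S := [Choice of submodule_type S by <:].
HB.instance Definition _ S :=
  [SubChoice_isSubLmodule of submodule_type S by <:].

Section Quotient.
Variable S : submodClosed M.

(* [submodClosed] does not inherit from [zmodClosed], which the library's
   quotients require. *)
Definition subgroup_of : {pred M} := fun x => x \in S.
Lemma subgroup_of_zmod_closed : zmod_closed subgroup_of.
Proof. exact: GRing.submod_closedB (submodClosedP S). Qed.
HB.instance Definition _ :=
  GRing.isZmodClosed.Build M subgroup_of subgroup_of_zmod_closed.

Definition quotient_mod := Quotient.quot subgroup_of.
HB.instance Definition _ := GRing.Zmodule.on quotient_mod.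
HB.instance Definition _ := Quotient.on quotient_mod.

Definition quotient_scale (a : A) (u : quotient_mod) : quotient_mod :=
  \pi_quotient_mod (a *: repr u).

Lemma quotient_scale_pi a (x : M) :
  quotient_scale a (\pi_quotient_mod x) = \pi_quotient_mod (a *: x).
Proof.
rewrite /quotient_scale; apply/eqP; rewrite -Quotient.idealrBE -scalerBr.
apply: (@rpredZ _ _ S); rewrite -[_ \in _]/(_ \in subgroup_of).
by rewrite Quotient.idealrBE reprK.
Qed.

Lemma quotient_pi_add (x y : M) :
  \pi_quotient_mod (x + y) = \pi_quotient_mod x + \pi_quotient_mod y.
Proof. by rewrite /quotient_mod !piE. Qed.

Lemma quotient_scaleA a b u :
  quotient_scale a (quotient_scale b u) = quotient_scale (a * b) u.
Proof.
rewrite -[u]reprK; move: (repr u) => x.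
by rewrite (quotient_scale_pi b x) !(quotient_scale_pi _ _) scalerA.
Qed.

Lemma quotient_scale1 : left_id 1 quotient_scale.
Proof. by move=> u; rewrite -[u]reprK quotient_scale_pi scale1r. Qed.

Lemma quotient_scaleDr : right_distributive quotient_scale +%R.
Proof.
move=> a u v; rewrite -[u]reprK -[v]reprK; move: (repr u) (repr v) => x y.
rewrite -quotient_pi_add.
by rewrite !quotient_scale_pi scalerDr quotient_pi_add.
Qed.

Lemma quotient_scaleDl u :
  {morph quotient_scale^~ u : a b / a + b >-> a + b}.
Proof.
move=> a b; rewrite -[u]reprK; move: (repr u) => x.
by rewrite !quotient_scale_pi scalerDl quotient_pi_add.
Qed.

HB.instance Definition _ := GRing.Zmodule_isLmodule.Build A quotient_mod
  quotient_scaleA quotient_scale1 quotient_scaleDr quotient_scaleDl.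
End Quotient.

Definition submod_span (X : set M) : {pred M} := fun x =>
  `[< forall S : submodClosed M, (forall y, X y -> y \in S) -> x \in S >].

Lemma submod_span_closed X : submod_closed (submod_span X).
Proof.
split; first by apply/asboolP => S _; exact: rpred0.
move=> a x y /asboolP hx /asboolP hy; apply/asboolP => S hS.
by rewrite rpredD ?rpredZ ?hx ?hy.
Qed.
HB.instance Definition _ X :=
  GRing.isSubmodClosed.Build A M (submod_span X)
    (GRing.submod_closed_semi (submod_span_closed X)).

Definition whole : {pred M} := fun=> true.
Lemma whole_submod_closed : submod_closed whole. Proof. by []. Qed.
HB.instance Definition _ :=
  GRing.isSubmodClosed.Build A M whole
    (GRing.submod_closed_semi whole_submod_closed).

Definition finitely_generated (S : submodClosed M) : Prop :=
  exists s : seq M, S =i submod_span [set` s]%classic.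

Definition ideal_smul (I : submodClosed A^o) (S : submodClosed M) :
    submodClosed M :=
  submod_span [set y | exists a x, [/\ a \in I, x \in S & y = a *: x]]%classic.

(* [ideal_pow I n] is I^n M; on A^o it is the ideal power I^n. *)
Definition ideal_pow (I : submodClosed A^o) (n : nat) : submodClosed M :=
  iter n (ideal_smul I) whole.

Definition strict_chain (n : nat) (F : nat -> submodClosed M) : Prop :=
  forall i, (i < n)%N ->
    {subset F i <= F i.+1} /\ ~ {subset F i.+1 <= F i}.

Definition module_length : \bar int :=
  sup_nat (fun n => exists F, strict_chain n F).

Definition annihilates (a : A) : Prop := forall x : M, a *: x = 0.

End Modules.

Arguments whole {A} M.
Arguments ideal_pow {A} M I n.
Arguments module_length {A} M.

Section Dimension.
Variable A : comNzRingType.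

Definition prime_ideal (p : submodClosed A^o) : Prop :=
  (1 : A) \notin p /\
  forall a b : A, a * b \in p -> a \in p \/ b \in p.

Definition maximal_ideal (p : submodClosed A^o) : Prop :=
  (1 : A) \notin p /\
  forall q : submodClosed A^o, {subset p <= q} -> (1 : A) \notin q ->
    {subset q <= p}.

(* dim_A M is the Krull dimension of A / Ann_A(M); it is -oo for M = 0. *)
Definition mdim (M : lmodType A) : \bar int :=
  sup_nat (fun n => exists F : nat -> submodClosed A^o,
    [/\ forall i, (i <= n)%N -> prime_ideal (F i),
        forall a : A, annihilates M a -> a \in F 0%N
      & strict_chain n F]).

(* dim_A M as a natural number, with 0 for M = 0. *)
Definition ndim (M : lmodType A) : nat := `|fine (mdim M)|%N.

Definition associated_prime (M : lmodType A) (p : submodClosed A^o) : Prop :=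
  prime_ideal p /\ exists x : M, forall a : A, a \in p <-> a *: x = 0.

Definition unmixed (M : lmodType A) : Prop :=
  forall p, associated_prime M p -> mdim (quotient_mod p) = mdim M.

Definition noetherian_ring : Prop :=
  forall I : submodClosed A^o, finitely_generated I.

Definition local_ring (m : submodClosed A^o) : Prop :=
  maximal_ideal m /\ forall p, maximal_ideal p -> p =i m.

(* Bijectivity of A -> lim A / m^n, an element of the limit being
   represented by a sequence of elements of A. *)
Definition adically_complete (m : submodClosed A^o) : Prop :=
  (forall a : A, (forall n, a \in ideal_pow A^o m n) -> a = 0) /\
  (forall u : nat -> A,
     (forall n, u n.+1 - u n \in ideal_pow A^o m n) ->
     exists a : A, forall n, a - u n \in ideal_pow A^o m n).

(* Q is generated by d elements and its radical is m. *)
Definition parameter_ideal (m : submodClosed A^o) (d : nat)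
    (Q : submodClosed A^o) : Prop :=
  (exists x : d.-tuple A^o, Q =i submod_span [set` x]%classic) /\
  (forall a : A, a \in m <-> exists n : nat, a ^+ n \in Q).

End Dimension.

Section Homological.
Variable A : comNzRingType.

Definition linear_maps (U V : lmodType A) : {pred (U -> V)} :=
  fun f => `[< linear f >].
Arguments linear_maps : clear implicits.
Lemma linear_maps_submod_closed (U V : lmodType A) :
  submod_closed (linear_maps U V).
Proof.
split; first by apply/asboolP => a x y; rewrite [RHS]addr0 scaler0.
move=> a f g /asboolP hf /asboolP hg; apply/asboolP => b x y.
have E z : (a *: f + g) z = a *: f z + g z by [].
rewrite !E hf hg !scalerDr !scalerA (mulrC a b) -!addrA.
by congr (_ + _); rewrite addrCA.
Qed.
HB.instance Definition _ (U V : lmodType A) := GRing.isSubmodClosed.Build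
  A (U -> V) (linear_maps U V)
    (GRing.submod_closed_semi (linear_maps_submod_closed U V)).

Definition hom (U V : lmodType A) : lmodType A :=
  submodule_type (linear_maps U V).

Definition injective_module (E : lmodType A) : Prop :=
  forall (U V : lmodType A) (i : {linear U -> V}) (f : {linear U -> E}),
    injective i -> exists g : {linear V -> E}, forall x, g (i x) = f x.

Definition essential (K E : lmodType A) (iota : K -> E) : Prop :=
  forall S : submodClosed E, (exists2 y, y \in S & y != 0) ->
    exists2 x, iota x \in S & iota x != 0.

Definition is_injective_envelope (K E : lmodType A) : Prop :=
  injective_module E /\
  exists iota : {linear K -> E}, injective iota /\ essential iota.

(* Every module has an injective envelope, unique up to isomorphism, so the
   default value of [pick_such] plays no role. *)
Definition injective_envelope (K : lmodType A) : lmodType A :=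
  pick_such K (is_injective_envelope K).

Record injective_resolution (M : lmodType A) := InjectiveResolution {
  ires :> nat -> lmodType A;
  ires_aug : {linear M -> ires 0%N};
  ires_d : forall j, {linear ires j -> ires j.+1};
  _ : forall j, injective_module (ires j);
  _ : injective ires_aug;
  _ : forall x, ires_d 0%N x = 0 <-> exists y, x = ires_aug y;
  _ : forall j x, ires_d j.+1 x = 0 <-> exists y, x = ires_d j y
}.

Variable m : submodClosed A^o.

Lemma ideal_powS (n : nat) : {subset ideal_pow A^o m n.+1 <= ideal_pow A^o m n}.
Proof.
move=> x /asboolP; apply => _ [a [y [_ yS ->]]].
exact: rpredZ.
Qed.

Lemma ideal_pow_le (n k : nat) : (n <= k)%N ->
  {subset ideal_pow A^o m k <= ideal_pow A^o m n}.
Proof.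
move=> /subnK <-; elim: (k - n)%N => [|i IH] // x xI.
by apply/IH/ideal_powS.
Qed.

(* The m-torsion submodule Gamma_m(N). *)
Definition torsion (N : lmodType A) : {pred N} := fun x =>
  `[< exists n : nat, forall a : A, a \in ideal_pow A^o m n -> a *: x = 0 >].
Arguments torsion : clear implicits.
Lemma torsion_submod_closed (N : lmodType A) : submod_closed (torsion N).
Proof.
split; first by apply/asboolP; exists 0%N => a _; rewrite scaler0.
move=> b x y /asboolP[n hn] /asboolP[k hk]; apply/asboolP.
exists (maxn n k) => a ha; rewrite scalerDr scalerA mulrC -scalerA.
rewrite hn ?hk ?scaler0 ?addr0 //.
  exact: (ideal_pow_le (leq_maxr n k)).
exact: (ideal_pow_le (leq_maxl n k)).
Qed.
HB.instance Definition _ (N : lmodType A) := GRing.isSubmodClosed.Build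
  A N (torsion N)
    (GRing.submod_closed_semi (torsion_submod_closed N)).

Section Cohomology.
Variables (M : lmodType A) (I : injective_resolution M).

Definition cocycles (j : nat) : {pred (I j)} := fun x =>
  (x \in torsion (I j)) && (ires_d I j x == 0).
Arguments cocycles : clear implicits.
Lemma cocycles_submod_closed j : submod_closed (cocycles j).
Proof.
split; first by rewrite unfold_in /cocycles linear0 eqxx rpred0.
move=> a x y /andP[xT /eqP dx] /andP[yT /eqP dy]; apply/andP; split.
  by rewrite rpredD ?rpredZ.
by rewrite linearP dx dy scaler0 addr0.
Qed.
HB.instance Definition _ j := GRing.isSubmodClosed.Build
  A (I j) (cocycles j)
    (GRing.submod_closed_semi (cocycles_submod_closed j)).

Definition coboundary (j : nat) : I j -> Prop :=
  if j is i.+1 then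
    fun x => exists2 y : I i, y \in torsion (I i) & x = ires_d I i y
  else fun x => x = 0.

Definition coboundaries (j : nat) : {pred submodule_type (cocycles j)} :=
  fun x => `[< coboundary (val x) >].
Arguments coboundaries : clear implicits.
Lemma coboundaries_submod_closed j : submod_closed (coboundaries j).
Proof.
rewrite /coboundaries; split.
  apply/asboolP; rewrite linear0; case: j => [|j] //=.
  by exists 0; rewrite ?linear0 ?rpred0.
move=> a x y /asboolP hx /asboolP hy; apply/asboolP; rewrite linearP.
case: j x y hx hy => [|j] x y /=; first by move=> -> ->; rewrite scaler0 addr0.
move=> [u uT ->] [v vT ->]; exists (a *: u + v); last by rewrite linearP.
by rewrite rpredD ?rpredZ.
Qed.
HB.instance Definition _ j := GRing.isSubmodClosed.Build A
  (submodule_type (cocycles j)) (coboundaries j)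
    (GRing.submod_closed_semi (coboundaries_submod_closed j)).

(* The j-th cohomology of the complex Gamma_m(I). *)
Definition torsion_cohomology (j : nat) : lmodType A :=
  quotient_mod (coboundaries j).

End Cohomology.

(* H^j_m(M), the j-th right derived functor of Gamma_m at M, computed on some
   injective resolution. Every module has one, and the result does not depend
   on it up to isomorphism. *)
Definition local_cohomology (j : nat) (M : lmodType A) : lmodType A :=
  pick_such M (fun H => exists I : injective_resolution M,
    H = torsion_cohomology I j).

(* M_j = Hom_A(H^j_m(M), E_A(A/m)). *)
Definition matlis_dual_cohomology (M : lmodType A) (j : nat) : lmodType A :=
  hom (local_cohomology j M) (injective_envelope (quotient_mod m)).

End Homological.

Section HilbertCoefficients.
Variable A : comNzRingType.

(* e_I^i(M) for i <= dim_A M: these are the coefficients of a polynomial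
   function, so they are determined by its values for large n. *)
Definition hilbert_coef (I : submodClosed A^o) (M : lmodType A) : nat -> int :=
  pick_such (fun=> 0) (fun e : nat -> int =>
    exists N : nat, forall n : nat, (N <= n)%N ->
    module_length (quotient_mod (ideal_pow M I n.+1)) =
    (\sum_(i < (ndim M).+1)
       (-1) ^+ i * e i * 'C(n + ndim M - i, ndim M - i)%:Z)%:E).

Variables (m I : submodClosed A^o).

(* The recursion on dim_A M, with fuel k >= dim_A M; dim_A M_j <= j < dim_A M
   makes k - 1 enough for the M_j. *)
Fixpoint hdeg_rec (k : nat) (M : lmodType A) : int :=
  if k is k'.+1 then
    if (mdim M <= 0)%E then fine (module_length M)
    else hilbert_coef I M 0
         + \sum_(j < ndim M)
             'C((ndim M).-1, j)%:Z * hdeg_rec k' (matlis_dual_cohomology m M j)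
  else fine (module_length M).

Definition hdeg (M : lmodType A) : int := hdeg_rec (ndim M) M.

(* T_I^i(M) for 1 <= i <= dim_A M - 1. *)
Definition htorsion (i : nat) (M : lmodType A) : int :=
  \sum_(1 <= j < (ndim M - i).+1)
     'C(ndim M - i - 1, j - 1)%:Z * hdeg (matlis_dual_cohomology m M j).

End HilbertCoefficients.

(* Main.v *)
Require Import Defs.
From HB Require Import structures.
From mathcomp Require Import all_boot all_order all_algebra.
From mathcomp Require Import boolp classical_sets functions cardinality.
From mathcomp Require Import constructive_ereal.
From mathcomp Require Import zify ring.
(* Induction on [d], cutting [M] by a generic [a] in [Q]. Such an [a] is superficial for [M] and for
   all its Matlis duals [M_j], so [e_2] is unchanged when [d > 3], and there are exact sequences
   [0 -> M_(j+1) / a M_(j+1) -> (M / aM)_j -> (0 :_(M_j) a) -> 0]. Since [hdeg] does not increase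
   modulo a generic element and bounds the length of the torsion submodule, they give
   [hdeg (M / aM)_j <= hdeg M_(j+1) + hdeg M_j], and Pascal's rule carries both bounds from
   [M / aM] to [M].
   For [d = 3] put [N = M / aM], with torsion submodule [W] and [L = N / W]. Then
   [e_2(M) = e_2(L) + l(W) - l(0 :_M a) = e_2(L) + l(M_1 / a M_1)]. If [x] and [y] generate [Q]
   modulo [Ann L] with [x] superficial, then [e_2(L) <= 0], by summing
   [l(L / (xL + Q^n L)) <= e_0 n - e_1], and [e_2(L) >= - l(0 :_F y^k)] for [F = L / x^k L] and
   [k] large, where [l(0 :_F y^k) <= l(L_1)]. If [M] is unmixed then [dim M_j < j] for
   [0 < j < d], a condition inherited by [M / aM]; for [d = 3] it makes [N_1] of finite length,
   with [l(N_1) = l(M_2 / a M_2) + l(M_1 / a M_1)]. *)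

Set Implicit Arguments.
Unset Strict Implicit.
Unset Printing Implicit Defensive.

Import Order.TTheory GRing.Theory Num.Theory.
Local Open Scope ring_scope.

(** The obstacle is that one cut must serve several purposes at once: [a] has to be superficial for
    [M] and for the [M_j] involved, must not raise [hdeg M_j], and must belong to a generating set
    of [Q], so that one generator fewer is left for [M / aM]. Hence [generic], a notion closed under
    finite conjunctions, and [param], which asks for generators of [Q] only modulo the annihilator.
    Superficial elements need not be regular, so the sequences for [M / aM] are first written for
    [M] modulo its torsion submodule, where [a] is regular. This changes no [M_j] with [j > 0];
    degree 0 is settled by a separate length count ([gam_mquo_len]). Graded associated primes,
    height theory and local duality do not enter. Superficial elements come from a maximality
    argument in the Rees module, lower bounds for the dimension of [M / aM] from the growth of
    Hilbert functions. Finite generation of [M_j] and [dim M_j <= j] follow by induction on [j] from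
    completeness, because [M_j] is [m]-adically separated. *)

Lemma choice_dep (I : Type) (T : I -> Type) (P : forall i, T i -> Prop) :
  (forall i, exists t, P i t) -> exists s : forall i, T i, forall i, P i (s i).
Proof. by move=> h; exists (fun i => projT1 (cid (h i))) => i; apply: (projT2 (cid (h i))). Qed.

Lemma dependent_choice (T : nat -> Type) (P : forall n, T n -> Prop)
    (R : forall n, T n -> T n.+1 -> Prop) (t0 : T 0%N) :
  P 0%N t0 ->
  (forall n t, P n t -> exists t', P n.+1 t' /\ R n t t') ->
  exists s : forall n, T n, s 0%N = t0 /\ forall n, P n (s n) /\ R n (s n) (s n.+1).
Proof.
move=> P0 step.
pose next n (t : {t | P n t}) : {t' | P n.+1 t'} :=
  let h := cid (step n _ (projT2 t)) in exist _ (projT1 h) (projT2 h).1.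
pose s := fix s n : {t | P n t} :=
  if n is k.+1 then next k (s k) else exist _ t0 P0.
exists (fun n => sval (s n)); split=> // n; split; first exact: svalP.
by rewrite /=; case: cid => t' [].
Qed.

(** Without a maximal element, dependent choice would build an infinite [R]-chain inside [P]. With
    [R] a strict growth relation this is Noetherian induction, in the form of picking a maximal
    element. *)
Lemma ascending_max (T : Type) (R : T -> T -> Prop) (P : T -> Prop) :
  (forall u : nat -> T, (forall n, P (u n)) -> ~ (forall n, R (u n) (u n.+1))) ->
  (exists x, P x) -> exists2 x, P x & forall y, P y -> ~ R x y.
Proof.
move=> hR [x0 Px0]; apply: contrapT => nomax.
have step (_ : nat) x : P x -> exists y, P y /\ R x y.
  move=> Px; apply: contrapT => h; apply: nomax; exists x => // y Py Rxy.
  by apply: h; exists y.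
have [u [_ hu]] := @dependent_choice (fun=> T) (fun=> P) (fun=> R) x0 Px0 step.
by apply: (hR u) => n; case: (hu n).
Qed.

(** * Submodules and Noetherian modules *)

Section Submodules.
Variable A : comNzRingType.
Implicit Types M : lmodType A.

(** Membership is a plain [Prop], so that submodules with the same elements are equal ([subm_eq])
    and can be rewritten; [toS] and [ofS] translate to and from [submodClosed]. *)
Record submodule M := SubM {
  submodule_pred :> M -> Prop;
  sub0 : submodule_pred 0;
  subL : forall a x y, submodule_pred x -> submodule_pred y ->
    submodule_pred (a *: x + y) }.

Lemma subm_eq M (S T : submodule M) : (forall x, S x <-> T x) -> S = T.
Proof.
case: S T => [S S0 SL] [T T0 TL] /= h.
have E : S = T by apply/funext=> x; apply/propext.
by subst T; congr SubM; exact: Prop_irrelevance.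
Qed.

Section Closure.
Variables (M : lmodType A) (S : submodule M).
Lemma subZ a x : S x -> S (a *: x).
Proof. by move=> Sx; rewrite -[_ *: _]addr0; apply: subL => //; apply: sub0. Qed.
Lemma subD x y : S x -> S y -> S (x + y).
Proof. by move=> Sx Sy; rewrite -[x]scale1r; apply: subL. Qed.
Lemma subN x : S x -> S (- x).
Proof. by rewrite -scaleN1r; apply: subZ. Qed.
Lemma subB x y : S x -> S y -> S (x - y).
Proof. by move=> Sx Sy; apply: subD => //; apply: subN. Qed.
Lemma sub_sum (I : Type) (r : seq I) (P : pred I) (F : I -> M) :
  (forall i, P i -> S (F i)) -> S (\sum_(i <- r | P i) F i).
Proof. by move=> h; elim/big_ind: _ => //; [exact: sub0 | exact: subD]. Qed.
Lemma subDr x y : S x -> S (x + y) <-> S y.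
Proof.
move=> Sx; split; last exact: subD.
by move=> Sxy; rewrite -(addKr x y); apply: subD => //; apply: subN.
Qed.
End Closure.

Definition sle M (S T : submodule M) := forall x, S x -> T x.
End Submodules.

Notation "S ≤ T" := (sle S T) (at level 70, no associativity).
Notation ideal A := (submodule A^o).

Section Operations.
Variable A : comNzRingType.
Implicit Types M N : lmodType A.
Implicit Types I J : ideal A.

Lemma sle_refl M (S : submodule M) : S ≤ S. Proof. by []. Qed.
Lemma sle_trans M (S T U : submodule M) : S ≤ T -> T ≤ U -> S ≤ U.
Proof. by move=> h k x /h/k. Qed.
Lemma sle_anti M (S T : submodule M) : S ≤ T -> T ≤ S -> S = T.
Proof. by move=> h k; apply: subm_eq => x; split=> [/h|/k]. Qed.

Definition topS M : submodule M :=
  @SubM A M (fun=> True) Logic.I (fun _ _ _ _ _ => Logic.I).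

Lemma botS_subproof M (a : A) (x y : M) : x = 0 -> y = 0 -> a *: x + y = 0.
Proof. by move=> -> ->; rewrite scaler0 addr0. Qed.
Definition botS M : submodule M :=
  @SubM A M (fun x => x = 0) erefl (@botS_subproof M).

Lemma capS_subproof M (S T : submodule M) a x y :
  S x /\ T x -> S y /\ T y -> S (a *: x + y) /\ T (a *: x + y).
Proof. by move=> [? ?] [? ?]; split; apply: subL. Qed.
Definition capS M (S T : submodule M) : submodule M :=
  @SubM A M (fun x => S x /\ T x) (conj (sub0 S) (sub0 T)) (@capS_subproof M S T).

Definition add_pred M (S T : submodule M) x := exists y z, [/\ S y, T z & x = y + z].
Lemma addS0 M (S T : submodule M) : add_pred S T 0.
Proof. by exists 0, 0; rewrite addr0; split=> //; exact: sub0. Qed.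
Lemma addSL M (S T : submodule M) a x y :
  add_pred S T x -> add_pred S T y -> add_pred S T (a *: x + y).
Proof.
move=> [y1 [z1 [S1 T1 ->]]] [y2 [z2 [S2 T2 ->]]].
exists (a *: y1 + y2), (a *: z1 + z2); split; try exact: subL.
by rewrite scalerDr addrACA.
Qed.
Definition addS M (S T : submodule M) : submodule M := SubM (addS0 S T) (@addSL M S T).

Definition span_pred M (X : M -> Prop) x := forall S : submodule M, (forall y, X y -> S y) -> S x.
Lemma spanS0 M X : @span_pred M X 0. Proof. by move=> S _; exact: sub0. Qed.
Lemma spanSL M X a x y :
  @span_pred M X x -> span_pred X y -> span_pred X (a *: x + y).
Proof. by move=> hx hy S hS; apply: subL; [apply: hx|apply: hy]. Qed.
Definition spanS M X : submodule M := locked (SubM (@spanS0 M X) (@spanSL M X)).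
Lemma spanSE M X x : spanS X x = @span_pred M X x.
Proof. by rewrite /spanS -lock. Qed.

Lemma preS_subproof M N (f : {linear M -> N}) (S : submodule N) a x y :
  S (f x) -> S (f y) -> S (f (a *: x + y)).
Proof. by rewrite linearP; apply: subL. Qed.
Lemma preS0 M N (f : {linear M -> N}) (S : submodule N) : S (f 0).
Proof. by rewrite linear0; apply: sub0. Qed.
Definition preS M N (f : {linear M -> N}) (S : submodule N) : submodule M :=
  @SubM A M (fun x => S (f x)) (preS0 f S) (@preS_subproof M N f S).

Definition img_pred M N (f : {linear M -> N}) (S : submodule M) y :=
  exists2 x, S x & y = f x.
Lemma imgS0 M N (f : {linear M -> N}) S : img_pred f S 0.
Proof. by exists 0; [apply: sub0 | rewrite linear0]. Qed.
Lemma imgSL M N (f : {linear M -> N}) S a x y :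
  img_pred f S x -> img_pred f S y -> img_pred f S (a *: x + y).
Proof.
move=> [u Su ->] [v Sv ->]; exists (a *: u + v); first exact: subL.
by rewrite linearP.
Qed.
Definition imgS M N (f : {linear M -> N}) S : submodule N :=
  SubM (imgS0 f S) (@imgSL M N f S).

Definition mkLinear M N (f : M -> N) (fL : linear f) : {linear M -> N} :=
  HB.pack f (GRing.isLinear.Build A M N *:%R f fL).

Lemma scal_linear M (a : A) : linear (fun x : M => a *: x).
Proof. by move=> b x y; rewrite scalerDr !scalerA mulrC. Qed.
(** [imS (scal M a)] is [aM], [kerS (scal M a)] is [(0 :_M a)], and [preS (scal M a) U] is
    [(U :_M a)]. *)
Definition scal M a : {linear M -> M} := mkLinear (@scal_linear M a).

Lemma actL_linear M (x : M) : linear (fun c : A^o => c *: x).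
Proof. by move=> a b d; rewrite scalerDl scalerA. Qed.
(** Preimages of submodules under this map are the colon ideals [(U : x)], and its kernel is the
    annihilator of [x]. *)
Definition actL M x : {linear A^o -> M} := mkLinear (@actL_linear M x).

Definition smul (I : ideal A) M (S : submodule M) : submodule M :=
  spanS (fun y => exists (a : A) x, [/\ I a, S x & y = a *: x]).
Definition ipow (I : ideal A) M n : submodule M := iter n (@smul I M) (topS M).
Definition seqS M (s : seq M) : submodule M := spanS (fun x => x \in s).
Definition fg M (S : submodule M) := exists s : seq M, S = seqS s.

Definition annS M : ideal A.
Proof.
exists (fun a : A => forall x : M, a *: x = 0) => [x|a b c hb hc x].
  by rewrite scale0r.
by rewrite [a *: _]/(a * b) scalerDl -scalerA hb hc scaler0 addr0.
Defined.

Lemma spanP M (X : M -> Prop) x : X x -> spanS X x.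
Proof. by move=> Xx; rewrite spanSE => S; apply. Qed.
Lemma span_le M (X : M -> Prop) (S : submodule M) : (forall y, X y -> S y) -> spanS X ≤ S.
Proof. by move=> h x; rewrite spanSE; apply. Qed.
Lemma add_le M (S T U : submodule M) : S ≤ U -> T ≤ U -> addS S T ≤ U.
Proof. by move=> h k _ [y [z [/h Sy /k Tz ->]]]; apply: subD. Qed.
Lemma le_addl M (S T : submodule M) : S ≤ addS S T.
Proof. by move=> x Sx; exists x, 0; rewrite addr0; split=> //; apply: sub0. Qed.
Lemma le_addr M (S T : submodule M) : T ≤ addS S T.
Proof. by move=> x Sx; exists 0, x; rewrite add0r; split=> //; apply: sub0. Qed.
Lemma addS_mono M (S S' T T' : submodule M) : S ≤ S' -> T ≤ T' -> addS S T ≤ addS S' T'.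
Proof. by move=> h k _ [y [z [/h Sy /k Tz ->]]]; exists y, z. Qed.
Lemma addSC M (S T : submodule M) : addS S T = addS T S.
Proof. by apply: subm_eq => x; split=> -[y [z [? ? ->]]]; exists z, y; rewrite addrC. Qed.
Lemma addSA M (S T U : submodule M) : addS S (addS T U) = addS (addS S T) U.
Proof.
apply: subm_eq => x; split.
  move=> [y [_ [Sy [z [t [Tz Ut ->]]] ->]]]; exists (y + z), t; rewrite addrA; split=> //.
  by exists y, z.
move=> [_ [t [[y [z [Sy Tz ->]]] Ut ->]]]; exists y, (z + t); rewrite addrA; split=> //.
by exists z, t.
Qed.
Lemma smulP I M (S : submodule M) (a : A) x : I a -> S x -> smul I S (a *: x).
Proof. by move=> Ia Sx; apply: spanP; exists a, x. Qed.
Lemma smul_le I M (S T : submodule M) :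
  (forall (a : A) x, I a -> S x -> T (a *: x)) -> smul I S ≤ T.
Proof. by move=> h; apply: span_le => _ [a [x [Ia Sx ->]]]; apply: h. Qed.
Lemma smul_mono I J M (S T : submodule M) : I ≤ J -> S ≤ T -> smul I S ≤ smul J T.
Proof. by move=> h k; apply: smul_le => a x /h Ia /k Tx; apply: smulP. Qed.
Lemma smul_sub I M (S : submodule M) : smul I S ≤ S.
Proof. by apply: smul_le => a x _; apply: subZ. Qed.
Lemma smul_add I M (S T : submodule M) : smul I (addS S T) = addS (smul I S) (smul I T).
Proof.
apply: sle_anti.
  apply: smul_le => a _ Ia [y [z [Sy Tz ->]]]; rewrite scalerDr.
  by exists (a *: y), (a *: z); split=> //; apply: smulP.
by apply: add_le; apply: smul_mono => //; [apply: le_addl | apply: le_addr].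
Qed.
Lemma smulA I J M (S : submodule M) :
  smul I (smul J S) = smul (smul I J) S.
Proof.
apply: sle_anti.
  apply: smul_le => a x Ia.
  apply: (span_le (S := preS (scal M a) (smul (smul I J) S))) => _ [b [y [Jb Sy ->]]].
  rewrite /= scalerA; apply: smulP => //.
  by apply: (@smulP I A^o J a b).
apply: smul_le => c x + Sx.
pose K : ideal A := preS (actL x) (smul I (smul J S)).
suff : smul I J ≤ K by apply.
apply: smul_le => a b Ia Jb; rewrite /= -scalerA; apply: smulP => //; exact: smulP.
Qed.

Lemma ipowS I M n : ipow I M n.+1 = smul I (ipow I M n). Proof. by []. Qed.
Lemma ipow_le I M n k : (n <= k)%N -> ipow I M k ≤ ipow I M n.
Proof.
move/subnK => <-; elim: (k - n)%N => [|i IH] // x; rewrite addSn ipowS => /smul_sub; apply: IH.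
Qed.
Lemma ipowM I M (a : A) n x : I a -> ipow I M n x -> ipow I M n.+1 (a *: x).
Proof. exact: smulP. Qed.
Lemma ipowD I M n k : ipow I M (n + k) = iter n (@smul I M) (ipow I M k).
Proof. by rewrite /ipow iterD. Qed.
Lemma smul_ipow I M (S : submodule M) n :
  iter n (@smul I M) S = smul (ipow I A^o n) S.
Proof.
elim: n => [|n IH] /=; last by rewrite IH smulA.
apply: sle_anti; last exact: smul_sub.
by move=> x Sx; rewrite -[x]scale1r; apply: smulP.
Qed.
Lemma ipow_smul I M n k : ipow I M (n + k) = smul (ipow I A^o n) (ipow I M k).
Proof. by rewrite ipowD smul_ipow. Qed.
Lemma ipowZ I M n k (a : A) x : ipow I A^o n a -> ipow I M k x -> ipow I M (n + k) (a *: x).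
Proof. by rewrite ipow_smul; apply: smulP. Qed.
Lemma ipowE I M n : ipow I M n = smul (ipow I A^o n) (topS M).
Proof. by rewrite -[n in LHS]addn0 ipow_smul. Qed.
Lemma ipow_mono I J M n : I ≤ J -> ipow I M n ≤ ipow J M n.
Proof. by move=> h; elim: n => //= n IH; apply: smul_mono. Qed.
Lemma ipow_add I M n k : ipow I M (n * k) = ipow (ipow I A^o n) M k.
Proof. by elim: k => [|k IH]; rewrite ?muln0 // mulnS ipow_smul IH. Qed.

Lemma img_span M N (f : {linear M -> N}) X : imgS f (spanS X) = spanS (fun y => exists2 x, X x & y = f x).
Proof.
apply: sle_anti.
  move=> _ [x Xx ->]; suff: spanS X ≤ preS f (spanS (fun y => exists2 x, X x & y = f x)) by apply.
  by apply: span_le => y Xy; apply: spanP; exists y.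
by apply: span_le => _ [x Xx ->]; exists x => //; apply: spanP.
Qed.
Lemma img_smul I M N (f : {linear M -> N}) S : imgS f (smul I S) = smul I (imgS f S).
Proof.
rewrite img_span; apply: sle_anti.
  apply: span_le => _ [_ [a [x [Ia Sx ->]]] ->]; rewrite linearZ; apply: smulP => //.
  by exists x.
apply: smul_le => a _ Ia [x Sx ->]; apply: spanP; exists (a *: x); last by rewrite linearZ.
by exists a, x.
Qed.
Lemma img_ipow I M N (f : {linear M -> N}) n :
  imgS f (topS M) = topS N -> imgS f (ipow I M n) = ipow I N n.
Proof. by move=> h; elim: n => //= n IH; rewrite img_smul IH. Qed.
Lemma map_ipow I M N (f : {linear M -> N}) n x : ipow I M n x -> ipow I N n (f x).
Proof.
elim: n x => [|n IH] // x.
suff : ipow I M n.+1 ≤ preS f (ipow I N n.+1) by apply.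
by apply: smul_le => a y Ia /IH; rewrite /= linearZ; apply: ipowM.
Qed.

Lemma seqS_cons M (x : M) s : seqS (x :: s) = addS (seqS [:: x]) (seqS s).
Proof.
apply: sle_anti.
  apply: span_le => y; rewrite inE => /orP[/eqP->|ys].
    by apply: le_addl; apply: spanP; rewrite inE.
  by apply: le_addr; apply: spanP.
apply: add_le; apply: span_le => y; rewrite ?inE => h; apply: spanP; rewrite inE ?h //.
by rewrite orbT.
Qed.
Lemma seq1P M (x y : M) : seqS [:: x] y <-> exists a, y = a *: x.
Proof.
split; last by move=> [a ->]; apply: subZ; apply: spanP; rewrite inE.
have h0 : exists a : A, 0 = a *: x by exists 0; rewrite scale0r.
have hL (a : A) (u v : M) : (exists b : A, u = b *: x) -> (exists b : A, v = b *: x) -> exists b : A, a *: u + v = b *: x.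
  by move=> [b ->] [c ->]; exists (a * b + c); rewrite scalerDl scalerA.
apply: (span_le (S := SubM h0 hL)) => z; rewrite inE => /eqP->.
by exists 1; rewrite scale1r.
Qed.
Lemma seqS_nil M : seqS [::] = botS M.
Proof. by apply: sle_anti => [|x -> ]; [apply: span_le | apply: sub0]. Qed.
Lemma seqS_sumP M (s : seq M) x :
  seqS s x -> exists c : 'I_(size s) -> A, x = \sum_i c i *: s`_i.
Proof.
elim: s x => [|y s IH] x; first by rewrite seqS_nil => ->; exists (fun=> 0); rewrite big_ord0.
rewrite seqS_cons => -[_ [z [/seq1P[a ->] /IH[c ->] ->]]].
exists (fun i => if unlift ord0 i is Some j then c j else a).
rewrite big_ord_recl unlift_none /=; congr (_ + _).
by apply: eq_bigr => i _; rewrite liftK.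
Qed.
Lemma seqS_sum M (s : seq M) (c : 'I_(size s) -> A) : seqS s (\sum_i c i *: s`_i).
Proof. by apply: sub_sum => i _; apply: subZ; apply: spanP; rewrite mem_nth. Qed.
Lemma img_seqS M N (f : {linear M -> N}) s : imgS f (seqS s) = seqS (map f s).
Proof.
rewrite img_span; congr spanS; apply/funext => y; apply/propext; split.
  by move=> [x xs ->]; apply/mapP; exists x.
by move/mapP.
Qed.
Lemma img_fg M N (f : {linear M -> N}) S : fg S -> fg (imgS f S).
Proof. by move=> [s ->]; exists (map f s); rewrite img_seqS. Qed.
Lemma add_fg M (S T : submodule M) : fg S -> fg T -> fg (addS S T).
Proof.
move=> [s ->] [t ->]; exists (s ++ t); elim: s => [|x s IH] /=.
  by rewrite seqS_nil; apply: sle_anti; [apply: add_le => // y ->; apply: sub0 | apply: le_addr].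
by rewrite (seqS_cons x s) (seqS_cons x (s ++ t)) -IH addSA.
Qed.
End Operations.

(** * Quotient modules, submodules as modules, factorization of linear maps *)

Section Quotients.
Local Open Scope quotient_scope.
Variable A : comNzRingType.
Implicit Types M N : lmodType A.

Definition ofS M (S : submodClosed M) : submodule M.
Proof.
exists (fun x => x \in S); first exact: rpred0.
by move=> a x y Sx Sy; rewrite rpredD ?rpredZ.
Defined.

Section ToS.
Variables (M : lmodType A) (S : submodule M).
Definition toS_pred : {pred M} := fun x => `[< S x >].
Lemma toS_closed : submod_closed toS_pred.
Proof.
split; first by apply/asboolP; apply: sub0.
by move=> a x y /asboolP Sx /asboolP Sy; apply/asboolP; apply: subL.
Qed.
HB.instance Definition _ := GRing.isSubmodClosed.Build A M toS_pred
  (GRing.submod_closed_semi toS_closed).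
Definition toS : submodClosed M := toS_pred.
Lemma toSP x : reflect (S x) (x \in toS).
Proof. exact: asboolP. Qed.
End ToS.

Lemma ofSK M (S : submodule M) : ofS (toS S) = S.
Proof. by apply: subm_eq => x; split=> /toSP. Qed.

Definition onto M N (f : {linear M -> N}) := forall y, exists x, y = f x.
Definition kerS M N (f : {linear M -> N}) := preS f (botS N).
Definition imS M N (f : {linear M -> N}) := imgS f (topS M).

Section Proj.
Variables (M : lmodType A) (S : submodClosed M).
Lemma proj_linear : linear (\pi_(quotient_mod S) : M -> quotient_mod S).
Proof.
move=> a x y; apply: etrans (quotient_pi_add S (a *: x) y) _.
by have := esym (quotient_scale_pi S a x); rewrite /GRing.scale /= => ->.
Qed.
Definition proj : {linear M -> quotient_mod S} := mkLinear proj_linear.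
Lemma proj_onto : onto proj.
Proof. by move=> y; exists (repr y); rewrite /= reprK. Qed.
Lemma projE x y : proj x = proj y <-> x - y \in S.
Proof.
split=> [/eqP|] h; last apply/eqP.
  by rewrite -[_ \in S]/(_ \in subgroup_of S) Quotient.idealrBE.
by rewrite -[_ == _]Quotient.idealrBE.
Qed.
Lemma proj_ker : kerS proj = ofS S.
Proof.
apply: subm_eq => x; rewrite -[ofS S x]/(is_true (x \in S)) -[in X in _ <-> X](subr0 x).
by rewrite -(projE x 0) linear0.
Qed.
End Proj.
End Quotients.

Section Maps.
Variable A : comNzRingType.
Implicit Types M N P : lmodType A.

Definition qmod M (S : submodule M) : lmodType A := quotient_mod (toS S).
Definition prj M (S : submodule M) : {linear M -> qmod S} := proj (toS S).
Lemma prj_onto M (S : submodule M) : onto (prj S).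
Proof. exact: proj_onto. Qed.
Lemma prj0 M (S : submodule M) x : prj S x = 0 <-> S x.
Proof. by rewrite -[prj S x = 0]/(kerS (proj (toS S)) x) proj_ker ofSK. Qed.
Lemma prjE M (S : submodule M) x y : prj S x = prj S y <-> S (x - y).
Proof. by rewrite -prj0 linearB; split=> [->|/subr0_eq //]; rewrite subrr. Qed.

Definition smd M (S : submodule M) : lmodType A := submodule_type (toS S).
Lemma inc_linear M (S : submodule M) : linear (val : smd S -> M).
Proof. by move=> a x y; rewrite linearP. Qed.
Definition inc M (S : submodule M) : {linear smd S -> M} := mkLinear (@inc_linear M S).
Lemma incP M (S : submodule M) u : S (inc S u).
Proof. by apply/toSP; apply: (valP u). Qed.
Lemma inc_injective M (S : submodule M) : injective (inc S).
Proof. exact: val_inj. Qed.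
Lemma inc_onto M (S : submodule M) x : S x -> exists u, x = inc S u.
Proof. by move=> /toSP h; exists (Submodule h). Qed.

Lemma linear_injP M N (f : {linear M -> N}) :
  (forall x, f x = 0 -> x = 0) -> injective f.
Proof.
by move=> h x y exy; apply: subr0_eq; apply: h; rewrite linearB exy subrr.
Qed.
Lemma linear_inj0 M N (f : {linear M -> N}) x : injective f -> f x = 0 -> x = 0.
Proof. by move=> h; rewrite -[0 in X in X -> _](linear0 f) => /h. Qed.

Lemma factor_onto M N P (p : {linear M -> P}) (f : {linear M -> N}) :
  onto p -> (forall x, p x = 0 -> f x = 0) ->
  exists g : {linear P -> N}, forall x, g (p x) = f x.
Proof.
move=> ps pf; pose s y := sval (cid (ps y)).
have sK y : p (s y) = y by rewrite /s; case: cid.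
have fs x : f (s (p x)) = f x.
  by apply: subr0_eq; rewrite -linearB; apply: pf; rewrite linearB sK subrr.
have gL : linear (fun y => f (s y)).
  move=> a x y; rewrite -linearP -[RHS]fs; congr (f (s _)).
  by rewrite linearP !sK.
by exists (mkLinear gL).
Qed.

Lemma factor_inj M N P (i : {linear P -> N}) (f : {linear M -> N}) :
  injective i -> (forall x, exists u, f x = i u) ->
  exists g : {linear M -> P}, forall x, i (g x) = f x.
Proof.
move=> ii fi; pose s x := sval (cid (fi x)).
have sK x : i (s x) = f x by rewrite /s; case: cid.
have gL : linear s.
  by move=> a x y; apply: ii; rewrite linearP !sK linearP.
by exists (mkLinear gL).
Qed.

Definition isom M N := exists f : {linear M -> N}, injective f /\ onto f.
Lemma isom_sym M N : isom M N -> isom N M.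
Proof.
move=> [f [fi fs]].
have [g gf] := @factor_onto M M N f (scal M 1) fs (fun x e =>
  etrans (congr1 (fun z => 1 *: z) (linear_inj0 fi e)) (scaler0 _ _)).
exists g; split.
  by move=> x y; have [u ->] := fs x; have [v ->] := fs y; rewrite !gf /= !scale1r => ->.
by move=> y; exists (f y); rewrite gf /= scale1r.
Qed.
Lemma comp_linear M N P (f : {linear M -> N}) (g : {linear N -> P}) : linear (g \o f).
Proof. by move=> a x y; rewrite /= !linearP. Qed.
Definition compL M N P (g : {linear N -> P}) (f : {linear M -> N}) : {linear M -> P} :=
  mkLinear (comp_linear f g).
Lemma isom_trans M N P : isom M N -> isom N P -> isom M P.
Proof.
move=> [f [fi fs]] [g [gi gs]]; exists (compL g f); split.
  by move=> x y /= /gi/fi.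
by move=> z; have [y ->] := gs z; have [x ->] := fs y; exists x.
Qed.
Lemma isom_prj M N (p : {linear M -> N}) (S : submodule M) :
  onto p -> (forall x, p x = 0 <-> S x) -> isom (qmod S) N.
Proof.
move=> ps pk; have [g gE] := @factor_onto M N _ (prj S) p (prj_onto (S:=S))
  (fun x e => (pk x).2 ((prj0 S x).1 e)).
exists g; split; last by move=> y; have [x ->] := ps y; exists (prj S x).
apply: linear_injP => y; have [x ->] := prj_onto y.
by rewrite gE => /pk/prj0.
Qed.
Lemma isom_inc M N (i : {linear N -> M}) (S : submodule M) :
  injective i -> (forall x, S x <-> exists u, x = i u) -> isom N (smd S).
Proof.
move=> ii iS; have [g gE] := @factor_inj N M _ (inc S) i (@inc_injective _ S)
  (fun x => inc_onto ((iS (i x)).2 (ex_intro _ x erefl))).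
exists g; split; first by move=> x y e; apply: ii; rewrite -!gE e.
move=> u; have [v vE] := (iS _).1 (incP u); exists v.
by apply: inc_injective; rewrite gE.
Qed.

Lemma fg_onto M N (p : {linear M -> N}) : onto p -> fg (topS M) -> fg (topS N).
Proof.
move=> ps /(img_fg p); congr fg; apply: subm_eq => y; split=> // _.
by have [x ->] := ps y; exists x.
Qed.
Lemma fg_smd M (S : submodule M) : fg S -> fg (topS (smd S)).
Proof.
move=> [s sE]; have h : forall x, x \in s -> exists u : smd S, x = inc S u.
  by move=> x xs; apply: inc_onto; rewrite sE; apply: spanP.
have [t tE] : exists t : seq (smd S), s = map (inc S) t.
  elim: s {sE} h => [|x s IH] h; first by exists [::].
  have [|t ->] := IH; first by move=> y ys; apply: h; rewrite inE ys orbT.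
  by have [|u ->] := h x; [rewrite inE eqxx | exists (u :: t)].
exists t; apply: sle_anti => // u _.
have : seqS s (inc S u) by rewrite -sE; apply: incP.
by rewrite tE -img_seqS => -[v vt /inc_injective ->].
Qed.
End Maps.
Arguments prj_onto {A M} S y.

(** * Ascending chains in finitely generated modules over a Noetherian ring *)

Section Noetherian.
Variable A : comNzRingType.
Implicit Types M N : lmodType A.

Definition acc_in M (S : submodule M) := forall U : nat -> submodule M,
  (forall k, U k ≤ U k.+1) -> (forall k, U k ≤ S) ->
  exists k, forall i, (k <= i)%N -> U i = U k.

Lemma eqS_mem M (S T : submodule M) x : S = T -> S x -> T x.
Proof. by move=> ->. Qed.

Lemma chain_le M (U : nat -> submodule M) :
  (forall k, U k ≤ U k.+1) -> forall i j, (i <= j)%N -> U i ≤ U j.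
Proof.
move=> h i j /subnK <-; elim: (j - i)%N => [|k IH] // x.
by move=> /IH; apply: h.
Qed.

Lemma unionS0 M (U : nat -> submodule M) : exists k, U k 0.
Proof. by exists 0%N; apply: sub0. Qed.
Lemma unionSL M (U : nat -> submodule M) (h : forall k, U k ≤ U k.+1) a x y :
  (exists k, U k x) -> (exists k, U k y) -> exists k, U k (a *: x + y).
Proof.
move=> [i Ui] [j Uj]; exists (maxn i j).
by apply: subL; [move: Ui | move: Uj]; apply: (chain_le h); rewrite ?leq_maxl ?leq_maxr.
Qed.
Definition unionS M (U : nat -> submodule M) (h : forall k, U k ≤ U k.+1) :=
  @SubM A M (fun x => exists k, U k x) (unionS0 U) (unionSL h).

Lemma fg_acc_union M (U : nat -> submodule M) (h : forall k, U k ≤ U k.+1) :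
  fg (unionS h) -> exists k, forall i, (k <= i)%N -> U i = U k.
Proof.
move=> [s sE].
have [k hk] : exists k, forall x, x \in s -> U k x.
  have : forall x, x \in s -> unionS h x by move=> x xs; rewrite sE; apply: spanP.
  elim: s {sE} => [|x s IH] hs; first by exists 0%N.
  have [|k hk] := IH; first by move=> y ys; apply: hs; rewrite inE ys orbT.
  have [|j hj] := hs x; first by rewrite inE eqxx.
  exists (maxn k j) => y; rewrite inE => /orP[/eqP->|/hk].
    by move: hj; apply: (chain_le h); rewrite leq_maxr.
  by apply: (chain_le h); rewrite leq_maxl.
exists k => i ki; apply: sle_anti; last exact: (chain_le h).
have : unionS h ≤ U k by rewrite sE; apply: span_le.
by move=> hU x Ux; apply: hU; exists i.
Qed.

Hypothesis noethA : noetherian_ring A.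

Lemma ideal_fg (I : ideal A) : fg I.
Proof.
have [s sE] := noethA (toS I); exists s; apply: subm_eq => x.
have -> : I x <-> x \in toS I by split=> /toSP.
rewrite sE; split.
  move=> /asboolP h; rewrite spanSE => S hS; apply/toSP; apply: h => y ys.
  by apply/toSP; apply: hS.
move=> h; apply/asboolP => S hS; suff: seqS s ≤ ofS S by apply.
by apply: span_le.
Qed.

Lemma ideal_acc (U : nat -> ideal A) : (forall k, U k ≤ U k.+1) ->
  exists k, forall i, (k <= i)%N -> U i = U k.
Proof. by move=> h; apply: (fg_acc_union (h := h)); apply: ideal_fg. Qed.

Lemma acc_add M (S : submodule M) y : acc_in S -> acc_in (addS (seqS [:: y]) S).
Proof.
move=> aS U hU US.
(* Two stationary chains control [U]: the traces on [S], and the ideals of those [a] with [a *: y]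
   in [S + U k]. For [x = a *: y + s] in [U i], the second lets an element [z] of an earlier [U k]
   have the same part along [y] modulo [S], and [x - z] is then in the trace. *)
have [k0 h0] := aS (fun k => capS (U k) S)
  (fun k x h => conj (hU k x h.1) h.2) (fun k x h => h.2).
have [k1 h1] := @ideal_acc (fun k => preS (actL y) (addS S (U k)))
  (fun k x => @addS_mono _ _ _ _ _ _ (@sle_refl _ _ _) (hU k) _).
exists (maxn k0 k1) => i hi; apply: sle_anti; last exact: (chain_le hU).
move=> x Ux; have [_ [s [/seq1P[a ->] Ss xE]]] := US _ _ Ux.
have hk0 : (k0 <= i)%N by apply: leq_trans hi; rewrite leq_maxl.
have hk1 : (k1 <= i)%N by apply: leq_trans hi; rewrite leq_maxr.
have : preS (actL y) (addS S (U i)) a.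
  exists (- s), x; split=> //; first exact: subN.
  by rewrite xE /= [- s + _]addrC addrK.
move=> /(eqS_mem (etrans (h1 _ hk1) (esym (h1 _ (leq_maxr k0 k1))))) -[t [z [St Uz /= ayE]]].
have : capS (U i) S (x - z).
  split; first by apply: subB => //; move: Uz; apply: (chain_le hU).
  by rewrite xE ayE addrAC addrK; apply: subD.
move=> /(eqS_mem (etrans (h0 _ hk0) (esym (h0 _ (leq_maxl k0 k1))))) -[h _].
by rewrite -(subrK z x); apply: subD.
Qed.

Lemma fg_acc M (S : submodule M) : fg S -> acc_in S.
Proof.
move=> [s ->]; elim: s => [|y s IH]; last by rewrite seqS_cons; apply: acc_add.
rewrite seqS_nil => U hU Ub; exists 0%N => i _; apply: sle_anti => x /Ub ->; exact: sub0.
Qed.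

Lemma acc_sup M (S : submodule M) (P : submodule M -> Prop) : acc_in S ->
  (forall T, P T -> T ≤ S) -> (exists T, P T) ->
  exists2 T, P T & forall T', P T' -> T ≤ T' -> T' = T.
Proof.
move=> aS PS exP.
have [|T PT Tmax] := @ascending_max (submodule M) (fun T T' => T ≤ T' /\ T' <> T) P _ exP.
  move=> u Pu hu; have [k hk] := aS u (fun k => (hu k).1) (fun k => PS _ (Pu k)).
  by case: (hu k) => _; apply; apply: hk.
exists T => // T' PT' le; apply: contrapT => ne; exact: (Tmax _ PT').
Qed.

Lemma acc_fg M (S : submodule M) : acc_in S -> fg S.
Proof.
move=> aS; have [||T [fT TS] Tmax] := @acc_sup M S (fun T => fg T /\ T ≤ S) aS.
- by move=> T [].
- by exists (botS M); split; [exists [::]; rewrite seqS_nil | move=> x ->; apply: sub0].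
suff -> : S = T by [].
apply: sle_anti => // x Sx.
rewrite -(Tmax (addS T (seqS [:: x]))); last exact: le_addl.
  by apply: le_addr; apply: spanP; rewrite inE.
split; first by apply: add_fg => //; exists [:: x].
by apply: add_le => //; apply: span_le => y; rewrite inE => /eqP->.
Qed.

Lemma le_fg M (S T : submodule M) : fg T -> S ≤ T -> fg S.
Proof.
move=> /fg_acc aT ST; apply: acc_fg => U hU US; apply: aT => // k.
exact: sle_trans ST.
Qed.
Lemma fg_inj M N (i : {linear M -> N}) : injective i -> fg (topS N) -> fg (topS M).
Proof.
move=> ii /(@le_fg _ (imS i)) h.
have fi : fg (imS i) by apply: h.
have [f [fi' fs]] : isom (smd (imS i)) M.
  by apply/isom_sym/(isom_inc ii) => x; split=> [[u _ ->]|[u ->]]; exists u.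
exact: fg_onto fs (fg_smd fi).
Qed.
Lemma top_fg : fg (topS A^o). Proof. exact: ideal_fg. Qed.
End Noetherian.

Section Fg.
Variable A : comNzRingType.
End Fg.

(** * Length *)

Section Length.
Variable A : comNzRingType.
Implicit Types M N P : lmodType A.

Definition covers M (S T : submodule M) :=
  [/\ S ≤ T, ~ T ≤ S & forall U, S ≤ U -> U ≤ T -> U ≤ S \/ T ≤ U].

Fixpoint clen M n (S T : submodule M) : Prop :=
  if n is k.+1 then exists2 U, covers S U & clen k U T else S = T.

Lemma clen_le M n (S T : submodule M) : clen n S T -> S ≤ T.
Proof.
elim: n S => [|n IH] S /=; first by move=> ->.
by move=> [U [SU _ _] /IH UT]; apply: sle_trans UT.
Qed.

Lemma clen_cat M n k (S T U : submodule M) :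
  clen n S T -> clen k T U -> clen (n + k) S U.
Proof.
elim: n S => [|n IH] S /=; first by move=> ->.
by move=> [V SV /IH VT] /VT; exists V.
Qed.

Lemma clen_iso M N (phi : submodule M -> submodule N) psi n S T :
  (forall U V, S ≤ U -> U ≤ V -> V ≤ T -> phi U ≤ phi V) ->
  (forall U V, phi S ≤ U -> U ≤ V -> V ≤ phi T -> psi U ≤ psi V) ->
  (forall U, S ≤ U -> U ≤ T -> psi (phi U) = U) ->
  (forall U, phi S ≤ U -> U ≤ phi T -> phi (psi U) = U) ->
  clen n S T -> clen n (phi S) (phi T).
Proof.
elim: n S => [|n IH] S h1 h2 h3 h4 /=; first by move=> ->.
move=> [S1 [SS1 S1S cov] c1]; have S1T := clen_le c1.
have ST := sle_trans SS1 S1T.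
have pp : phi S ≤ phi S1 by apply: h1.
have p1T : phi S1 ≤ phi T by apply: h1.
exists (phi S1); last first.
  apply: IH => // [U V le1|U V le1|U le1|U le1].
  - by apply: h1; apply: sle_trans le1.
  - by apply: h2; apply: sle_trans le1.
  - by apply: h3; apply: sle_trans le1.
  - by apply: h4; apply: sle_trans le1.
split=> //.
  move=> le; apply: S1S; rewrite -(h3 S1) // -(h3 S) //.
  by apply: h2 => //; apply: sle_trans p1T.
move=> U le1 le2; have leT := sle_trans le2 p1T.
have h5 : S ≤ psi U by rewrite -(h3 S) //; apply: h2.
have h6 : psi U ≤ S1 by rewrite -(h3 S1) //; apply: h2.
case: (cov _ h5 h6) => h7; [left | right]; rewrite -(h4 U) //; apply: h1 => //.
exact: sle_trans S1T.
Qed.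

Lemma modular M (S T U : submodule M) : S ≤ U -> capS (addS S T) U = addS S (capS T U).
Proof.
move=> SU; apply: sle_anti => x.
  move=> [[y [z [Sy Tz ->]]] Ux]; exists y, z; split=> //; split=> //.
  exact/(subDr _ (SU _ Sy)).
move=> [y [z [Sy [Tz Uz] ->]]]; split; first by exists y, z.
by apply: subD => //; apply: SU.
Qed.

Lemma cap_id M (S T : submodule M) : S ≤ T -> capS S T = S.
Proof. by move=> h; apply: sle_anti => x; [case | move=> Sx; split=> //; apply: h]. Qed.
Lemma add_id M (S T : submodule M) : S ≤ T -> addS S T = T.
Proof. by move=> h; apply: sle_anti; [apply: add_le | apply: le_addr]. Qed.
Lemma capSC M (S T : submodule M) : capS S T = capS T S.
Proof. by apply: sle_anti => x []. Qed.

Lemma clen_diamond M n (S T : submodule M) :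
  clen n (capS S T) T <-> clen n S (addS S T).
Proof.
have h1 U : capS S T ≤ U -> U ≤ T -> capS (addS S U) T = U.
  move=> h k; rewrite addSC modular //; apply: sle_anti; last exact: le_addl.
  exact: add_le.
have h2 U : S ≤ U -> U ≤ addS S T -> addS S (capS U T) = U.
  by move=> h k; rewrite capSC -modular // capSC cap_id.
have h3 : addS S (capS S T) = S by rewrite addSC add_id // => x [].
have h4 : capS (addS S T) T = T by rewrite capSC cap_id //; apply: le_addr.
split.
  rewrite -{2}h3; apply: (@clen_iso M M (addS S) (fun U => capS U T)) => //.
  - by move=> U V _ h _; apply: addS_mono.
  - by move=> U V _ h _ x [/h Vx Tx].
  - by move=> U; rewrite h3; apply: h2.
move=> h; rewrite -{2}h4; move: h; apply: (@clen_iso M M (fun U => capS U T) (addS S)) => //.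
- by move=> U V _ h _ x [/h Vx Tx].
- by move=> U V _ h _; apply: addS_mono.
- by move=> U; rewrite h4; apply: h1.
Qed.

(** Let [S1] be the first member of the chain above [S]. If [capS S1 U] is [S], then [addS S1 U]
    covers [U], and the rest of the chain is split at [addS S1 U] and moved down along the diamond.
    Otherwise [S1 ≤ U] and induction applies directly. *)
Lemma clen_split M n (S U T : submodule M) : clen n S T -> S ≤ U -> U ≤ T ->
  exists i j, [/\ clen i S U, clen j U T & n = (i + j)%N].
Proof.
elim: n S U => [|n IH] S U /=.
  by move=> -> h k; exists 0%N, 0%N; rewrite (sle_anti h k).
move=> [S1 cv c1] SU UT; have [SS1 S1S cov] := cv; have S1T := clen_le c1.
have [||h|h] := cov (capS S1 U).
- by move=> x Sx; split; [apply: SS1 | apply: SU].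
- by move=> x [].
- have SE : capS S1 U = S by apply: sle_anti => // x Sx; split; [apply: SS1 | apply: SU].
  have [||i [j [ci cj ->]]] := IH S1 (addS S1 U) c1; first exact: le_addl.
    exact: add_le.
  exists i, j.+1; rewrite addnS; split=> //.
    by rewrite -SE; apply/clen_diamond.
  exists (addS S1 U) => //; have : clen 1 U (addS U S1).
    by apply/clen_diamond; rewrite capSC SE; exists S1.
  by rewrite addSC => -[V cV /= <-].
- have S1U : S1 ≤ U by move=> x /h[].
  have [i [j [ci cj ->]]] := IH S1 U c1 S1U UT.
  by exists i.+1, j; split=> //; exists S1.
Qed.

(** Jordan-Hölder: split the first chain at the first member [U] of the second. As [U] covers [S],
    the lower part has length one, and the upper parts are compared by induction. *)
Lemma clen_uniq M n k (S T : submodule M) : clen n S T -> clen k S T -> n = k.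
Proof.
elim: n k S => [|n IH] k S.
  by move=> /= -> ; case: k => //= k [U [TU UT _] /clen_le].
case: k => [|k] /=; first by move=> [U [SU US _] /clen_le UT] ST; case: US; rewrite ST.
move=> [S1 cv c1] [U cU ck]; congr _.+1.
have [] := @clen_split M n.+1 S U T; [by exists S1|by case: cU|exact: clen_le ck|].
move=> i [j [ci cj]]; case: cU => SU US cov; case: i ci => [|[|i]] /=.
- by move=> SE; case: US; rewrite SE.
- by move=> [V _ VE]; rewrite add1n => -[jE]; subst j; apply: (IH _ U).
move=> [V [SV VS _] [W [VW WV _] /clen_le WU]]; have VU := sle_trans VW WU.
case: (cov V SV VU) => [|UV]; first by move/VS.
by case: WV; apply: sle_trans UV.
Qed.

Definition flen M (S T : submodule M) := exists n, clen n S T.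
(** The length of [T / S], read in the lattice of submodules of [M], so that lengths of subquotients
    add up without forming quotients of quotients. It is 0 when there is no finite composition
    chain. *)
Definition ilen M (S T : submodule M) : nat :=
  if pselect (flen S T) is left h then projT1 (cid h) else 0%N.

Lemma clenE M n (S T : submodule M) : clen n S T -> ilen S T = n.
Proof.
rewrite /ilen => c; case: pselect => [h|]; last by case; exists n.
by case: cid => k ck /=; apply: clen_uniq c.
Qed.
Lemma ilenP M (S T : submodule M) : flen S T -> clen (ilen S T) S T.
Proof. by move=> [n c]; rewrite (clenE c). Qed.
Lemma flen_refl M (S : submodule M) : flen S S. Proof. by exists 0%N. Qed.
Lemma ilen_refl M (S : submodule M) : ilen S S = 0%N. Proof. exact: clenE. Qed.
Lemma flen_trans M (S T U : submodule M) : flen S T -> flen T U -> flen S U.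
Proof. by move=> [n cn] [k ck]; exists (n + k)%N; apply: clen_cat cn ck. Qed.
Lemma ilen_cat M (S T U : submodule M) : flen S T -> flen T U ->
  ilen S U = (ilen S T + ilen T U)%N.
Proof. by move=> h k; apply: clenE; apply: clen_cat; apply: ilenP. Qed.
Lemma flen_split M (S T U : submodule M) : flen S U -> S ≤ T -> T ≤ U ->
  flen S T /\ flen T U.
Proof.
by move=> [n c] h k; have [i [j [ci cj _]]] := clen_split c h k; split; [exists i | exists j].
Qed.
Lemma ilen_add M (S T U : submodule M) : flen S U -> S ≤ T -> T ≤ U ->
  ilen S U = (ilen S T + ilen T U)%N.
Proof. by move=> f h k; have [] := flen_split f h k; apply: ilen_cat. Qed.
Lemma flen_sub M (S S' T T' : submodule M) : flen S T -> S ≤ S' -> S' ≤ T' -> T' ≤ T ->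
  flen S' T'.
Proof.
move=> f h k l; have [_ g] := flen_split f h (sle_trans k l).
by have [] := flen_split g k l.
Qed.
Lemma ilen_mono M (S S' T T' : submodule M) : flen S T -> S ≤ S' -> S' ≤ T' -> T' ≤ T ->
  (ilen S' T' <= ilen S T)%N.
Proof.
move=> f h k l; rewrite (ilen_add f h (sle_trans k l)).
have [_ g] := flen_split f h (sle_trans k l).
by rewrite (ilen_add g k l) addnA addnAC leq_addl.
Qed.
Lemma ilen_eq0 M (S T : submodule M) : flen S T -> ilen S T = 0%N -> S = T.
Proof. by move=> /ilenP + E; rewrite E. Qed.

Lemma flen_diamond M (S T : submodule M) : flen (capS S T) T <-> flen S (addS S T).
Proof. by split=> -[n c]; exists n; apply/clen_diamond. Qed.
(** Finiteness need not be assumed: either both intervals have a composition chain, or both lengths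
    take the default value 0. The same holds for [ilen_ker]. *)
Lemma ilen_diamond M (S T : submodule M) : ilen (capS S T) T = ilen S (addS S T).
Proof.
rewrite {1}/ilen; case: pselect => [h|h]; last first.
  by rewrite /ilen; case: pselect => // k; case: h; apply/flen_diamond.
by case: cid => n c /=; apply/esym/clenE/clen_diamond.
Qed.

Lemma clen_pre M N (f : {linear M -> N}) n (S T : submodule N) : T ≤ imS f -> S ≤ T ->
  clen n (preS f S) (preS f T) <-> clen n S T.
Proof.
move=> Tf ST.
have h1 U : U ≤ T -> imgS f (preS f U) = U.
  move=> UT; apply: sle_anti => [_ [x Ux ->]//|x Ux].
  by have [y _ yE] := Tf _ (UT _ Ux); exists y; rewrite //= -yE.
have h2 U : preS f S ≤ U -> preS f (imgS f U) = U.
  move=> SU; apply: sle_anti => [x [y Uy /= e]|x Ux]; last by exists x.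
  rewrite -(subrK y x); apply: subD => //; apply: SU; rewrite /= linearB e subrr.
  exact: sub0.
have pm U V : U ≤ V -> preS f U ≤ preS f V by move=> h x /h.
have im U V : U ≤ V -> imgS f U ≤ imgS f V by move=> h _ [x /h Vx ->]; exists x.
split; last first.
  apply: (@clen_iso N M (preS f) (imgS f)) => [U V _ h _|U V _ h _|U _|U h _].
  - exact: pm.
  - exact: im.
  - exact: h1.
  - exact: h2.
move=> c; rewrite -(h1 S) // -(h1 T) //; move: c.
apply: (@clen_iso M N (imgS f) (preS f)) => [U V _ h _|U V _ h _|U h _|U _].
- exact: im.
- exact: pm.
- exact: h2.
- by rewrite (h1 T) //; apply: h1.
Qed.
Lemma flen_pre M N (f : {linear M -> N}) (S T : submodule N) : T ≤ imS f -> S ≤ T ->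
  flen (preS f S) (preS f T) <-> flen S T.
Proof. by move=> Tf ST; split=> -[n c]; exists n; apply/(clen_pre _ Tf). Qed.
Lemma ilen_pre M N (f : {linear M -> N}) (S T : submodule N) : T ≤ imS f -> S ≤ T ->
  ilen (preS f S) (preS f T) = ilen S T.
Proof.
move=> Tf ST; rewrite {2}/ilen; case: pselect => [h|h]; last first.
  by rewrite /ilen; case: pselect => // k; case: h; apply/(flen_pre Tf ST).
by case: cid => n c /=; apply/clenE/clen_pre.
Qed.

Lemma flen_ker M N (f : {linear M -> N}) (S : submodule N) :
  flen (preS f S) (topS M) <-> flen S (addS S (imS f)).
Proof.
rewrite -flen_diamond; have le : capS S (imS f) ≤ imS f by move=> x [].
rewrite -(flen_pre (f := f)) //.
have -> : preS f (capS S (imS f)) = preS f S.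
  by apply: sle_anti => x /= => [[]|] //; split=> //; exists x.
by have -> : preS f (imS f) = topS M by apply: sle_anti => // x _; exists x.
Qed.
Lemma ilen_ker M N (f : {linear M -> N}) (S : submodule N) :
  ilen (preS f S) (topS M) = ilen S (addS S (imS f)).
Proof.
rewrite -ilen_diamond; have le : capS S (imS f) ≤ imS f by move=> x [].
rewrite -(ilen_pre (f := f)) //.
have -> : preS f (capS S (imS f)) = preS f S.
  by apply: sle_anti => x /= => [[]|] //; split=> //; exists x.
by have -> : preS f (imS f) = topS M by apply: sle_anti => // x _; exists x.
Qed.

Definition finl M := flen (botS M) (topS M).
Definition len M : nat := ilen (botS M) (topS M).
Lemma sle_bot M (S : submodule M) : botS M ≤ S. Proof. by move=> x ->; apply: sub0. Qed.

Lemma add_bot M (S : submodule M) : addS (botS M) S = S.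
Proof. exact/add_id/sle_bot. Qed.
Lemma pre_inj M N (i : {linear M -> N}) : injective i -> preS i (botS N) = botS M.
Proof.
move=> ii; apply: sle_anti => x /=; first by move/(linear_inj0 ii).
by move=> ->; rewrite linear0.
Qed.
Lemma im_onto M N (p : {linear M -> N}) : onto p -> imS p = topS N.
Proof. by move=> ps; apply: sle_anti => // y _; have [x ->] := ps y; exists x. Qed.

Lemma len_inj M N (i : {linear M -> N}) : injective i ->
  (finl M <-> flen (botS N) (imS i)) /\ len M = ilen (botS N) (imS i).
Proof.
move=> ii; rewrite /finl /len -(pre_inj ii) flen_ker ilen_ker add_bot; split=> //.
Qed.
Lemma len_onto M N (p : {linear M -> N}) : onto p ->
  (finl N <-> flen (kerS p) (topS M)) /\ len N = ilen (kerS p) (topS M).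
Proof.
move=> ps; rewrite /kerS flen_ker ilen_ker add_bot im_onto //; split=> //.
Qed.
Lemma len_exact M N P (i : {linear M -> N}) (p : {linear N -> P}) :
  injective i -> onto p -> (forall x, p x = 0 <-> exists u, x = i u) ->
  (finl N <-> finl M /\ finl P) /\ (finl N -> len N = (len M + len P)%N).
Proof.
move=> ii ps ip; have [fM lM] := len_inj ii; have [fP lP] := len_onto ps.
have E : kerS p = imS i.
  by apply: sle_anti => x => [/ip[u ->]|[u _ ->]]; [exists u | apply/ip; exists u].
split; last by rewrite lM lP E => f; apply: ilen_add => //; apply: sle_bot.
rewrite fM fP E; split=> [f|[f g]]; last exact: flen_trans f g.
by apply: flen_split f _ _ => //; apply: sle_bot.
Qed.
Lemma len_isom M N : isom M N -> (finl M <-> finl N) /\ len M = len N.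
Proof.
move=> [f [fi fs]]; have [fN ->] := len_inj fi.
by rewrite fN im_onto.
Qed.
Lemma len_qmod M (S : submodule M) :
  (finl (qmod S) <-> flen S (topS M)) /\ len (qmod S) = ilen S (topS M).
Proof.
have [h k] := len_onto (prj_onto S).
have E : kerS (prj S) = S by apply: subm_eq => x; apply: prj0.
by rewrite E in h k.
Qed.
Lemma im_inc M (S : submodule M) : imS (inc S) = S.
Proof.
apply: sle_anti => x => [[u _ ->]|/inc_onto[u ->]]; first exact: incP.
by exists u.
Qed.
Lemma len_smd M (S : submodule M) :
  (finl (smd S) <-> flen (botS M) S) /\ len (smd S) = ilen (botS M) S.
Proof. by have := len_inj (@inc_injective _ _ S); rewrite im_inc. Qed.
Lemma finl_inj M N (i : {linear M -> N}) : injective i -> finl N -> finl M /\ (len M <= len N)%N.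
Proof.
move=> ii f; have [-> ->] := len_inj ii; split.
  by apply: flen_sub f _ _ _ => //; apply: sle_bot.
by apply: ilen_mono f _ _ _ => //; apply: sle_bot.
Qed.
Lemma finl_onto M N (p : {linear M -> N}) : onto p -> finl M -> finl N /\ (len N <= len M)%N.
Proof.
move=> ps f; have [-> ->] := len_onto ps; split.
  by apply: flen_sub f _ _ _ => //; apply: sle_bot.
by apply: ilen_mono f _ _ _ => //; apply: sle_bot.
Qed.

Lemma zero_finl M : (forall x : M, x = 0) -> finl M /\ len M = 0%N.
Proof.
move=> h; have E : botS M = topS M by apply: sle_anti => // x _; apply: h.
by split; [exists 0%N | apply: clenE].
Qed.
Lemma len0P M : finl M -> len M = 0%N -> forall x : M, x = 0.
Proof. by move=> f /(ilen_eq0 f) E x; have : topS M x by []; rewrite -E. Qed.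

Lemma sup_nat_max (P : nat -> Prop) (N : nat) : P N -> (forall n, P n -> (n <= N)%N) ->
  sup_nat P = N%:Z%:E.
Proof.
move=> PN Pmax; rewrite /sup_nat.
have hB : supremums [set x | exists2 n : nat, P n & x = n%:Z%:E]%classic N%:Z%:E.
  split; first by move=> _ [n Pn ->]; rewrite lee_fin lez_nat; apply: Pmax.
  by move=> y; apply; exists N.
rewrite /supremum; case: ifPn => [/eqP E|_]; last first.
  apply: (is_subset1_supremums (A := [set x | exists2 n : nat, P n & x = n%:Z%:E]%classic)) => //; apply: xgetPex; by exists N%:Z%:E.

  by have : [set x | exists2 n : nat, P n & x = n%:Z%:E]%classic (N%:Z%:E : \bar int);
    [exists N | rewrite E].
Qed.

Lemma clen_chain M n (S T : submodule M) : clen n S T ->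
  exists F : nat -> submodule M, F 0%N = S /\
    forall i, (i < n)%N -> F i ≤ F i.+1 /\ ~ F i.+1 ≤ F i.
Proof.
elim: n S => [|n IH] S /=; first by exists (fun=> S).
move=> [U [SU US _] /IH[F [F0 FE]]].
exists (fun i => if i is j.+1 then F j else S); split=> // -[|i] /=; last exact: FE.
by rewrite F0.
Qed.

Lemma chain_ilen M n (F : nat -> submodule M) : finl M ->
  (forall i, (i < n)%N -> F i ≤ F i.+1 /\ ~ F i.+1 ≤ F i) -> (n <= len M)%N.
Proof.
move=> fM FE.
suff h i : (i <= n)%N -> (i <= ilen (botS M) (F i))%N.
  apply: leq_trans (h n (leqnn n)) _; apply: ilen_mono => //; exact: sle_bot.
elim: i => // i IH lin; have [le nle] := FE i lin.
have f : flen (botS M) (F i.+1) by apply: flen_sub fM _ _ _ => //; apply: sle_bot.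
rewrite (ilen_add f _ le); last exact: sle_bot.
have : ilen (F i) (F i.+1) <> 0%N.
  move=> /ilen_eq0 E; apply: nle; rewrite E //.
  by have [] := flen_split f (sle_bot _) le.
have := IH (ltnW lin); lia.
Qed.

Lemma module_lengthE M : finl M -> module_length M = (len M)%:Z%:E.
Proof.
move=> fM; apply: sup_nat_max.
  have [F [_ FE]] := clen_chain (ilenP fM).
  exists (fun i => toS (F i)) => i /FE[h k]; split=> [x /toSP/h/toSP//|h'].
  by apply: k => x /toSP/h'/toSP.
by move=> n [F FE]; apply: (@chain_ilen M n (fun i => ofS (F i))).
Qed.
End Length.

(** * The Artin-Rees lemma *)

Section Graded.
Variables (A : comNzRingType) (noethA : noetherian_ring A).
Implicit Types M N : lmodType A.
Implicit Types I Q : ideal A.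

(** A stable family with [U n ≤ ipow Q M n] is a graded submodule of the Rees module, the direct sum
    of the [Q^n M]. *)
Definition stable M Q (U : nat -> submodule M) :=
  forall n (a : A) x, Q a -> U n x -> U n.+1 (a *: x).

Section Step.
Variables (M : lmodType A) (I : ideal A) (x : A).

(* [layers i N] is the sum of the [x^j I^(N-j) M] for [j < i], [j <= N]. *)
Fixpoint layers (i N : nat) : submodule M :=
  if i is j.+1 then
    addS (layers j N)
      (if (j <= N)%N then imgS (scal M (x ^+ j)) (ipow I M (N - j)) else botS M)
  else botS M.

Lemma layers_mono i (N : nat) : layers i N ≤ layers i.+1 N.
Proof. exact: le_addl. Qed.

Lemma layersI i (N : nat) a u : I a -> layers i N u -> layers i N.+1 (a *: u).
Proof.
move=> Ia; elim: i u => [|i IH] u /=; first by move=> ->; rewrite scaler0.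
move=> [v [w [/IH Rv Rw ->]]]; rewrite scalerDr; exists (a *: v), (a *: w); split=> //.
move: Rw; case: leqP => [iN [z Wz ->]|_ ->]; last by rewrite scaler0; apply: sub0.
rewrite leqW // subSn //; exists (a *: z); first exact: ipowM.
by rewrite /= !scalerA mulrC.
Qed.

Lemma layersX i (N : nat) u : layers i N u -> layers i.+1 N.+1 (x *: u).
Proof.
elim: i u => [|i IH] u; first by move=> ->; rewrite scaler0; apply: sub0.
move=> [v [w [/IH Rv Rw ->]]]; rewrite scalerDr; exists (x *: v), (x *: w); split=> //.
move: Rw; rewrite ltnS; case: leqP => [iN [z Wz ->]|_ ->]; last by rewrite scaler0; apply: sub0.
by rewrite subSS; exists z; rewrite //= scalerA exprS.
Qed.

Lemma ipow_layers n : ipow (addS (seqS [:: x : A^o]) I) M n ≤ layers n.+1 n.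
Proof.
elim: n => [|n IH].
  by move=> u _; exists 0, u; rewrite add0r; split=> //; exists u; rewrite //= expr0 scale1r.
apply: smul_le => _ u [_ [b [/seq1P[a ->] Ib ->]]] /IH Ru.
rewrite scalerDl; apply: subD.
  rewrite [a *: _]mulrC -scalerA; apply: layersX; exact: subZ.
by apply: layers_mono; apply: layersI.
Qed.

(** The coefficients of [x^i] in the elements of [U] of degree [n + i] that have degree at most [i]
    in [x]. An expansion in powers of [x] is not unique, so the lower terms are only required to lie
    in [layers i]. *)
Definition leading (U : nat -> submodule M) i n : submodule M :=
  capS (ipow I M n) (preS (scal M (x ^+ i)) (addS (layers i (n + i)) (U (n + i)%N))).

Lemma leading_stable (U : nat -> submodule M) i : stable I U -> stable I (leading U i).
Proof.
move=> sU n a w Ia [Ww [r [u [Rr Uu /= E]]]]; split; first exact: ipowM.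
exists (a *: r), (a *: u); rewrite addSn; split; [exact: layersI|exact: sU|].
by rewrite /= scalerA mulrC -scalerA E scalerDr.
Qed.

Lemma leading_index (U : nat -> submodule M) i n : (forall n u, U n u -> U n.+1 (x *: u)) ->
  leading U i n ≤ leading U i.+1 n.
Proof.
move=> sU w [Ww [r [u [Rr Uu /= E]]]]; split=> //.
exists (x *: r), (x *: u); rewrite addnS; split; [exact: layersX|exact: sU|].
by rewrite /= exprS -scalerA E scalerDr.
Qed.

Lemma leading_mono (U V : nat -> submodule M) i n : (forall n, U n ≤ V n) ->
  leading U i n ≤ leading V i n.
Proof.
move=> UV w [Ww h]; split=> //; move: h; apply: addS_mono => //; exact: UV.
Qed.

(** Induction on the number of layers that [u] needs: its top term is [x^i z] with [z] a leading
    coefficient of [V], hence of [U]. Subtracting an element of [U] with the same top term leaves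
    fewer layers. *)
Lemma leading_inj (U V : nat -> submodule M) : (forall n, U n ≤ V n) ->
  (forall n, V n ≤ ipow (addS (seqS [:: x : A^o]) I) M n) ->
  (forall i n, leading V i n ≤ leading U i n) -> forall n, V n ≤ U n.
Proof.
move=> UV VW LVU N u Vu; have : layers N.+1 N u by apply/ipow_layers/VW.
elim: N.+1 u Vu => [|i IH] u Vu; first by move=> ->; apply: sub0.
move=> [v [w [Rv Rw E]]]; move: Rw; case: leqP => [iN [z Wz /= wE]|_ wE]; last first.
  by apply: IH => //; rewrite E wE addr0.
have : leading V i (N - i)%N z.
  split=> //; exists (- v), u; rewrite subnK //; split=> //; first exact: subN.
  by rewrite /= E wE [- v + _]addrC -addrA addrCA subrr addr0.
move=> /LVU[_ [r [t [Rr Ut /=]]]]; rewrite subnK // in Rr Ut *; move=> xE.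
rewrite -(subrK t u); apply: subD => //; apply: IH.
  by apply: subB => //; apply: UV.
have -> : u - t = v + r by rewrite E wE xE addrA addrK.
exact: subD.
Qed.
End Step.

Lemma ipow_bot M n : ipow (botS A^o) M n.+1 = botS M.
Proof.
apply: sle_anti; last exact: sle_bot.
by apply: smul_le => a u -> _; rewrite scale0r.
Qed.

(* Graded form of the Hilbert basis theorem for the Rees module of [seqS s]. *)
Lemma graded_acc M (s : seq A^o) (U : nat -> nat -> submodule M) :
  fg (topS M) ->
  (forall k n, U k n ≤ U k.+1 n) ->
  (forall k n, U k n ≤ ipow (seqS s) M n) ->
  (forall k, stable (seqS s) (U k)) ->
  exists k, forall i, (k <= i)%N -> forall n, U i n = U k n.
Proof.
move=> fM; elim: s U => [|x s IH] U Um UW Us.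
  have [k hk] := fg_acc noethA fM (fun k => Um k 0%N) (fun k x _ => Logic.I).
  exists k => i ki [|n]; first exact: hk.
  have h j : U j n.+1 = botS M.
    apply: sle_anti; last exact: sle_bot.
    by rewrite -(ipow_bot M n) -seqS_nil; apply: UW.
  by rewrite !h.
have sS e : e \in s -> e \in x :: s by rewrite inE orbC => ->.
rewrite seqS_cons in Us UW.
have Usx k n u : U k n u -> U k n.+1 (x *: u).
  by apply: Us; apply: le_addl; apply: spanP; rewrite inE.
have UsI k : stable (seqS s) (U k) by move=> n a u h; apply: Us; apply: le_addr.
pose L k i := leading (seqS s) x (U k) i.
have Lm k i n : L k i n ≤ L k.+1 i n by apply/leading_mono/Um.
have Li k i n : L k i n ≤ L k i.+1 n by apply: leading_index; apply: Usx.
have LW k i n : L k i n ≤ ipow (seqS s) M n by move=> w [].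
have Ls k i : stable (seqS s) (L k i) by apply: leading_stable; apply: UsI.
have Lmm k k' i n : (k <= k')%N -> L k i n ≤ L k' i n.
  exact: (chain_le (fun k => Lm k i n)).
have Lii k i i' n : (i <= i')%N -> L k i n ≤ L k i' n.
  exact: (chain_le (fun i => Li k i n)).
(* The diagonal chain settles all indices [i >= k0] at once; the finitely many smaller ones are
   treated one by one. *)
have [k0 h0] := IH (fun k => L k k) (fun k n => sle_trans (Lm k k n) (Li k.+1 k n))
  (fun k => LW k k) (fun k => Ls k k).
have /choice[K hK] : forall i, exists k, forall j, (k <= j)%N -> forall n, L j i n = L k i n.
  by move=> i; apply: (IH (fun k => L k i)).
(* The sum serves only as a common upper bound of [k0] and the [K i] with [i < k0]. *)
pose k1 := (k0 + \sum_(i < k0) K i)%N.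
exists k1 => j kj n; apply: sle_anti; last exact: (chain_le (fun k => Um k n)).
apply: (leading_inj (I := seqS s) (x := x)) n => [n|n|i n].
- exact: (chain_le (fun k => Um k n)).
- exact: UW.
have k0k1 : (k0 <= k1)%N by rewrite leq_addr.
rewrite -/(L j i n) -/(L k1 i n).
case: (ltnP i k0) => [ik|ki].
  have Kk : (K i <= k1)%N.
    by rewrite /k1 (bigD1 (Ordinal ik)) //= addnCA leq_addr.
  by rewrite (hK i j) ?(hK i k1) // (leq_trans Kk).
apply: (sle_trans (Lmm j (i + j)%N i n _)); first by rewrite leq_addl.
apply: (sle_trans (Lii _ _ (i + j)%N n _)); first by rewrite leq_addr.
rewrite (h0 (i + j)%N); last by rewrite (leq_trans ki) // leq_addr.
exact: (sle_trans (Lmm k0 k1 k0 n k0k1) (Lii _ _ _ _ ki)).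
Qed.

Lemma stable_chain M Q (U : nat -> nat -> submodule M) :
  fg (topS M) -> (forall k n, U k n ≤ U k.+1 n) ->
  (forall k n, U k n ≤ ipow Q M n) -> (forall k, stable Q (U k)) ->
  exists k, forall i, (k <= i)%N -> forall n, U i n = U k n.
Proof. by have [s ->] := ideal_fg noethA Q; apply: graded_acc. Qed.

Lemma iter_smul_le M Q n (S T : submodule M) : S ≤ T -> iter n (@smul A Q M) S ≤ iter n (@smul A Q M) T.
Proof. by move=> h; elim: n => //= n IH; apply: smul_mono. Qed.

(** Truncate [U] at degree [k] and continue by multiplication with [Q]: these families increase with
    [k] and are stable, so they stop growing at some [c], which means that [U] is generated up to
    degree [c]. *)
Lemma stable_gen M Q (U : nat -> submodule M) : fg (topS M) ->
  (forall n, U n ≤ ipow Q M n) -> stable Q U ->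
  exists c, forall j, U (c + j)%N = iter j (@smul A Q M) (U c).
Proof.
move=> fM UW sU.
pose V k n := if (n <= k)%N then U n else iter (n - k) (@smul A Q M) (U k).
have le j k : iter j (@smul A Q M) (U k) ≤ U (k + j)%N.
  elim: j => [|j IH]; first by rewrite addn0.
  by rewrite addnS; apply: smul_le => a x Qa /IH; apply: sU.
have [|||c hc] := @stable_chain M Q V fM.
- move=> k n; rewrite /V; case: leqP => [nk|kn]; first by rewrite leqW.
  case: leqP => [nk1|nk1].
    have -> : n = (k + 1)%N by lia.
    by rewrite addKn; apply: le.
  have -> : (n - k = (n - k.+1) + 1)%N by lia.
  by rewrite iterD; apply: iter_smul_le; have := le 1%N k; rewrite addn1.
- move=> k n; rewrite /V; case: leqP => // kn.
  by apply: sle_trans (UW n); rewrite -{2}(subnKC (ltnW kn)); apply: le.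
- move=> k n a x Qa; rewrite /V; case: (leqP n k) => nk; case: (leqP n.+1 k) => nk1 h.
  + exact: sU.
  + have -> : k = n by lia.
    by rewrite subSn // subnn; apply: smulP.
  + lia.
  + by rewrite subSn; [apply: smulP | lia].
exists c => j; have := hc (c + j)%N (leq_addr _ _) (c + j)%N.
rewrite /V leqnn; case: leqP => [h _|_ ->]; last by rewrite addKn.
by have -> : j = 0%N; [lia | rewrite addn0].
Qed.

Lemma artin_rees M Q (N : submodule M) : fg (topS M) ->
  exists c, forall j, capS N (ipow Q M (c + j)) ≤ smul (ipow Q A^o j) N.
Proof.
move=> fM; have [||c hc] := @stable_gen M Q (fun n => capS N (ipow Q M n)) fM.
- by move=> n x [].
- by move=> n a x Qa [Nx Wx]; split; [apply: subZ | apply: ipowM].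
exists c => j; rewrite hc smul_ipow; apply: smul_mono => // x [] //.
Qed.
End Graded.

(** * Generic and superficial elements *)

Section LocalRing.
Variable A : comNzRingType.
Implicit Types M N P : lmodType A.
Implicit Types I J Q p : ideal A.

Record noeth_local (m : submodClosed A^o) : Prop := NoethLocal {
  nl_noeth : noetherian_ring A;
  nl_local : local_ring m;
  nl_inf : infinite_set [set: quotient_mod m]%classic }.

Definition prime p := ~ p 1 /\ forall a b : A, p (a * b) -> p a \/ p b.

Lemma prime_toS p : prime p -> prime_ideal (toS p).
Proof.
by move=> [p1 pM]; split; [apply/negP => /toSP | move=> a b /toSP/pM[]/toSP; [left|right]].
Qed.
Lemma prime_ofS (p : submodClosed A^o) : prime_ideal p -> prime (ofS p).
Proof. by move=> [/negP p1 pM]; split. Qed.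

Lemma smul1P I M (y z : M) : smul I (seqS [:: y]) z <-> exists2 a, I a & z = a *: y.
Proof.
split; last by move=> [a Ia ->]; apply: smulP => //; apply: spanP; rewrite inE.
suff h : smul I (seqS [:: y]) ≤ imgS (actL y) I by move/h => [a Ia ->]; exists a.
apply: smul_le => a x Ia /seq1P[b ->]; exists (a * b); last by rewrite /= scalerA.
by rewrite mulrC; apply: (subZ (S := I) b Ia).
Qed.

Lemma fg_le_union M (S : submodule M) (U : nat -> submodule M) (h : forall k, U k ≤ U k.+1) :
  fg S -> S ≤ unionS h -> exists k, S ≤ U k.
Proof.
move=> [s ->] le; have hs x : x \in s -> unionS h x by move=> xs; apply/le/spanP.
suff [k hk] : exists k, forall x, x \in s -> U k x by exists k; apply: span_le.
elim: s {le} hs => [|x s IH] hs; first by exists 0%N.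
have [|k hk] := IH; first by move=> y ys; apply: hs; rewrite inE ys orbT.
have [|j hj] := hs x; first by rewrite inE eqxx.
exists (maxn k j) => y; rewrite inE => /orP[/eqP->|/hk].
  by move: hj; apply: (chain_le h); rewrite leq_maxr.
by apply: (chain_le h); rewrite leq_maxl.
Qed.

(* Nakayama's lemma localized at [p], stated without localization. *)
Lemma nakayama_prime p M (s : seq M) b : prime p -> ~ p b ->
  (forall y, y \in s -> smul p (seqS s) (b *: y)) ->
  exists2 c, ~ p c & forall y, y \in s -> c *: y = 0.
Proof.
move=> [p1 pM]; elim: s b => [|x s IH] b pb hb; first by exists 1.
have hb' y : y \in x :: s -> addS (smul p (seqS [:: x])) (smul p (seqS s)) (b *: y).
  by move=> /hb; rewrite seqS_cons smul_add.
have [_ [z [/smul1P[a pa ->] pz E]]] := hb' x (mem_head _ _).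
(* From [b *: x = a *: x + z] with [a] in [p]: the element [c] is still outside [p], and
   [c *: x = z] no longer involves [x]. Multiplying the remaining relations by [c] eliminates
   [x]. *)
pose c := b - a.
have cx : c *: x = z by rewrite /c scalerBl E addrC addKr.
have pc : ~ p c.
  by move=> pc; apply: pb; rewrite -[b](subrK a); apply: (subD (S := p)).
have [||e pe he] := IH (c * b).
- by move/pM => [].
- move=> y ys; have [_ [w [/smul1P[a' pa' ->] pw E']]] : addS (smul p (seqS [:: x])) (smul p (seqS s)) (b *: y).
    by apply: hb'; rewrite inE ys orbT.
  rewrite -scalerA E' scalerDr; apply: subD; last exact: subZ.
  by rewrite scalerA mulrC -scalerA cx; apply: subZ.
exists (e * c); first by move/pM => [].
have es : seqS s ≤ preS (scal M e) (botS M) by apply: span_le.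
move=> y; rewrite inE => /orP[/eqP->|/he]; rewrite -scalerA.
  by rewrite cx; apply: es; move: pz; apply: smul_sub.
by rewrite [c *: y]/(c *: y) => h; rewrite scalerA mulrC -scalerA h scaler0.
Qed.

Section Local.
Variables (m : submodClosed A^o) (H : noeth_local m).
Local Notation mm := (ofS m).
Let noethA := nl_noeth H.

Lemma mm_proper : ~ mm 1.
Proof. by have [[/negP]] := nl_local H. Qed.

Lemma proper_le I : ~ I 1 -> I ≤ mm.
Proof.
move=> I1; have [|||J [IJ J1] Jmax] := @acc_sup _ _ (topS A^o) (fun J => I ≤ J /\ ~ J 1).
- exact: (fg_acc noethA (ideal_fg noethA _)).
- by move=> T _ x.
- by exists I; split.
have mJ : maximal_ideal (toS J).
  split; first by apply/negP => /toSP.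
  move=> q Jq q1 x xq; apply/toSP; have := Jmax (ofS q); move=> <- //.
    by split; [move=> y /IJ /toSP/Jq | apply/negP].
  by move=> y /toSP/Jq.
by move=> x /IJ /toSP; rewrite ((nl_local H).2 _ mJ).
Qed.

Lemma unit_mm (a : A) : ~ mm a -> exists b, b * a = 1.
Proof.
move=> na; have : seqS [:: a : A^o] 1.
  apply: contrapT => h; apply: na; apply: proper_le h _ _.
  by apply: spanP; rewrite inE.
by move=> /seq1P[b ->]; exists b.
Qed.

Lemma mm_prime : prime mm.
Proof.
split; first exact: mm_proper.
move=> a b ab; apply: contrapT => /not_orP[na nb].
have [a' aE] := unit_mm na; have [b' bE] := unit_mm nb.
apply: mm_proper; have -> : 1 = (a' * b') * (a * b) by rewrite mulrACA aE bE mulr1.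
exact: (subZ (S := mm)).
Qed.

Lemma prime_le_mm p : prime p -> p ≤ mm.
Proof. by move=> [p1 _]; apply: proper_le. Qed.

Lemma nakayama M (N : submodule M) : fg N -> N ≤ smul mm N -> N = botS M.
Proof.
move=> [s sE] NN; have [|c mc cs] := @nakayama_prime mm M s 1 mm_prime mm_proper.
  by move=> y ys; rewrite scale1r -sE; apply: NN; rewrite sE; apply: spanP.
have [b bc] := unit_mm mc.
apply: sle_anti; last exact: sle_bot.
rewrite sE; apply: span_le => y /cs cy.
by rewrite /= -[y]scale1r -bc -scalerA cy scaler0.
Qed.

(** For [N = Ax], Artin-Rees gives [N ≤ QN], and Nakayama's lemma gives [N = 0]. *)
Lemma krull M Q x : fg (topS M) -> Q ≤ mm -> (forall n, ipow Q M n x) -> x = 0.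
Proof.
move=> fM Qm hx; pose N := seqS [:: x].
have Nx : N x by apply: spanP; rewrite inE.
suff NE : N = botS M by rewrite NE in Nx.
apply: nakayama; first by exists [:: x].
have [c hc] := artin_rees noethA Q N fM.
have : smul (ipow Q A^o 1) N x by apply: hc.
move=> h y /seq1P[a ->]; apply: subZ; move: h; apply: smul_mono => //.
by apply: smul_le => b e Qb _; rewrite [_ *: _]mulrC; apply: subZ; apply: Qm.
Qed.

(* [P] holds on [Q] outside finitely many proper subideals of [Q]; when the residue field is
   infinite such subideals do not cover [Q]. *)
Definition generic Q (P : A -> Prop) := exists n (V : nat -> ideal A),
  (forall i, (i < n)%N -> exists2 x, Q x & ~ V i x) /\
  forall a : A, Q a -> (forall i, (i < n)%N -> ~ V i a) -> P a.

Lemma generic_weak Q (P P' : A -> Prop) : (forall a : A, Q a -> P a -> P' a) -> generic Q P -> generic Q P'.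
Proof. by move=> h [n [V [V1 V2]]]; exists n, V; split=> // a Qa /(V2 _ Qa); apply: h. Qed.
Lemma generic_all Q (P : A -> Prop) : (forall a : A, Q a -> P a) -> generic Q P.
Proof. by move=> h; exists 0%N, (fun=> Q); split=> // a /h. Qed.
Lemma generic_out Q (V : ideal A) : (exists2 x, Q x & ~ V x) -> generic Q (fun a => ~ V a).
Proof. by move=> h; exists 1%N, (fun=> V); split=> // a _ /(_ 0%N isT). Qed.
Lemma generic_and Q (P P' : A -> Prop) : generic Q P -> generic Q P' ->
  generic Q (fun a => P a /\ P' a).
Proof.
move=> [n [V [V1 V2]]] [k [W [W1 W2]]].
exists (n + k)%N, (fun i => if (i < n)%N then V i else W (i - n)%N); split.
  by move=> i ik; case: ltnP => [/V1//|ni]; apply: W1; lia.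
move=> a Qa h; split; [apply: V2 => // i ik | apply: W2 => // i ik].
  by have := h i; rewrite ik ltn_addr //; apply.
have := h (n + i)%N; rewrite ltn_add2l ik ltnNge leq_addr /= addKn; exact.
Qed.
Lemma generic_forall Q n (P : nat -> A -> Prop) : (forall i, (i < n)%N -> generic Q (P i)) ->
  generic Q (fun a => forall i, (i < n)%N -> P i a).
Proof.
elim: n => [|n IH] h; first exact: generic_all.
have /generic_and/(_ (h n (ltnSn n))) := IH (fun i lin => h i (ltnW lin)).
apply: generic_weak => a _ [h1 h2] i; rewrite ltnS leq_eqVlt => /orP[/eqP->//|]; exact: h1.
Qed.

Lemma residues n : exists u : nat -> A, forall i j, (i < n)%N -> (j < n)%N -> i <> j ->
  ~ mm (u i - u j).
Proof.
have [s us ss] : exists2 s : seq (quotient_mod m), uniq s & size s = n.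
  elim: n => [|n [s us ss]]; first by exists [::].
  apply: contrapT => h; apply: (nl_inf H).
  suff -> : [set: quotient_mod m]%classic = [set` s]%classic by apply: finite_seq.
  apply/seteqP; split=> // x _ /=; apply: contrapT => /negP xs; apply: h.
  by exists (x :: s); rewrite /= ?xs ?ss.
exists (fun i => repr (nth 0 s i)) => i j lin ljn ij h; apply: ij.
apply/eqP; rewrite -(nth_uniq 0 _ _ us) ?ss //; apply/eqP.
by have /projE := h; rewrite /= !reprK.
Qed.

Lemma generic_ex Q (P : A -> Prop) : generic Q P -> exists2 a : A, Q a & P a.
Proof.
move=> [n [V [V1 V2]]].
suff [a Qa Va] : exists2 a, Q a & forall i, (i < n)%N -> ~ V i a by exists a => //; apply: V2.
elim: n V1 {V2} => [|n IH] V1; first by exists 0 => //; apply: sub0.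
have [a Qa Va] := IH (fun i lin => V1 i (ltnW lin)).
have [b Qb Vb] := V1 n (ltnSn n).
have [u hu] := residues n.+2.
(* Each [V i] contains at most one point [a + u_j b]: two of them would put a unit multiple of [b],
   and then [a], into [V i]. So [n + 2] points cannot all lie in the union of [n + 1] ideals. *)
have bad i j k : (i < n.+1)%N -> (j < n.+2)%N -> (k < n.+2)%N -> j <> k -> V i (a + u j *: (b : A^o)) -> V i (a + u k *: (b : A^o)) -> False.
  move=> lin ljn lkn jk Vj Vk.
  have [w wE] := unit_mm (hu _ _ ljn lkn jk).
  have Vib : V i b.
    have := subZ w (subB Vj Vk); rewrite opprD addrACA subrr add0r -scalerBl scalerA wE.
    by rewrite scale1r.
  move: lin; rewrite ltnS leq_eqVlt => /orP[/eqP E|lin]; first by apply: Vb; rewrite -E.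
  apply: (Va i lin); rewrite -[a](addrK (u j *: (b : A^o))); apply: subB => //; exact: subZ.
apply: contrapT => nex.
have /choice[f fP] : forall j, exists i, (i < n.+1)%N /\ V i (a + u j *: (b : A^o)).
  move=> j; apply: contrapT => nj; apply: nex; exists (a + u j *: (b : A^o)).
    by apply: subD => //; apply: subZ.
  by move=> i lin Vi; apply: nj; exists i.
pose g (j : 'I_n.+2) : 'I_n.+1 := Ordinal (fP j).1.
have : injective g.
  move=> j k /(congr1 val) /= E; apply/val_inj; apply: contrapT => jk.
  by apply: (bad (f j) j k) => //; [case: (fP j) | case: (fP j) | rewrite E; case: (fP k)].
by move/leq_card; rewrite !card_ord ltnn.
Qed.
End Local.
End LocalRing.
Arguments generic {A}.

Section Superficial.
Variables (A : comNzRingType) (m : submodClosed A^o) (H : noeth_local m).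
Implicit Types M : lmodType A.
Implicit Types I Q : ideal A.
Local Notation mm := (ofS m).
Let noethA := nl_noeth H.

(** For [a] in [Q]: multiplication by the class of [a] is injective in degrees at least [c] on the
    associated graded module of [M]. *)
Definition superficial Q M (a : A) := exists c, forall n, (c <= n)%N ->
  forall w, ipow Q M n w -> ipow Q M n.+2 (a *: w) -> ipow Q M n.+1 w.

Lemma ipow1 Q : ipow Q A^o 1 = Q.
Proof.
apply: sle_anti; first by apply: smul_le => a x Qa _; rewrite [_ *: _]mulrC; apply: (subZ (S := Q)).
by move=> x Qx; rewrite -[x]mulr1; apply: (smulP (x := 1 : A^o)).
Qed.

Lemma iter_smul_sub M Q j (S : submodule M) : iter j (@smul A Q M) S = smul (ipow Q A^o j) S.
Proof. exact: smul_ipow. Qed.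

Section Family.
Variables (Q : ideal A) (M : lmodType A) (U : nat -> submodule M).
Hypothesis sU : stable Q U.

Lemma transporter0 n s (c : A) : ipow Q A^o s c -> U (n + s)%N (c *: 0).
Proof. by rewrite scaler0 => _; apply: sub0. Qed.
Lemma transporterL n s a (x y : M) :
  (forall c : A, ipow Q A^o s c -> U (n + s)%N (c *: x)) ->
  (forall c : A, ipow Q A^o s c -> U (n + s)%N (c *: y)) ->
  forall c : A, ipow Q A^o s c -> U (n + s)%N (c *: (a *: x + y)).
Proof.
move=> hx hy c Qc; rewrite scalerDr scalerA mulrC -scalerA; apply: subL; [exact: hx | exact: hy].
Qed.
Definition transporter n s : submodule M := SubM (@transporter0 n s) (@transporterL n s).

Lemma transporterS n s : transporter n s ≤ transporter n s.+1.
Proof.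
move=> w hw c; suff : ipow Q A^o s.+1 ≤ preS (actL w) (U (n + s.+1)) by apply.
apply: smul_le => a b Qa Qb; rewrite addnS /= -scalerA; apply: (@sU _ _ _) => //; exact: hw.
Qed.
Lemma transporter_le n s t : (s <= t)%N -> transporter n s ≤ transporter n t.
Proof. exact: (chain_le (@transporterS n)). Qed.

(** The saturation of [U] in degree [n]: elements that some power of [Q] multiplies into [U]. *)
Definition eventually_in n : submodule M := unionS (@transporterS n).

Lemma transporterM n s a w : Q a -> transporter n s w -> transporter n.+1 s (a *: w).
Proof.
move=> Qa hw c Qc; rewrite addSn scalerA mulrC -scalerA; apply: (@sU _ _ _) => //; exact: hw.
Qed.

Lemma eventually_all : fg (topS M) -> (forall w, eventually_in 0 w) ->
  exists c, forall n, (c <= n)%N -> ipow Q M n ≤ U n.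
Proof.
move=> fM h; have [//|s hs] := @fg_le_union _ _ (topS M) _ (@transporterS 0) fM.
exists s => n sn; rewrite ipowE; apply: smul_le => a x Qa _.
exact: (transporter_le sn (hs x Logic.I)).
Qed.

(** In degree [s], the annihilator in the Rees algebra of [w], taken in degree [n], modulo [U]. *)
Definition annf n w s : ideal A := capS (ipow Q A^o s) (preS (actL w) (U (n + s)%N)).
Lemma annf_stable n w : stable Q (annf n w).
Proof.
move=> s a b Qa [Qb Ub]; split; first exact: ipowM.
by rewrite addnS /= -scalerA; apply: (@sU _ _ _).
Qed.

Definition extend n w (N : nat) : submodule M :=
  addS (U N) (if (n <= N)%N then imgS (actL w) (ipow Q A^o (N - n)) else botS M).
End Family.

(** Noetherian induction: take [U] maximal among the counterexamples. A homogeneous [w] outside the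
    saturation of [U], with maximal graded annihilator modulo [U], takes the place of an element
    whose annihilator is a relevant associated prime. Adding the multiples of [w] to [U] gives a
    family for which the claim holds, so only multiples [b *: w] are left; for these the maximal
    annihilator decides, once [a] avoids [annf Q U n w 1]. *)
Lemma generic_family Q M (U : nat -> submodule M) : fg (topS M) ->
  stable Q U -> (forall n, U n ≤ ipow Q M n) ->
  generic Q (fun a => exists c, forall n, (c <= n)%N ->
    forall w, ipow Q M n w -> U n.+1 (a *: w) -> U n w).
Proof.
move=> fM; pose good (U : nat -> submodule M) := generic Q (fun a => exists c, forall n,
  (c <= n)%N -> forall w, ipow Q M n w -> U n.+1 (a *: w) -> U n w).
rewrite -/(good U) => sU UW; apply: contrapT => nU.
have [|{sU nU UW}{}U [[sU UW] bU] Umax] := @ascending_max (nat -> submodule M)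
  (fun U V => (forall n, U n ≤ V n) /\ exists n, ~ V n ≤ U n)
  (fun U => (stable Q U /\ forall n, U n ≤ ipow Q M n) /\ ~ good U) _
  (ex_intro _ U (conj (conj sU UW) nU)).
  move=> u hu hR; have [k hk] := stable_chain noethA fM (fun k => (hR k).1)
    (fun k => (hu k).1.2) (fun k => (hu k).1.1).
  by have [_ [n]] := hR k; rewrite (hk k.+1) // => /(_ (fun x h => h)).
(* If all of [M] is eventually in [U], then [Q^n M ≤ U n] for large [n], and every [a] will do. *)
apply: bU; case: (pselect (forall w, eventually_in sU 0 w)) => [h|/existsNP[w0 nw0]].
  have [c hc] := eventually_all fM h; apply: generic_all => a _.
  by exists c => n cn w Ww _; apply: hc.
have [|[n w] [Ww nw] wmax] := @ascending_max (nat * M)%type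
  (fun x y => (forall s, annf Q U x.1 x.2 s ≤ annf Q U y.1 y.2 s) /\
     exists s, ~ annf Q U y.1 y.2 s ≤ annf Q U x.1 x.2 s)
  (fun x => ipow Q M x.1 x.2 /\ ~ eventually_in sU x.1 x.2) _
  (ex_intro _ (0%N, w0) (conj Logic.I nw0)).
  move=> u hu hR.
  have [|k s x []//|k|k hk] := @stable_chain _ noethA A^o Q (fun k => annf Q U (u k).1 (u k).2) (top_fg noethA).
  - by move=> k; apply: (hR k).1.
  - exact: annf_stable.
  - by have [_ [s]] := hR k; rewrite (hk k.+1) // => /(_ (fun x h => h)).
rewrite /= in Ww nw wmax.
have uw : ~ U n w.
  by move=> Uw; apply: nw; exists 0%N => c _; rewrite addn0; apply: subZ.
have : good (extend Q U n w).
  apply: contrapT => bE; apply: (Umax (extend Q U n w)); last split.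
  - split=> //; split=> [k a x Qa [y [z [Uy Ez ->]]]|N].
      rewrite scalerDr; exists (a *: y), (a *: z); split=> //; first exact: (@sU _ _ _).
      move: Ez; case: leqP => [nN [b Qb ->]|_ ->]; last by rewrite scaler0; apply: sub0.
      rewrite leqW // subSn //; exists (a *: b); first exact: ipowM.
      by rewrite /= scalerA.
    apply: add_le => //; case: leqP => [nN|_]; last exact: sle_bot.
    by move=> _ [b Qb ->]; rewrite -{1}(subnK nN); apply: ipowZ.
  - by move=> N; apply: le_addl.
  - exists n => h; apply: uw; apply: h; apply: le_addr; rewrite leqnn subnn.
    by exists 1; rewrite //= scale1r.
have : generic Q (fun a => ~ annf Q U n w 1 a).
  apply: generic_out; apply: contrapT => nex; apply: nw; exists 1%N => c.
  rewrite ipow1 => Qc; apply: contrapT => nc; apply: nex; exists c => //.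
  by move=> [].
move=> /generic_and h /h {h}; apply: generic_weak => a Qa [na [c hc]].
(* The coefficients [b] for which [b *: w] is eventually in [U]. They are generated in degree [c1],
   so that one exponent [t] serves for generators of all degrees and eventual membership becomes
   membership in large degrees. *)
pose K s : ideal A := capS (ipow Q A^o s) (preS (actL w) (eventually_in sU (n + s))).
have [||c1 hc1] := @stable_gen _ noethA A^o Q K (top_fg noethA).
- by move=> s x [].
- move=> s b x Qb [Qx [t ht]]; split; first exact: ipowM.
  by exists t; rewrite addnS /= -scalerA; apply: transporterM.
have [t ht] : exists t, K c1 ≤ preS (actL w) (transporter Q U (n + c1) t).
  have h k : preS (actL w) (transporter Q U (n + c1) k) ≤ preS (actL w) (transporter Q U (n + c1) k.+1).
    by move=> x; apply: transporterS.
  apply: (fg_le_union (h := h)); first exact: ideal_fg.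
  by move=> x [_ [k hk]]; exists k.
exists (maxn c (n + c1 + t)) => N hN y Wy Uay.
have [u [z [Uu Ez yE]]] : extend Q U n w N y.
  apply: hc => //; first by apply: leq_trans hN; rewrite leq_maxl.
  exact: le_addl.
have hN' : (n + c1 + t <= N)%N by apply: leq_trans hN; rewrite leq_maxr.
have nN : (n <= N)%N by lia.
rewrite nN in Ez; case: Ez => b Qb zE; rewrite /= in zE; subst y z.
apply: subD => //.
have Uabw : U N.+1 (a *: (b *: w)).
  have -> : a *: (b *: w) = a *: (u + b *: w) - a *: u by rewrite scalerDr addrAC subrr add0r.
  by apply: subB => //; apply: (@sU _ _ _).
have NE : (n + (N - n) = N)%N by lia.
have Kb : K (N - n)%N b.
  split=> //; apply: contrapT => nb; rewrite /= NE in nb.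
  (* Otherwise [b *: w] is outside the saturation, and its annihilator contains that of [w] and also
     [a], which the latter does not contain. *)
  apply: (wmax (N, b *: w)); first by split=> //=; rewrite -NE; move: (ipowZ Qb Ww); rewrite addnC.
  split=> /= [s x [Qx Ux]|].
    split=> //=; rewrite /= in Ux; rewrite scalerA mulrC -scalerA.
    have : transporter Q U (n + s) 0 (x *: w) by move=> e _; rewrite addn0; apply: subZ.
    move/(transporter_le sU (leq0n (N - n)))=> /(_ b Qb).
    by rewrite -addnA [(s + _)%N]addnC addnA NE.
  exists 1%N => h; apply: na; apply: h; split; first by rewrite ipow1.
  by rewrite addn1.
have : K (c1 + (N - n - c1))%N b by have -> : (c1 + (N - n - c1) = N - n)%N by lia.
rewrite hc1 iter_smul_sub => hb.
suff : smul (ipow Q A^o (N - n - c1)) (K c1) ≤ preS (actL w) (U N) by apply.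
apply: smul_le => x k Qx Kk; rewrite /= -scalerA.
have /(transporter_le sU _) h := ht k Kk.
have -> : N = (n + c1 + (N - n - c1))%N by lia.
by apply: (h (N - n - c1)%N) => //; lia.
Qed.

(** The case [U n = Q^(n+1) M], for which the quotient of the Rees module is the associated graded
    module. *)
Lemma generic_superficial Q M : fg (topS M) -> generic Q (superficial Q M).
Proof.
move=> fM; have := @generic_family Q M (fun n => ipow Q M n.+1) fM.
have h : stable Q (fun n => ipow Q M n.+1) by move=> n a x; apply: ipowM.
move=> /(_ h (fun n => ipow_le (leqnSn n))); apply: generic_weak => a Qa [c hc].
by exists c => n cn w; apply: hc.
Qed.

Section Consequences.
Variables (Q : ideal A) (M : lmodType A) (a : A).
Hypotheses (fM : fg (topS M)) (Qm : Q ≤ mm) (Qa : Q a) (sa : superficial Q M a).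

Lemma superficial_colon : exists c, forall n, (c <= n)%N ->
  forall w, ipow Q M c w -> ipow Q M n.+1 (a *: w) -> ipow Q M n w.
Proof.
have [c hc] := sa; exists c => n /subnK <-; elim: (n - c)%N => [|k IH] // w Ww aw.
by apply: hc; rewrite ?leq_addl //; apply: IH => //; apply: ipow_le aw; rewrite !ltnS.
Qed.

Lemma superficial_ann : exists c, forall w, ipow Q M c w -> a *: w = 0 -> w = 0.
Proof.
have [c hc] := superficial_colon; exists c => w Ww aw.
apply: (krull H fM Qm) => n; case: (leqP c n) => cn; last by apply: ipow_le Ww; apply: ltnW.
by apply: hc => //; rewrite aw; apply: sub0.
Qed.

(** If [a *: w] is in [Q^(n+1) M], Artin-Rees writes it as [a *: v] with [v] in a high power of [Q];
    the colon property applies to [v], and [w - v] is killed by [a]. *)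
Lemma superficial_colonE : exists c, forall n, (c <= n)%N ->
  preS (scal M a) (ipow Q M n.+1) = addS (ipow Q M n) (kerS (scal M a)).
Proof.
have [c hc] := superficial_colon.
have [k hk] := artin_rees noethA Q (imS (scal M a)) fM.
exists (c + k)%N => n cn; apply: sle_anti => w.
  move=> aw; have : smul (ipow Q A^o (n.+1 - k)) (imS (scal M a)) (a *: w).
    by apply: hk; split; [exists w | rewrite subnKC //; lia].
  rewrite -img_smul -ipowE => -[v Wv /= E].
  exists v, (w - v); split=> /=; [|by rewrite scalerBr E subrr|by rewrite addrC subrK].
  apply: hc; first by lia.
    by apply: ipow_le Wv; lia.
  by rewrite -E.
move=> [u [v [Wu /= av ->]]]; rewrite /= scalerDr av addr0; exact: ipowM.
Qed.
End Consequences.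
End Superficial.

(** * Hilbert functions and dimension *)

Section FiniteLength.
Variables (A : comNzRingType) (m : submodClosed A^o) (H : noeth_local m).
Implicit Types M N P : lmodType A.
Implicit Types I Q p : ideal A.
Local Notation mm := (ofS m).
Let noethA := nl_noeth H.

Lemma flen_simple M (S : submodule M) y : (forall a : A, mm a -> S (a *: y)) ->
  flen S (addS S (seqS [:: y])).
Proof.
move=> hy; case: (pselect (S y)) => Sy.
  exists 0%N => /=; apply: sle_anti; first exact: le_addl.
  by apply: add_le => // z /seq1P[a ->]; apply: subZ.
exists 1%N; exists (addS S (seqS [:: y])) => //; split; first exact: le_addl.
  by move=> h; apply/Sy/h/le_addr/spanP; rewrite inE.
move=> U SU UT; case: (pselect (U ≤ S)) => [|nU]; [by left | right].
have [u Uu Su] : exists2 u, U u & ~ S u.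
  by apply: contrapT => h; apply: nU => u Uu; apply: contrapT => Su; apply: h; exists u.
apply: add_le => //; apply: span_le => z; rewrite inE => /eqP->.
have [s [_ [Ss /seq1P[a ->] uE]]] := UT u Uu.
have /(unit_mm H)[b ba] : ~ mm a.
  by move=> /hy ay; apply: Su; rewrite uE; apply: subD.
rewrite -[y]scale1r -ba -scalerA; apply: subZ.
by rewrite -(addKr s (a *: y)) -uE; apply: subD => //; apply/subN/SU.
Qed.

Lemma flen_smul M (S T : submodule M) : fg T -> smul mm T ≤ S -> flen S (addS S T).
Proof.
move=> [s ->]; elim: s => [|y s IH] h.
  by rewrite seqS_nil addSC add_bot; apply: flen_refl.
rewrite seqS_cons [addS (seqS _) _]addSC addSA.
apply: flen_trans (IH _) _.
  by apply: sle_trans h; apply: smul_mono => //; rewrite seqS_cons; apply: le_addr.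
apply: flen_simple => a ma; apply: le_addl; apply: h; apply: smulP => //.
by apply: spanP; rewrite inE eqxx.
Qed.

Lemma flen_mm M r : fg (topS M) -> flen (ipow mm M r) (topS M).
Proof.
move=> fM; elim: r => [|r IH]; first exact: flen_refl.
apply: flen_trans IH; have := @flen_smul M (ipow mm M r.+1) (ipow mm M r).
by rewrite add_id; [apply => //; exact: le_fg fM _ | exact: smul_sub].
Qed.

Lemma flen_top M (S : submodule M) r : fg (topS M) -> ipow mm M r ≤ S -> flen S (topS M).
Proof. by move=> fM h; apply: flen_sub (flen_mm r fM) h _ _. Qed.

Definition killed M := exists r, forall a : A, ipow mm A^o r a -> forall x : M, a *: x = 0.

Lemma killed_ipow M r : (forall a : A, ipow mm A^o r a -> forall x : M, a *: x = 0) <->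
  ipow mm M r = botS M.
Proof.
split=> h; last by move=> a ma x; have : ipow mm M r (a *: x);
  [rewrite ipowE; apply: smulP | rewrite h].
by apply: sle_anti => [|x ->]; [rewrite ipowE; apply: smul_le => a x ma _; apply: h | apply: sub0].
Qed.

Lemma killed_finl M : fg (topS M) -> killed M -> finl M.
Proof. by move=> fM [r /killed_ipow h]; apply: (flen_top (r := r)) => //; rewrite h. Qed.

Lemma killed_inj M N (i : {linear M -> N}) : injective i -> killed N -> killed M.
Proof.
by move=> ii [r h]; exists r => a ma x; apply: ii; rewrite linearZ linear0; apply: h.
Qed.
Lemma killed_onto M N (p : {linear M -> N}) : onto p -> killed M -> killed N.
Proof.
by move=> ps [r h]; exists r => a ma y; have [x ->] := ps y; rewrite -linearZ h // linear0.
Qed.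
Lemma killed_ext M N P (i : {linear M -> N}) (p : {linear N -> P}) :
  (forall x, p x = 0 -> exists u, x = i u) -> killed M -> killed P -> killed N.
Proof.
move=> ip [r hr] [s hs]; exists (r + s)%N; apply/killed_ipow.
apply: sle_anti; last exact: sle_bot.
rewrite ipow_smul; apply: smul_le => a x ma hx.
have : ipow mm N s ≤ kerS p.
  by rewrite ipowE; apply: smul_le => b y mb _; rewrite /= linearZ; apply: hs.
by move/(_ _ hx)/ip => [u ->]; rewrite -linearZ hr // linear0.
Qed.

Definition mprimary Q := Q ≤ mm /\ exists r, ipow mm A^o r ≤ Q.

Lemma mprimary_ipow Q n : mprimary Q -> exists r, forall M, ipow mm M r ≤ ipow Q M n.
Proof. by move=> [_ [r hr]]; exists (r * n)%N => M; rewrite ipow_add; apply: ipow_mono. Qed.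

Section Hilbert.
Variable Q : ideal A.
Hypothesis Qm : mprimary Q.

Lemma flen_ipow M n : fg (topS M) -> flen (ipow Q M n) (topS M).
Proof. by move=> fM; have [r hr] := mprimary_ipow n Qm; apply: flen_top (hr M). Qed.
Lemma flen_ge_ipow M n (S T : submodule M) : fg (topS M) ->
  ipow Q M n ≤ S -> S ≤ T -> flen S T.
Proof. by move=> fM h k; apply: flen_sub (flen_ipow n fM) h k _. Qed.

Definition hsf M n := ilen (ipow Q M n) (topS M).

Lemma hsf_mono M n k : fg (topS M) -> (n <= k)%N -> (hsf M n <= hsf M k)%N.
Proof.
by move=> fM nk; apply: ilen_mono (flen_ipow k fM) (ipow_le nk) _ _.
Qed.

Lemma pre_ipow M N (p : {linear M -> N}) n : onto p ->
  preS p (ipow Q N n) = addS (ipow Q M n) (kerS p).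
Proof.
move=> ps; rewrite -(img_ipow Q n (im_onto ps)); apply: sle_anti => x.
  move=> [y Qy /= E]; exists y, (x - y); split=> //=; last by rewrite addrC subrK.
  by rewrite linearB E subrr.
by move=> [y [z [Qy /= pz ->]]]; exists y; rewrite // linearD pz addr0.
Qed.

Lemma hsf_onto M N (p : {linear M -> N}) n : onto p ->
  hsf N n = ilen (addS (ipow Q M n) (kerS p)) (topS M).
Proof.
move=> ps; by rewrite -pre_ipow // ilen_ker im_onto // add_id.
Qed.
Lemma hsf_onto_le M N (p : {linear M -> N}) n : fg (topS M) -> onto p -> (hsf N n <= hsf M n)%N.
Proof.
move=> fM ps; rewrite (hsf_onto n ps); apply: ilen_mono (flen_ipow n fM) _ _ _ => //; exact: le_addl.
Qed.
Lemma hsf_isom M N n : isom M N -> hsf M n = hsf N n.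
Proof.
move=> [f [fi fs]]; rewrite (hsf_onto n fs) /kerS (pre_inj fi) addSC add_bot //.
Qed.

Definition mquo M (a : A) : lmodType A := qmod (imS (scal M a)).
Definition mker M (a : A) : lmodType A := smd (kerS (scal M a)).
Definition mquo_prj M a : {linear M -> mquo M a} := prj (imS (scal M a)).

Lemma mquo_ker M a : kerS (mquo_prj M a) = imS (scal M a).
Proof. by apply: subm_eq => x; apply: prj0. Qed.
Lemma hsf_mquo M a n : hsf (mquo M a) n = ilen (addS (ipow Q M n) (imS (scal M a))) (topS M).
Proof. by rewrite (hsf_onto n (prj_onto _)) mquo_ker. Qed.
Lemma mquo_fg M a : fg (topS M) -> fg (topS (mquo M a)).
Proof. exact: fg_onto (prj_onto _). Qed.
Lemma mker_fg M a : fg (topS M) -> fg (topS (mker M a)).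
Proof. by move=> fM; apply: fg_smd; apply: (le_fg noethA fM). Qed.

Lemma hsf_step M a n : fg (topS M) ->
  hsf M n.+1 = (ilen (preS (scal M a) (ipow Q M n.+1)) (topS M) + hsf (mquo M a) n.+1)%N.
Proof.
move=> fM; rewrite ilen_ker hsf_mquo; apply: ilen_add => //; last exact: le_addl.
exact: flen_ipow.
Qed.
Lemma hsf_step_le M a n : fg (topS M) -> Q a -> (hsf M n.+1 <= hsf M n + hsf (mquo M a) n.+1)%N.
Proof.
move=> fM Qa; rewrite (hsf_step a n fM) leq_add2r.
apply: ilen_mono (flen_ipow n fM) _ _ _ => // x; exact: ipowM.
Qed.

Lemma superficial_killed M a : fg (topS M) -> Q a -> superficial Q M a -> killed (mker M a).
Proof.
move=> fM Qa sa; have [c hc] := superficial_ann H fM Qm.1 sa.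
have [r hr] := mprimary_ipow c Qm; exists r => b mb x.
apply: inc_injective; rewrite linear0 linearZ; apply: hc.
  by rewrite ipowE; apply: smulP => //; apply: hr.
by have /= ax := incP x; rewrite scalerA mulrC -scalerA ax scaler0.
Qed.

(** For large [n] the colon [(Q^(n+1) M : a)] is the sum of [Q^n M] and [(0 :_M a)], and the sum is
    direct; insert this into [hsf_step]. *)
Lemma hsf_superficial M a : fg (topS M) -> Q a -> superficial Q M a ->
  exists c, forall n, (c <= n)%N ->
  (hsf M n.+1 + len (mker M a) = hsf M n + hsf (mquo M a) n.+1)%N.
Proof.
move=> fM Qa sa; have [c hc] := superficial_colonE H fM Qa sa.
have [k hk] := superficial_ann H fM Qm.1 sa.
exists (maxn c k) => n; rewrite geq_max => /andP[cn kn].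
rewrite (hsf_step a n fM) hc // addnAC; congr addn.
have [_ ->] := len_smd (kerS (scal M a)).
rewrite /hsf; have -> := ilen_add (flen_ipow n fM) (@le_addl _ _ (ipow Q M n) (kerS (scal M a))) (fun _ _ => Logic.I).
rewrite addnC; congr addn; rewrite -ilen_diamond.
suff -> : capS (ipow Q M n) (kerS (scal M a)) = botS M by [].
apply: sle_anti; last exact: sle_bot.
by move=> x [/(ipow_le kn) Qx /= ax]; apply: hk.
Qed.

Lemma hsf_killed M : fg (topS M) -> killed M -> exists c, forall n, (c <= n)%N -> hsf M n = len M.
Proof.
move=> fM [r hr]; exists r => n rn; rewrite /hsf.
have -> : ipow Q M n = botS M; last by [].
apply: sle_anti; last exact: sle_bot.
move=> x /(ipow_le rn)/(ipow_mono Qm.1).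
by rewrite (killed_ipow M r).1.
Qed.
End Hilbert.

Lemma ofS_ipow (I : submodClosed A^o) M k :
  ofS (ideal_pow M I k) = ipow (ofS I) M k.
Proof.
elim: k => [|k IH]; first exact: subm_eq.
rewrite ipowS -IH; apply: subm_eq => x; split.
  move=> /asboolP h.
  have := h (toS (smul (ofS I) (ofS (ideal_pow M I k)))) => /(_ _)/toSP; apply.
  by move=> _ [a [y [Ia Ky ->]]]; apply/toSP; apply: smulP.
have le : smul (ofS I) (ofS (ideal_pow M I k)) ≤ ofS (ideal_pow M I k.+1).
  by apply: smul_le => a y Ia Ky; apply/asboolP => S; apply; exists a, y.
exact: le.
Qed.

Lemma hsf_length (I : submodClosed A^o) M n : mprimary (ofS I) -> fg (topS M) ->
  module_length (quotient_mod (ideal_pow M I n)) = (hsf (ofS I) M n)%:Z%:E.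
Proof.
move=> Im fM.
have [h k] := len_onto (@proj_onto _ _ (ideal_pow M I n)).
rewrite proj_ker ofS_ipow in h k; rewrite module_lengthE ?k //; apply/h; exact: flen_ipow.
Qed.
End FiniteLength.

(** * Krull dimension: chains of primes and growth of Hilbert functions *)

Section Dimension.
Variables (A : comNzRingType) (m : submodClosed A^o) (H : noeth_local m).
Implicit Types M N : lmodType A.
Implicit Types I J Q p : ideal A.
Local Notation mm := (ofS m).
Let noethA := nl_noeth H.

Definition prime_chain n (F : nat -> ideal A) :=
  (forall i, (i <= n)%N -> prime (F i)) /\
  forall i, (i < n)%N -> F i ≤ F i.+1 /\ ~ F i.+1 ≤ F i.

(** Only an upper bound, satisfied by the zero module for every [n]; the proofs by induction on
    dimension can then use it without a case distinction for zero modules. *)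
Definition dim_le M n := forall k F, prime_chain k F -> annS M ≤ F 0%N -> (k <= n)%N.

Lemma prime_pow p (x : A) n : prime p -> p (x ^+ n) -> p x.
Proof.
move=> [p1 pM]; elim: n => [|n IH]; first by rewrite expr0.
by rewrite exprS => /pM[|/IH].
Qed.

Lemma prime_chain_tail n F : prime_chain n.+1 F -> prime_chain n (fun i => F i.+1).
Proof. by move=> [h k]; split=> i lin; [apply: h | apply: k]. Qed.

Lemma prime_chain_cons n F p : prime p -> p ≤ F 0%N -> ~ F 0%N ≤ p -> prime_chain n F ->
  prime_chain n.+1 (fun i => if i is j.+1 then F j else p).
Proof. by move=> pp le nle [h k]; split=> -[|i] lin //; [apply: h | apply: k]. Qed.

Lemma prime_ipow p n I : prime p -> ipow I A^o n ≤ p -> I ≤ p.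
Proof.
move=> pp h x Ix; apply: (@prime_pow p x n pp); apply: h.
elim: n => [|n IH] //; rewrite exprS; exact: ipowM.
Qed.

Lemma prime_smul p I J : prime p -> (forall a b : A, I a -> J b -> p (a * b)) -> I ≤ p \/ J ≤ p.
Proof.
move=> [_ pM] h; case: (pselect (I ≤ p)) => [|nI]; [by left | right => b Jb].
apply: contrapT => pb; apply: nI => a Ia.
by case: (pM _ _ (h _ _ Ia Jb)).
Qed.

Lemma prime_exists (S : A -> Prop) J : S 1 -> (forall a b, S a -> S b -> S (a * b)) ->
  (forall a, J a -> ~ S a) -> exists p, [/\ prime p, J ≤ p & forall a, p a -> ~ S a].
Proof.
move=> S1 SM JS.
have [|||p [Jp pS] pmax] := @acc_sup _ _ (topS A^o) (fun p => J ≤ p /\ forall a, p a -> ~ S a).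
- exact: (fg_acc noethA (ideal_fg noethA _)).
- by move=> T _ x.
- by exists J; split.
exists p; split=> //; split; first by move/pS; apply.
move=> a b pab; apply: contrapT => /not_orP[pa pb].
have meet c : ~ p c -> exists x y : A, [/\ p x & S (x + y * c)].
  move=> pc; apply: contrapT => nex; apply: pc.
  rewrite -(pmax (addS p (seqS [:: c : A^o]))); last exact: le_addl.
    by apply: le_addr; apply: spanP; rewrite inE.
  split; first by move=> x /Jp; apply: le_addl.
  by move=> _ [x [_ [px /seq1P[y ->] ->]]] Sx; apply: nex; exists x, y.
have [x [y [px Sx]]] := meet a pa; have [z [t [pz Sz]]] := meet b pb.
apply: (pS _ _ (SM _ _ Sx Sz)).
rewrite mulrDl; apply: (subD (S := p)); first by rewrite mulrC; apply: (subZ (S := p)).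
rewrite mulrDr; apply: (subD (S := p)); first by apply: (subZ (S := p)).
by rewrite mulrACA; apply: (subZ (S := p)).
Qed.

Lemma pow_generate I J : (forall x, I x -> exists n, J (x ^+ n)) -> exists r, ipow I A^o r ≤ J.
Proof.
have [s ->] := ideal_fg noethA I; elim: s => [|x s IH] h.
  by exists 1%N; rewrite seqS_nil ipow_bot; apply: sle_bot.
rewrite seqS_cons in h *.
have [|r hr] := IH; first by move=> y ys; apply: h; apply: le_addr.
have [n Jn] : exists n, J (x ^+ n) by apply: h; apply: le_addl; apply: spanP; rewrite inE.
(* In a product of [x^i] and the power [n + r - i] of the ideal of the other generators, either
   [i >= n] or the second exponent is at least [r]. *)
exists (n + r)%N; apply: (sle_trans (@ipow_layers _ _ _ _ _)).
elim: (n + r).+1 => [|i IHi] /=; first exact: sle_bot.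
apply: add_le => //; case: leqP => [iN|_]; last exact: sle_bot.
move=> _ [z Wz ->] /=.
case: (leqP n i) => ni.
  have E : (x : A) ^+ i * (z : A) = ((x : A) ^+ (i - n) * (z : A)) * (x : A) ^+ n.
    by rewrite mulrAC -exprD subnK.
  suff : J ((x : A) ^+ i * (z : A)) by [].
  rewrite E; exact: (subZ (S := J) _ Jn).
apply: (subZ (S := J)); apply: hr; apply: ipow_le Wz; lia.
Qed.

Lemma dim_le_ann M N n : annS M ≤ annS N -> dim_le M n -> dim_le N n.
Proof. by move=> le h k F Fc a; apply: (h k F Fc); apply: sle_trans a. Qed.
Lemma dim_le_inj M N (i : {linear M -> N}) n : injective i -> dim_le N n -> dim_le M n.
Proof.
move=> ii; apply: dim_le_ann => a h x; apply: ii.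
by rewrite linearZ linear0; apply: h.
Qed.
Lemma dim_le_onto M N (p : {linear M -> N}) n : onto p -> dim_le M n -> dim_le N n.
Proof.
move=> ps; apply: dim_le_ann => a h y; have [x ->] := ps y.
by rewrite -linearZ h linear0.
Qed.
Lemma dim_le_mono M n k : (n <= k)%N -> dim_le M n -> dim_le M k.
Proof. by move=> nk h l F Fc a; apply: leq_trans nk; apply: h Fc a. Qed.

(** The product of [m^r] and [Ann M] kills [N]. So the first prime of a chain above [Ann N] contains
    [Ann M], or it contains [m^r] and is [m], and the chain has length 0. *)
Lemma dim_le_ext M N (i : {linear M -> N}) n :
  (exists r, forall a : A, ipow mm A^o r a -> forall y, exists x, a *: y = i x) ->
  dim_le M n -> dim_le N n.
Proof.
move=> [r hr] h k F Fc aF; have F0 := Fc.1 0%N isT.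
have [rF|aM] : ipow mm A^o r ≤ F 0%N \/ annS M ≤ F 0%N.
- apply: prime_smul => // a b ma Mb; apply: aF => y.
  have [x xE] := hr a ma y.
  by rewrite mulrC -scalerA xE -linearZ Mb linear0.
- case: k Fc {aF} => // k [Fp Fl]; have [le nle] := Fl 0%N isT.
  case: nle => x F1x; apply: (prime_ipow F0 rF).
  exact: (prime_le_mm H (Fp 1%N isT)).
- exact: h Fc aM.
Qed.

Lemma dim0_killed M : fg (topS M) -> dim_le M 0 -> killed m M.
Proof.
move=> fM h; have [|r hr] := @pow_generate mm (annS M); last first.
  by exists r => a /hr.
move=> x mx; apply: contrapT => nx.
have [||a Ma [n aE]|p [pp Mp pS]] := @prime_exists (fun a => exists n, a = x ^+ n) (annS M).
- by exists 0%N; rewrite expr0.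
- by move=> a b [i ->] [j ->]; exists (i + j)%N; rewrite exprD.
- by apply: nx; exists n; rewrite -aE.
suff : (1 <= 0)%N by [].
apply: (h 1%N (fun i => if i is 0 then p else mm)) => //; split.
  by move=> [|i] _ //; apply: mm_prime H.
move=> [|i] // _; split; first exact: (prime_le_mm H).
by move=> mp; apply: (pS x); [apply: mp | exists 1%N; rewrite expr1].
Qed.

Lemma killed_dim0 M : killed m M -> dim_le M 0.
Proof.
move=> [r hr] [|k] F // Fc aF; case: Fc => Fp Fl; have [le nle] := Fl 0%N isT.
case: nle => x F1x; apply: (@prime_ipow (F 0%N) r mm (Fp 0%N isT)).
  by move=> a ma; apply: aF; apply: hr.
exact: (prime_le_mm H (Fp 1%N isT)).
Qed.

Lemma killed_mquo_pow M a n : killed m (mker M a) ->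
  exists r, forall b : A, ipow mm A^o r b -> forall x : M, a ^+ n *: x = 0 -> b *: x = 0.
Proof.
move=> [r hr]; exists (r * n)%N; elim: n => [|n IH] b mb x ax.
  by move: ax; rewrite expr0 scale1r => ->; rewrite scaler0.
move: b mb; suff : ipow mm A^o (r * n.+1) ≤ preS (actL x) (botS M) by [].
rewrite mulnS ipow_smul; apply: smul_le => b c mb mc /=.
rewrite -scalerA scalerA mulrC -scalerA; apply: IH => //.
rewrite scalerA mulrC -scalerA.
have [u uE] : exists u : mker M a, a ^+ n *: x = inc _ u.
  by apply: inc_onto; rewrite /= scalerA -exprS.
by rewrite uE -linearZ hr // linear0.
Qed.

(** A chain above [Ann (M / aM)] is prolonged downwards by a prime [p ≥ Ann M] inside [F 0] that
    does not contain [a]: a prime avoiding all products of a power of [a] and an element [t] outside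
    [F 0]. If such a product killed [M], then [t] times a power of [m] would kill [M], which forces
    [m ≤ F 0]; then the given chain has length 0 anyway. *)
Lemma dim_le_mquo M a s : killed m (mker M a) -> dim_le M s.+1 -> dim_le (mquo M a) s.
Proof.
move=> kM h k F Fc aF; have F0 := Fc.1 0%N isT.
have MF : annS M ≤ F 0%N.
  apply: sle_trans aF => b hb y; have [x ->] := prj_onto _ y.
  by rewrite -linearZ hb linear0.
have Fa : F 0%N a.
  apply: aF => y; have [x ->] := prj_onto _ y.
  by rewrite -linearZ; apply/prj0; exists x.
case: (pselect (mm ≤ F 0%N)) => mF.
  case: k Fc => // k [Fp Fl]; have [_ []] := Fl 0%N isT.
  by apply: sle_trans mF; apply: (prime_le_mm H); apply: Fp.
have [|x y [i [s1 [Fs1 ->]]] [j [t1 [Ft1 ->]]]|x Mx [n [t [Ft xE]]]|p [pp Mp pS]] :=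
    @prime_exists (fun x => exists n t, ~ F 0%N t /\ x = a ^+ n * t) (annS M).
- by exists 0%N, 1; rewrite expr0 mulr1; split=> //; apply: F0.1.
- exists (i + j)%N, (s1 * t1); rewrite mulrACA exprD; split=> //.
  by move/F0.2 => [].
- apply: mF; have [r hr] := killed_mquo_pow n kM.
  have [|rF|tF] := @prime_smul (F 0%N) (ipow mm A^o r) (seqS [:: t : A^o]) F0; last 1 first.
  + by case: Ft; apply: tF; apply: spanP; rewrite inE.
  + move=> b _ mb /seq1P[c ->]; rewrite [_ *: _]/(_ * _) mulrCA; apply: (subZ (S := F 0%N)).
    apply: MF => y; rewrite -scalerA; apply: hr => //.
    by rewrite scalerA -xE; apply: Mx.
  exact: prime_ipow rF.
have /h : prime_chain k.+1 (fun i => if i is j.+1 then F j else p).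
  apply: prime_chain_cons => //.
    move=> x px; apply: contrapT => Fx; apply: (pS _ px).
    by exists 0%N, x; rewrite expr0 mul1r.
  move=> Fp; apply: (pS a); first exact: Fp.
  by exists 1%N, 1; rewrite expr1 mulr1; split=> //; apply: F0.1.
exact.
Qed.

Section Growth.
Variables (Q : ideal A) (Qm : mprimary m Q).

Definition growth M r := exists C, forall n, (hsf Q M n <= C * n.+1 ^ r)%N.

Lemma growth_step M a r : fg (topS M) -> Q a -> growth (mquo M a) r -> growth M r.+1.
Proof.
move=> fM Qa [C hC]; exists C; elim=> [|n IH].
  by rewrite /hsf ilen_refl.
apply: leq_trans (hsf_step_le H Qm n fM Qa) _.
apply: leq_trans (leq_add IH (hC _)) _.
rewrite -mulnDr leq_mul2l; apply/orP; right.
have h : (n.+1 ^ r <= n.+2 ^ r)%N by case: r {hC IH} => [|r]; rewrite ?expn0 // leq_exp2r ?leqnSn.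
by rewrite !expnS; have := leq_mul (leqnn n.+1) h; lia.
Qed.

Lemma growth_onto M N (f : {linear M -> N}) r : fg (topS M) -> onto f -> growth M r -> growth N r.
Proof.
move=> fM fs [C hC]; exists C => n; apply: leq_trans (hC n).
exact: (hsf_onto_le H Qm n fM fs).
Qed.

Lemma dim_le_growth M s : fg (topS M) -> dim_le M s -> growth M s.
Proof.
elim: s M => [|s IH] M fM hM.
  have kM := dim0_killed fM hM; have fin := killed_finl H fM kM.
  by exists (len M) => n; rewrite expn0 muln1; apply: ilen_mono fin _ _ _ => //; apply: sle_bot.
have [a Qa sa] := generic_ex H (generic_superficial H Q fM).
apply: (growth_step fM Qa); apply: IH; first exact: mquo_fg.
by apply: dim_le_mquo => //; apply: (superficial_killed H Qm fM Qa sa).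
Qed.

Lemma annS_seq M (l : seq M) b :
  topS M = seqS l -> (forall y, y \in l -> b *: y = 0) -> annS M b.
Proof.
move=> lE hb x; have : topS M ≤ preS (scal M b) (botS M) by rewrite lE; apply: span_le.
by apply.
Qed.

Section Telescope.
Variables (p : ideal A) (pp : prime p) (M : lmodType A).
Hypothesis fM : fg (topS M).

Definition ptors_pred x := exists2 s : A, ~ p s & smul p (topS M) (s *: x).
Lemma ptors0 : ptors_pred 0.
Proof. by exists 1; [exact: pp.1 | rewrite scaler0; apply: sub0]. Qed.
Lemma ptorsL (a : A) x y : ptors_pred x -> ptors_pred y -> ptors_pred (a *: x + y).
Proof.
move=> [s ps hs] [t pt ht]; exists (s * t); first by move/pp.2 => [].
rewrite scalerDr; apply: subD; last by rewrite -scalerA; apply: subZ.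
have -> : (s * t) *: (a *: x) = (t * a) *: (s *: x) by rewrite !scalerA; congr (_ *: _); ring.
exact: subZ.
Qed.
(* [ptors] is the kernel of [M -> (M/pM)_p]. *)
Definition ptors : submodule M := SubM ptors0 ptorsL.

Lemma ptors_regular (x : A) y : ~ p x -> ptors (x *: y) -> ptors y.
Proof. by move=> px [s ps hs]; exists (s * x); [move/pp.2 => [] | rewrite -scalerA]. Qed.

Lemma ptors_ann c : annS M ≤ p -> ~ p c -> ~ (forall y, ptors (c *: y)).
Proof.
move=> Mp pc h; have [l lE] := fM.
have [s ps hs] : exists2 s, ~ p s & forall y, y \in l -> smul p (topS M) (s *: y).
  elim: l {lE} => [|y l [s ps hs]]; first by exists 1 => //; exact: pp.1.
  have [t pt ht] := h y; exists (s * t * c).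
    by move/pp.2 => [/pp.2[]|].
  move=> z; rewrite inE => /orP[/eqP->|/hs zs].
    by rewrite -!scalerA; apply: subZ.
  have -> : s * t * c = (t * c) * s by ring.
  by rewrite -scalerA; apply: subZ.
have [y|e pe he] := @nakayama_prime A p M l s pp ps; first by rewrite -lE; apply: hs.
by apply: pe; apply: Mp; apply: annS_seq he.
Qed.
End Telescope.

(** Modulo [ptors] for [p = F 0], an element [x] of [F 1] outside [F 0] is regular, and the
    annihilator of [L = N / xN] lies in [F 1], so the tail of the chain belongs to [L]. By
    Artin-Rees, the Hilbert function of [N] grows in every [c] steps by at least that of [L], which
    lowers the exponent by one for [L]. *)
Lemma growth_chain l M r F : fg (topS M) -> growth M r -> prime_chain l F ->
  annS M ≤ F 0%N -> (l <= r)%N.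
Proof.
elim: l M r F => // l IH M r F fM gM Fc MF.
have [F0p F1p] := (Fc.1 0%N isT, Fc.1 1%N isT).
have [le nle] := Fc.2 0%N isT.
have [x F1x F0x] : exists2 x, F 1%N x & ~ F 0%N x.
  by apply: contrapT => h; apply: nle => x F1x; apply: contrapT => F0x; apply: h; exists x.
pose T := ptors F0p M; pose N := qmod T.
have fN : fg (topS N) by apply: fg_onto (prj_onto T) fM.
have gN : growth N r by apply: growth_onto (prj_onto T) gM.
have regx : injective (scal N x).
  apply: linear_injP => y; have [z ->] := prj_onto T y.
  by rewrite -[scal N x _]/(x *: _) -linearZ => /prj0/(ptors_regular F0x) h; apply/prj0.
pose L := mquo N x; have fL : fg (topS L) by apply: mquo_fg.
have annL : annS L ≤ F 1%N.
  move=> b Lb; apply: contrapT => F1b; have [s sE] := fN.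
  have [y ys|c F1c hc] := @nakayama_prime A (F 1%N) N s b F1p F1b.
    have : imS (scal N x) (b *: y).
      by apply/prj0; rewrite linearZ; apply: Lb.
    by move=> [z _ ->] /=; apply: smulP => //; rewrite -sE.
  apply: (@ptors_ann _ F0p M fM c MF); first by move/le.
  move=> y; apply/prj0; rewrite linearZ.
  exact: (@annS_seq N s c sE hc).
have Lne n : (0 < hsf Q L n.+1)%N.
  rewrite lt0n; apply/eqP => /(ilen_eq0 (flen_ipow H Qm n.+1 fL)) E.
  have /(nakayama H fL) L0 : topS L ≤ smul (ofS m) (topS L).
    by rewrite -{1}E ipowS; apply: smul_mono => //; exact: Qm.1.
  apply: F1p.1; apply: annL => y; have : topS L y by [].
  by rewrite L0 => ->; rewrite scaler0.
have [c0 hc0] := artin_rees noethA Q (imS (scal N x)) fN.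
pose c := c0.+1.
have hc j : (hsf Q N j + hsf Q L (c + j) <= hsf Q N (c + j))%N.
  rewrite /c addSn (hsf_step H Qm x _ fN) leq_add2r.
  apply: ilen_mono (flen_ge_ipow (n := (c0 + j).+1) H Qm fN _ _) _ _ _ => // [y|y Qy].
    by move=> Qy; apply: subZ.
  have : smul (ipow Q A^o j.+1) (imS (scal N x)) (x *: y).
    by apply: hc0; split; [exists y | rewrite addnS].
  rewrite -img_smul -ipowE => -[z Qz /regx ->]; exact: ipow_le Qz.
have gm n k : (n <= k)%N -> (hsf Q L n <= hsf Q L k)%N by apply: (hsf_mono H Qm).
have hk k j : (hsf Q N j + k * hsf Q L (c + j) <= hsf Q N (k * c + j))%N.
  elim: k => [|k IHk]; first by rewrite !mul0n add0n addn0.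
  have := hc (k * c + j)%N; rewrite addnA -mulSn; apply: leq_trans.
  have : (hsf Q L (c + j) <= hsf Q L (k.+1 * c + j))%N by apply: gm; rewrite mulSn; lia.
  by rewrite mulSn; lia.
have [C hC] := gN.
(* Take [k = n + 1] and [j = n] in [hk]: about [n] repetitions of a step of fixed size [c] stay
   within a constant multiple of [n]. *)
have bound n : (n.+1 * hsf Q L n <= C * (c.+1 ^ r * n.+1 ^ r))%N.
  rewrite -expnMn; have -> : (c.+1 * n.+1 = (n.+1 * c + n).+1)%N by lia.
  apply: leq_trans (hC _); apply: leq_trans (hk _ _).
  apply: leq_trans (leq_addl _ _); rewrite leq_mul2l; apply/orP; right.
  by apply: gm; rewrite leq_addl.
case: r gM gN hC bound => [|r] gM gN hC bound.
  (* For [r = 0] the bound is constant, but [(n + 1) l(L / Q^n L) >= n + 1] since [L] is nonzero. *)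
  have := bound C.+1; have := Lne C; rewrite !expn0; nia.
have gL : growth L r.
  exists (C * c.+1 ^ r.+1)%N => n; have := bound n.
  have -> : (C * (c.+1 ^ r.+1 * n.+1 ^ r.+1) = n.+1 * (C * c.+1 ^ r.+1 * n.+1 ^ r))%N.
    by rewrite [(n.+1 ^ r.+1)%N]expnS !mulnA [(n.+1 * C)%N]mulnC -!mulnA; congr (_ * _)%N; rewrite mulnCA.
  by rewrite leq_pmul2l.
rewrite ltnS; apply: (IH L r (fun i => F i.+1)) => //.
exact: prime_chain_tail.
Qed.

(** The dimension bounds the growth of the Hilbert function, adding [a] back raises the exponent by
    at most one, and growth bounds the length of prime chains. *)
Lemma dim_le_mquo_ge M a t : fg (topS M) -> Q a -> dim_le (mquo M a) t -> dim_le M t.+1.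
Proof.
move=> fM Qa h k F Fc MF; apply: growth_chain Fc MF => //.
by apply: growth_step Qa _ => //; apply: dim_le_growth => //; apply: mquo_fg.
Qed.
End Growth.
End Dimension.

(** * Hilbert coefficients *)

Section HilbertPolynomial.
Implicit Types e : nat -> int.

Definition hp s e n : int :=
  \sum_(i < s.+1) (-1) ^+ i * e i * 'C(n + s - i, s - i)%:Z.

Lemma hp0 e n : hp 0 e n = e 0%N.
Proof. by rewrite /hp big_ord1 expr0 mul1r bin0 mulr1. Qed.

Lemma hp_last s e n :
  hp s e n = \sum_(i < s) (-1) ^+ i * e i * 'C(n + s - i, s - i)%:Z + (-1) ^+ s * e s.
Proof. by rewrite /hp big_ord_recr /= subnn bin0 mulr1. Qed.

(** By Pascal's rule the difference of each binomial coefficient is the one for [s], so taking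
    differences just drops the last coefficient. *)
Lemma hpS s e n : hp s.+1 e n.+1 - hp s.+1 e n = hp s e n.+1.
Proof.
rewrite (hp_last s.+1 e n.+1) (hp_last s.+1 e n) opprD addrACA subrr addr0 -sumrB.
apply: eq_bigr => -[i /= lis] _.
rewrite -mulrBr; congr (_ * _).
have -> : (n.+1 + s.+1 - i = (n + s - i).+2)%N by lia.
have -> : (n + s.+1 - i = (n + s - i).+1)%N by lia.
have -> : (n.+1 + s - i = (n + s - i).+1)%N by lia.
have -> : (s.+1 - i = (s - i).+1)%N by lia.
by rewrite binS PoszD addrAC subrr add0r.
Qed.

Lemma hp_ext s e e' n : (forall i, (i <= s)%N -> e i = e' i) -> hp s e n = hp s e' n.
Proof. by move=> h; apply: eq_bigr => -[i /= lis] _; rewrite h. Qed.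

Lemma hpB s e e' n : hp s e n - hp s e' n = hp s (fun i => e i - e' i) n.
Proof. by rewrite /hp -sumrB; apply: eq_bigr => i _; rewrite mulrBr mulrBl. Qed.

Lemma hp_uniq s e e' : (exists N, forall n, (N <= n)%N -> hp s e n = hp s e' n) ->
  forall i, (i <= s)%N -> e i = e' i.
Proof.
elim: s => [|s IH] [N hN] i.
  by rewrite leqn0 => /eqP->; have := hN N (leqnn N); rewrite !hp0.
have E j : (j <= s)%N -> e j = e' j.
  by apply: IH; exists N.+1 => -[|n] // Nn; rewrite -(hpS s e) -(hpS s e') !hN // ltnW.
rewrite leq_eqVlt => /orP[/eqP->|]; last exact: E.
have := hN N (leqnn N); rewrite !hp_last.
rewrite (eq_bigr (fun i : 'I_s.+1 => (-1) ^+ i * e' i * 'C(N + s.+1 - i, s.+1 - i)%:Z)).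
  by move=> /addrI/(mulrI _); apply; rewrite unitrX // unitrN1.
by move=> [j /= lj] _; rewrite E.
Qed.

(** Both parts are proved together: the values in one degree are the differences in the next, so
    values at most -1 make the next polynomial tend to minus infinity. *)
Lemma hp_neg s e : e 0%N < 0 ->
  (exists N, forall n, (N <= n)%N -> hp s e n <= -1) /\
  forall B : int, exists N, forall n, (N <= n)%N -> hp s.+1 e n <= B.
Proof.
move=> e0.
have step t : (exists N, forall n, (N <= n)%N -> hp t e n <= -1) ->
    forall B : int, exists N, forall n, (N <= n)%N -> hp t.+1 e n <= B.
  move=> [N hN] B.
  have h k : hp t.+1 e (N + k)%N <= hp t.+1 e N - k%:Z.
    elim: k => [|k IH]; first by rewrite addn0 subr0.
    have := hN (N + k).+1 (leqW (leq_addr _ _)); rewrite -hpS addnS; lia.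
  exists (N + `|hp t.+1 e N - B|)%N => n Nn.
  have := h (n - N)%N; rewrite subnKC; lia.
elim: s => [|s [_ IH]].
  have h0 : exists N : nat, forall n, (N <= n)%N -> hp 0 e n <= -1.
    by exists 0%N => n _; rewrite hp0; lia.
  by split; [exact: h0 | exact: step h0].
have h : exists N : nat, forall n, (N <= n)%N -> hp s.+1 e n <= -1 by apply: IH.
by split; [exact: h | exact: step h].
Qed.

Lemma hp_ge0 s e : (exists N, forall n, (N <= n)%N -> 0 <= hp s e n) -> 0 <= e 0%N.
Proof.
move=> [N hN]; rewrite leNgt; apply/negP => e0; have [[K hK] _] := hp_neg s e0.
have := hK _ (leq_maxl K N); have := hN _ (leq_maxr K N); lia.
Qed.
Lemma hpS_ge0 s e c : (exists N, forall n, (N <= n)%N -> c <= hp s.+1 e n) -> 0 <= e 0%N.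
Proof.
move=> [N hN]; rewrite leNgt; apply/negP => e0; have [_ h] := hp_neg s e0.
have [K hK] := h (c - 1).
have := hK _ (leq_maxl K N); have := hN _ (leq_maxr K N); lia.
Qed.

Lemma hp_sum s e (f : nat -> int) :
  (exists N, forall n, (N <= n)%N -> f n.+1 - f n = hp s e n.+1) ->
  exists2 e', (forall i, (i <= s)%N -> e' i = e i) &
    exists N, forall n, (N <= n)%N -> f n = hp s.+1 e' n.
Proof.
move=> [N hN]; pose g x i := if (i <= s)%N then e i else x.
have gE x n : hp s.+1 (g x) n = hp s.+1 (g 0) n + (-1) ^+ s.+1 * x.
  rewrite !hp_last {2 4}/g ltnn mulr0 addr0; congr (_ + _).
  by apply: eq_bigr => -[i /= lis] _; rewrite /g -ltnS lis.
(* The last coefficient is chosen to make both sides agree at [N]; from there on their differences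
   agree. *)
pose x := (-1) ^+ s.+1 * (f N - hp s.+1 (g 0) N).
have gs i y : (i <= s)%N -> g y i = e i by rewrite /g => ->.
exists (g x) => [i /gs//|]; exists N => n /subnKC <-.
elim: (n - N)%N => [|k IH].
  by rewrite addn0 gE mulrA -expr2 sqrr_sign mul1r addrC subrK.
rewrite addnS; apply: (addIr (- hp s.+1 (g x) (N + k)%N)).
rewrite hpS -IH hN ?leq_addr //.
by apply: hp_ext => i lis; rewrite gs.
Qed.
End HilbertPolynomial.

(** * Dimension as a natural number; existence and uniqueness of Hilbert polynomials *)

Section Coefficients.
Variables (A : comNzRingType) (m : submodClosed A^o) (H : noeth_local m).
Implicit Types M : lmodType A.

(** For an unbounded set the supremum is [+oo] and for the empty set [-oo], so a finite value is a
    maximum. *)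
Lemma sup_nat_fin (P : nat -> Prop) (d : nat) : sup_nat P = d%:Z%:E ->
  P d /\ forall n, P n -> (n <= d)%N.
Proof.
case: (pselect (exists d0, forall n, P n -> (n <= d0)%N)) => [[d0 hd0]|nb].
  case: (pselect (exists n, P n)) => [[n0 Pn0]|nP].
    have ex : exists n, `[< P n >] by exists n0; apply/asboolP.
    have ub n : `[< P n >] -> (n <= d0)%N by move/asboolP/hd0.
    case: (ex_maxnP ex ub) => k /asboolP Pk kmax.
    have Pmax n : P n -> (n <= k)%N by move=> Pn; apply: kmax; apply/asboolP.
    by rewrite (sup_nat_max Pk Pmax) => -[[<-]].
  rewrite /sup_nat /supremum ifT //; apply/eqP/seteqP; split=> // x [n Pn].
  by case: nP; exists n.
rewrite /sup_nat; set B := (X in supremum _ X).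
have hB : supremums B +oo%E.
  split; first by move=> x _; rewrite leey.
  move=> [r|//|] hr; last first.
    have [n Pn] : exists n, P n by apply: contrapT => h; apply: nb; exists 0%N => n Pn; case: h; exists n.
    by have := hr n%:Z%:E; rewrite /B /= => /(_ (ex_intro2 _ _ n Pn erefl)).
  case: nb; exists `|r|%N => n Pn.
  have := hr n%:Z%:E; rewrite /B /= => /(_ (ex_intro2 _ _ n Pn erefl)).
  by rewrite lee_fin; lia.
rewrite /supremum; case: ifPn => // _.
have hx : supremums B (xget -oo%E (supremums B)) by apply: xgetPex; exists +oo%E.
by rewrite (is_subset1_supremums hx hB).
Qed.

Definition above M n := exists F, prime_chain n F /\ annS M ≤ F 0%N.

Lemma mdim_above M : mdim M = sup_nat (above M).
Proof.
congr sup_nat; apply/funext => n; apply/propext; split.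
  move=> [F [Fp aF Fc]]; exists (fun i => ofS (F i)); split; last first.
    by move=> a Ma; apply: aF.
  by split=> i lin; [apply/prime_ofS/Fp | have [h k] := Fc i lin; split].
move=> [F [[Fp Fc] aF]]; exists (fun i => toS (F i)); split.
- by move=> i lin; apply/prime_toS/Fp.
- by move=> a Ma; apply/toSP; apply: aF.
move=> i /Fc[h k]; split=> [x /toSP/h/toSP//|h'].
by apply: k => x /toSP/h'/toSP.
Qed.

Lemma dim_leP M n : dim_le M n <-> forall k, above M k -> (k <= n)%N.
Proof. by split=> [h k [F [Fc aF]]|h k F Fc aF]; [apply: h Fc aF | apply: h; exists F]. Qed.

Lemma mdim_fin M d : mdim M = d%:Z%:E -> [/\ above M d, dim_le M d & ndim M = d].
Proof.
move=> E; have := E; rewrite mdim_above => /sup_nat_fin[h1 h2].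
by split=> //; [apply/dim_leP | rewrite /ndim E].
Qed.
Lemma mdim_eq M d : above M d -> dim_le M d -> mdim M = d%:Z%:E.
Proof. by move=> h1 /dim_leP h2; rewrite mdim_above; apply: sup_nat_max. Qed.

Lemma mdim_cases M d : dim_le M d ->
  (mdim M = -oo%E /\ forall k, ~ above M k) \/
  exists s, [/\ mdim M = s%:Z%:E, above M s & dim_le M s].
Proof.
move=> /dim_leP hd.
case: (pselect (exists n, above M n)) => [[n0 Pn0]|nP]; [right | left].
  have ex : exists n, `[< above M n >] by exists n0; apply/asboolP.
  have ub n : `[< above M n >] -> (n <= d)%N by move/asboolP/hd.
  case: (ex_maxnP ex ub) => k /asboolP Pk kmax.
  have Pmax : dim_le M k by apply/dim_leP => n Pn; apply: kmax; apply/asboolP.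
  by exists k; split=> //; apply: mdim_eq.
split; last by move=> k h; apply: nP; exists k.
rewrite mdim_above /sup_nat /supremum ifT //; apply/eqP/seteqP; split=> // x [n Pn].
by case: nP; exists n.
Qed.

Lemma dim_le_ndim M d : dim_le M d -> dim_le M (ndim M).
Proof.
move=> /mdim_cases[[E h]|[s [E h k]]]; last by rewrite /ndim E.
by apply/dim_leP => k /h.
Qed.
Lemma ndim_le M d : dim_le M d -> (ndim M <= d)%N.
Proof.
move=> hd; case: (mdim_cases hd) => [[E h]|[s [E h k]]]; rewrite /ndim E //=.
by move/dim_leP: hd; apply.
Qed.
Lemma mdim_le0 M d : dim_le M d -> (mdim M <= 0)%E <-> dim_le M 0.
Proof.
move=> hd; case: (mdim_cases hd) => [[E h]|[s [E h k]]]; rewrite E.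
  by rewrite leNye; split=> // _; apply/dim_leP => k /h.
rewrite lee_fin; split=> [s0|/dim_leP/(_ _ h)]; last by rewrite leqn0 => /eqP->.
by have -> : 0%N = s by lia.
Qed.

Section Primary.
Variables (I : submodClosed A^o).
Local Notation Q := (ofS I).
Hypothesis Qm : mprimary m Q.

Definition hilb s M (e : nat -> int) :=
  exists N, forall n, (N <= n)%N -> (hsf Q M n.+1)%:Z = hp s e n.

Lemma hilb_step M a s e : fg (topS M) -> Q a -> superficial Q M a ->
  hilb s.+1 M e ->
  hilb s (mquo M a) (fun i => if i == s then e s + (-1) ^+ s * (len (mker M a))%:Z else e i).
Proof.
move=> fM Qa sa [N hN]; have [c hc] := hsf_superficial H Qm fM Qa sa.
exists (maxn N.+1 c) => -[|n]; first by rewrite geq_max.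
rewrite geq_max ltnS => /andP[Nn cn].
have E : (hsf Q (mquo M a) n.+2)%:Z = hp s e n.+1 + (len (mker M a))%:Z.
  have := hc n.+1 cn; rewrite -(hpS s e) -!hN ?(leqW Nn) //; lia.
rewrite E !hp_last eqxx mulrDr mulrA -expr2 sqrr_sign mul1r addrA.
congr (_ + _ + _); apply: eq_bigr => -[i /= lis] _.
by rewrite ltn_eqF.
Qed.

Lemma hilb_exists M s : fg (topS M) -> dim_le M s -> exists e, hilb s M e.
Proof.
elim: s M => [|s IH] M fM hM.
  have kM := dim0_killed H fM hM; have [c hc] := hsf_killed Qm fM kM.
  by exists (fun=> (len M)%:Z); exists c => n cn; rewrite hp0 hc // leqW.
have [a Qa sa] := generic_ex H (generic_superficial H Q fM).
have kM := superficial_killed H Qm fM Qa sa.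
have [e [N hN]] := IH (mquo M a) (@mquo_fg A M a fM) (dim_le_mquo H kM hM).
have [c hc] := hsf_superficial H Qm fM Qa sa.
pose e' i := if i == s then e s - (-1) ^+ s * (len (mker M a))%:Z else e i.
have [|e2 _ h2] := @hp_sum s e' (fun n => (hsf Q M n.+1)%:Z); last by exists e2.
exists (maxn N c) => n; rewrite geq_max => /andP[Nn cn].
have : (hsf Q M n.+2)%:Z - (hsf Q M n.+1)%:Z = hp s e n.+1 - (len (mker M a))%:Z.
  rewrite -hN ?(leqW Nn) //; have := hc n.+1 (leqW cn); lia.
move=> ->; rewrite !hp_last /e' eqxx mulrBr mulrA -expr2 sqrr_sign mul1r addrA.
congr (_ + _ - _); apply: eq_bigr => -[i /= lis] _.
by rewrite ltn_eqF.
Qed.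

Lemma hilb_uniq M s e e' : hilb s M e -> hilb s M e' -> forall i, (i <= s)%N -> e i = e' i.
Proof.
move=> [N hN] [K hK]; apply: hp_uniq; exists (maxn N K) => n.
by rewrite geq_max => /andP[Nn Kn]; rewrite -hN // hK.
Qed.

(* Coefficients with respect to an upper bound [s] of the dimension, possibly not attained. *)
Definition hcoef s M : nat -> int := pick_such (fun=> 0) (hilb s M).

Lemma hcoefP s M : fg (topS M) -> dim_le M s -> hilb s M (hcoef s M).
Proof.
move=> fM hM; rewrite /hcoef /pick_such; case: pselect => [h|[]]; last exact: hilb_exists.
by case: cid.
Qed.
Lemma hcoefE s M e i : hilb s M e -> (i <= s)%N -> hcoef s M i = e i.
Proof.
move=> he; apply: (@hilb_uniq M) => //; rewrite /hcoef /pick_such.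
by case: pselect => [h|[]]; [case: cid | exists e].
Qed.

Lemma hcoef_mquo M a s : fg (topS M) -> dim_le M s.+1 -> Q a -> superficial Q M a ->
  (forall i, (i < s)%N -> hcoef s (mquo M a) i = hcoef s.+1 M i) /\
  hcoef s (mquo M a) s = hcoef s.+1 M s + (-1) ^+ s * (len (mker M a))%:Z.
Proof.
move=> fM hM Qa sa; have h := hilb_step fM Qa sa (hcoefP fM hM).
split=> [i lis|]; last by rewrite (hcoefE h) ?eqxx.
by rewrite (hcoefE h) ?ltn_eqF // ltnW.
Qed.

Lemma hcoef_ge0 s M : fg (topS M) -> dim_le M s -> 0 <= hcoef s M 0.
Proof.
move=> fM hM; have [N hN] := hcoefP fM hM; apply: (@hp_ge0 s).
by exists N => n /hN <-.
Qed.

Lemma hilbert_coefE M s i : fg (topS M) -> dim_le M s -> ndim M = s -> (i <= s)%N ->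
  hilbert_coef I M i = hcoef s M i.
Proof.
move=> fM hM ns lis; rewrite /hilbert_coef ns.
have E (e : nat -> int) n :
    \sum_(i < s.+1) (-1) ^+ i * e i * 'C(n + s - i, s - i)%:Z = hp s e n by [].
have hE e : (exists N : nat, forall n, (N <= n)%N ->
    module_length (quotient_mod (ideal_pow M I n.+1)) = (hp s e n)%:E) <-> hilb s M e.
  split=> -[N hN]; exists N => n /hN; rewrite (hsf_length H) //; last by move=> ->.
  by move=> [->].
rewrite /pick_such; case: pselect => [h|[]]; last first.
  by have [e he] := hilb_exists fM hM; exists e; apply/hE.
case: cid => e /hE he /=; exact/esym/hcoefE.
Qed.
End Primary.
End Coefficients.

(** * Injective modules *)

Section ZornSubmodules.
Variables (A : comNzRingType) (M : lmodType A).
Implicit Types S T : submodule M.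

Lemma zorn_submodule (P : submodule M -> Prop) S0 : P S0 ->
  (forall T, (forall x, T x -> exists2 S, P S & S x /\ S ≤ T) ->
     (forall x y, T x -> T y -> exists S, [/\ P S, S x, S y & S ≤ T]) -> P T) ->
  exists2 S, P S & forall T, P T -> S ≤ T -> T = S.
Proof.
move=> P0 Pchain; pose X := {S | P S}.
pose R (s t : X) := `[< sval s ≤ sval t >].
have [||||[S PS] Smax] := @Zorn X R.
- by move=> s; apply/asboolP.
- by move=> r s t /asboolP h /asboolP k; apply/asboolP; apply: sle_trans k.
- move=> [s Ps] [t Pt] /asboolP /= h /asboolP /= k.
  by have E := sle_anti h k; subst t; congr exist; apply: Prop_irrelevance.
- move=> C tC; case: (pselect (exists s, C s)) => [[s0 Cs0]|nC]; last first.
    by exists (exist _ S0 P0) => s Cs; case: nC; exists s.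
  pose U x := exists2 s, C s & sval s x.
  have tot s t : C s -> C t -> sval s ≤ sval t \/ sval t ≤ sval s.
    by move=> Cs Ct; have [/asboolP|/asboolP] := tC s t Cs Ct; [left | right].
  have U0 : U 0 by exists s0 => //; apply: sub0.
  have UL a x y : U x -> U y -> U (a *: x + y).
    move=> [s Cs sx] [t Ct ty]; have [h|h] := tot s t Cs Ct.
      by exists t => //; apply: subL => //; apply: h.
    by exists s => //; apply: subL => //; apply: h.
  pose T := SubM U0 UL.
  have PT : P T.
    apply: Pchain => [x [s Cs sx]|x y [s Cs sx] [t Ct ty]].
      by exists (sval s); [apply: (svalP s) | split=> // z sz; exists s].
    have [h|h] := tot s t Cs Ct.
      by exists (sval t); split=> //; [apply: (svalP t)|apply: h|move=> z tz; exists t].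
    by exists (sval s); split=> //; [apply: (svalP s)|apply: h|move=> z tz; exists s].
  by exists (exist _ T PT) => s Cs; apply/asboolP => x sx; exists s.
exists S => // T PT ST.
by have := Smax (exist _ T PT) (introT (asboolP _) ST) => /(congr1 sval) /= ->.
Qed.
End ZornSubmodules.

Section Baer.
Variable A : comNzRingType.
Implicit Types U V E : lmodType A.

(** Partial extensions of [f] are encoded by their graphs: submodules [G] of [V * E] that contain
    the graph of [f] and meet [E] in 0. A maximal one is defined everywhere: for [v] in [V], the
    hypothesis applied to the ideal of all [a] with [a *: v] in the domain gives [e], and
    [G + A (v, e)] is again a graph. *)
Lemma baer E : (forall (I : ideal A) (f : {linear smd I -> E}),
    exists e : E, forall u, f u = (inc I u : A) *: e) -> injective_module E.
Proof.
move=> hE U V i f ii.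
pose W : lmodType A := (V * E)%type.
pose P (G : submodule W) := (forall y : E, G (0, y) -> y = 0) /\ forall u, G (i u, f u).
have gr0 : exists u : U, (0 : W) = (i u, f u) by exists 0; rewrite !linear0.
have grL (a : A) (x y : W) : (exists u, x = (i u, f u)) -> (exists u, y = (i u, f u)) ->
    exists u, a *: x + y = (i u, f u).
  by move=> [u ->] [v ->]; exists (a *: u + v); rewrite !linearP.
have P0 : P (SubM gr0 grL).
  split=> [y [u [/esym/(linear_inj0 ii)-> ->]]|u]; first by rewrite linear0.
  by exists u.
have [|G [G0 Gf] Gmax] := zorn_submodule P0.
  move=> T h k; split=> [y /h[S [S0 _] [Sy _]]|u]; first exact: S0.
  have [S [_ Sf] [_ ST]] := h 0 (sub0 T).
  exact/ST/Sf.
have Gu v y y' : G (v, y) -> G (v, y') -> y = y'.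
  move=> h h'; apply: subr0_eq; apply: G0.
  by have := subB h h'; congr (G _); rewrite -[LHS]/(v - v, y - y') subrr.
have dom v : exists y, G (v, y).
  have I0 : exists y : E, G ((0 : A) *: v, y) by exists 0; rewrite scale0r; apply: sub0.
  have IL (a b c : A) : (exists y : E, G (b *: v, y)) -> (exists y : E, G (c *: v, y)) ->
      exists y : E, G ((a * b + c) *: v, y).
    move=> [y Gy] [z Gz]; exists (a *: y + z); rewrite scalerDl -scalerA.
    exact: (subL a Gy Gz).
  pose I : ideal A := @SubM A A^o (fun b => exists y : E, G (b *: v, y)) I0 IL.
  have /choice[g gP] : forall u : smd I, exists y : E, G ((inc I u : A) *: v, y).
    by move=> u; apply: (incP u).
  have gL : linear g.
    move=> a x y; apply: (Gu ((inc I (a *: x + y) : A) *: v)) (gP _) _.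
    rewrite linearP scalerDl -[(a *: inc I x)]/(a * (inc I x : A)) -scalerA.
    exact: (subL a (gP x) (gP y)).
  have [e eP] := hE I (mkLinear gL).
  have H0 : exists a (w : W), G w /\ (0 : W) = w + a *: (v, e).
    by exists 0, 0; rewrite scale0r addr0; split=> //; apply: sub0.
  have HL (a : A) (x y : W) : (exists b (w : W), G w /\ x = w + b *: (v, e)) ->
      (exists b (w : W), G w /\ y = w + b *: (v, e)) ->
      exists b (w : W), G w /\ a *: x + y = w + b *: (v, e).
    move=> [b [w [Gw ->]]] [c [z [Gz ->]]]; exists (a * b + c), (a *: w + z).
    split; first exact: subL.
    by rewrite scalerDr scalerA addrACA -scalerDl.
  pose G' : submodule W := SubM H0 HL.
  have GG' : G ≤ G' by move=> w Gw; exists 0, w; rewrite scale0r addr0.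
  exists e; rewrite -(Gmax G') //.
    by exists 1, 0; rewrite scale1r add0r; split=> //; apply: sub0.
  split=> [y [a [[w1 w2] [Gw [E1 E2]]]]|u]; last exact/GG'/Gf.
  have Ga : G (a *: v, - w2).
    have -> : a *: v = - w1 by apply/eqP; rewrite -addr_eq0 addrC; apply/eqP/esym.
    exact: (subN Gw).
  have [u uE] : exists u : smd I, (a : A^o) = inc I u by apply: inc_onto; exists (- w2).
  have : g u = a *: e by rewrite -[g u]/(mkLinear gL u) eP -uE.
  have -> : g u = - w2 by apply: Gu (gP u) _; rewrite -uE.
  by rewrite E2 => <-; rewrite subrr.
have /choice[g gP] := dom.
have gL : linear g.
  by move=> a x y; apply: Gu (gP _) _; exact: (subL a (gP x) (gP y)).
by exists (mkLinear gL) => x; apply: Gu (gP _) _; apply: Gf.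
Qed.

Lemma retract_injective E E' (r : {linear E -> E'}) (s : {linear E' -> E}) :
  (forall x, r (s x) = x) -> injective_module E -> injective_module E'.
Proof.
move=> rs hE U V i f ii; have [g gE] := hE U V i (compL s f) ii.
by exists (compL r g) => x; rewrite /= gE /= rs.
Qed.
End Baer.

Section Extend.
Variable A : comNzRingType.
Implicit Types U V E : lmodType A.

Lemma injective_extend E U V (p : {linear U -> V}) (q : {linear U -> E}) :
  injective_module E -> (forall u, p u = 0 -> q u = 0) ->
  exists g : {linear V -> E}, forall u, g (p u) = q u.
Proof.
move=> hE pq.
have [p' p'E] := @factor_inj A U V _ (inc (imS p)) p (@inc_injective _ _ _)
  (fun x => @inc_onto _ _ (imS p) _ (ex_intro2 _ _ x Logic.I erefl)).
have p's : onto p'.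
  by move=> y; have [x _ xE] := incP y; exists x; apply: inc_injective; rewrite p'E.
have [|q' q'E] := @factor_onto A U E _ p' q p's.
  by move=> x px; apply: pq; rewrite -p'E px linear0.
have [g gE] := hE _ _ (inc (imS p)) q' (@inc_injective _ _ _).
by exists g => u; rewrite -p'E gE q'E.
Qed.
End Extend.

(** * The injective group Q/Z and its characters *)

Section RationalsModIntegers.

Lemma int_ideal (I : ideal int) : exists n : nat, forall a : int, I a <-> (n %| a)%Z.
Proof.
have absI (a : int) : I a -> I (`|a|%N : int).
  move=> Ia; have : I (- a) by apply: (subN (S := I)).
  by case: (leP 0 a) => a0 Ina; [have -> : (`|a|%N : int) = a by lia | have -> : (`|a|%N : int) = - a by lia].
case: (pselect (exists n : nat, I (n.+1 : int))) => [ex|nex]; last first.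
  exists 0%N => a; rewrite dvd0z; split=> [Ia|/eqP->]; last exact: sub0.
  apply/eqP; apply: contrapT => a0; apply: nex; exists (`|a|.-1)%N.
  have -> : (`|a|.-1.+1)%N = `|a|%N by lia.
  exact: absI.
have ex' : exists n : nat, `[< I (n.+1 : int) >] by have [n In] := ex; exists n; apply/asboolP.
case: (ex_minnP ex') => n /asboolP In nmin; exists n.+1 => a.
have Im (b : int) : I (b * n.+1%:Z) by apply: (subZ (S := I) b In).
split=> [Ia|/dvdzP[b ->]]; last exact: Im.
have Ir : I (a %% n.+1)%Z.
  have -> : (a %% n.+1)%Z = a - (a %/ n.+1)%Z * n.+1%:Z by rewrite {2}(divz_eq a n.+1) addrC addKr.
  exact: (subB (S := I)).
apply/dvdz_mod0P; apply: contrapT => r0.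
have r1 : 0 <= (a %% n.+1)%Z by apply: modz_ge0.
have r2 : (a %% n.+1)%Z < n.+1%:Z by apply: ltz_pmod.
have := nmin (`|(a %% n.+1)%Z|.-1)%N.
have -> : `[< I ((`|(a %% n.+1)%Z|.-1).+1%N : int) >].
  apply/asboolP; have -> : ((`|(a %% n.+1)%Z|.-1).+1%N : int) = (a %% n.+1)%Z by lia.
  exact: Ir.
by move=> /(_ isT); lia.
Qed.

Lemma integral0 : exists k : int, (0 : rat) = k%:~R. Proof. by exists 0. Qed.
Lemma integralL (a : int) (x y : zmodule rat) :
  (exists k : int, (x : rat) = k%:~R) -> (exists k : int, (y : rat) = k%:~R) ->
  exists k : int, (a *: x + y : rat) = k%:~R.
Proof.
by move=> [k ->] [l ->]; exists (k * a + l); rewrite scalezrE intrD intrM mulrzr.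
Qed.
Definition integral : submodule (zmodule rat) :=
  @SubM int (zmodule rat) (fun q => exists k : int, (q : rat) = k%:~R) integral0 integralL.
Definition QZ : lmodType int := qmod integral.

Lemma rat_divz_mul (q : rat) (b : int) (n : nat) : n != 0%N ->
  q *~ b = (q / n%:R) *~ (b * n%:Z).
Proof.
move=> n0; rewrite -[LHS]mulrzr -[RHS]mulrzr intrM.
have n1 : (n%:R : rat) != 0 by rewrite pnatr_eq0.
have -> : (n%:Z)%:~R = n%:R :> rat by [].
by field.
Qed.

Lemma rat_inv_mul (k j : nat) (b : int) : k != 0%N ->
  (k%:R^-1 : rat) *~ (b * (j * k)%N%:Z) = (b * j%:Z)%:~R.
Proof.
move=> k0; rewrite -[LHS]mulrzr PoszM !intrM.
have k1 : (k%:R : rat) != 0 by rewrite pnatr_eq0.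
have -> : (k%:Z)%:~R = k%:R :> rat by [].
by field.
Qed.

Lemma QZ_injective : injective_module QZ.
Proof.
apply: baer => I f; have [n nP] := int_ideal I.
have [u0 u0E] : exists u0 : smd I, (n%:Z : int^o) = inc I u0 by apply: inc_onto; apply/nP.
have [q qE] := prj_onto integral (f u0).
case: (posnP n) => [n0|n0].
  exists 0 => u; rewrite scaler0; have -> : u = 0; last by rewrite linear0.
  apply: inc_injective; rewrite linear0; apply/eqP.
  by have /nP := incP u; rewrite n0 dvd0z.
exists (prj integral ((q : rat) / n%:R)) => u.
have /nP/dvdzP[b bE] := incP u.
have uE : u = b *: u0.
  by apply: inc_injective; rewrite linearZ -u0E; exact: bE.
have L (a : int) (x : zmodule rat) : prj integral (a *: x) = a *: prj integral x.
  exact: linearZ.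
rewrite [in LHS]uE linearZZ qE bE -!L.
have n1 : n != 0%N by rewrite -lt0n.
exact: (congr1 (prj integral) (@rat_divz_mul q b n n1)).
Qed.

Lemma QZ_separates (M : zmodType) (x : M) : x != 0 ->
  exists c : {linear zmodule M -> QZ}, c x != 0.
Proof.
move=> x0; pose X : zmodule M := x.
have [n nP] := int_ideal (kerS (actL X)).
have n1 : n != 1%N.
  apply: contra x0 => /eqP n1; have : kerS (actL X) 1 by apply/nP; rewrite n1 dvd1z.
  by rewrite /= scale1r => E; apply/eqP; exact: E.
(* The character sends [x] to [1/k], with [k] the order of [x]; for infinite order ([n = 0]) any
   [k >= 2] will do. *)
pose k := if n == 0%N then 2%N else n.
have k2 : (1 < k)%N by rewrite /k; case: n n1 {nP k} => [|[|n]].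
have kn0 : (k%:R : rat) != 0 by rewrite pnatr_eq0; lia.
have nk : (k %| n)%N by rewrite /k; case: eqP => [->|].
pose e : QZ := prj integral (k%:R^-1 : rat).
have e0 : e != 0.
  apply/eqP => /prj0[j jE].
  have : (j * k)%:~R = 1 :> rat by rewrite intrM -jE mulVf.
  move/eqP; rewrite -[1 in X in X -> _]/(1%:~R) eqr_int => /eqP E.
  have : (k %| 1)%Z by apply/dvdzP; exists j.
  by rewrite dvdz1 /=; lia.
have [|c cE] := @injective_extend int QZ _ _ (actL X) (actL e) QZ_injective.
  move=> a /nP/dvdzP[b ->]; have [j nE] := dvdnP nk.
  have -> : actL e (b * n%:Z) = prj integral ((b * n%:Z) *: (k%:R^-1 : zmodule rat)).
    exact/esym/linearZZ.
  apply/prj0; exists (b * j).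
  by rewrite nE; apply: (@rat_inv_mul k j b); rewrite -lt0n ltnW.
exists c; have := cE 1; rewrite /= !scale1r => ->.
exact: e0.
Qed.
End RationalsModIntegers.

Section Coinduced.
Variables (A : comNzRingType) (X : Type).

Definition biadd (phi : X -> A -> QZ) := forall x a b, phi x (a + b) = phi x a + phi x b.
Lemma biadd0 : biadd 0. Proof. by move=> x a b; rewrite addr0. Qed.
Lemma biaddL (k : int) (phi psi : X -> A -> QZ) : biadd phi -> biadd psi -> biadd (k *: phi + psi).
Proof.
move=> h1 h2 x a b.
have E c : (k *: phi + psi) x c = k *: phi x c + psi x c by [].
by rewrite !E h1 h2 scalerDr addrACA.
Qed.
Definition biaddS : submodule (X -> A -> QZ : lmodType int) := SubM biadd0 biaddL.

(* Functions from [X] to the injective module of additive maps [A -> Q/Z],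
   with [a] acting by [(a phi) x b = phi x (b a)]. *)
Definition coinduced : Type := smd biaddS.
HB.instance Definition _ := GRing.Zmodule.on coinduced.

Definition coap (u : coinduced) : X -> A -> QZ := inc biaddS u.
Lemma coapD u v x b : coap (u + v) x b = coap u x b + coap v x b. Proof. by []. Qed.
Lemma coap_biadd u : biadd (coap u). Proof. exact: (incP u). Qed.
Lemma coap_inj u v : (forall x b, coap u x b = coap v x b) -> u = v.
Proof. by move=> h; apply: (@inc_injective _ _ biaddS); apply/funext => x; apply/funext => b; apply: h. Qed.
Lemma coap_exists phi : biadd phi -> exists u, coap u = phi.
Proof. by move=> h; have [u uE] := @inc_onto _ _ biaddS phi h; exists u; rewrite /coap -uE. Qed.

Lemma coscale_subproof (a : A) u : biadd (fun x b => coap u x (b * a)).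
Proof. by move=> x b c; rewrite mulrDl coap_biadd. Qed.
Definition coscale (a : A) (u : coinduced) : coinduced :=
  sval (cid (coap_exists (coscale_subproof a u))).
Lemma coscaleE a u x b : coap (coscale a u) x b = coap u x (b * a).
Proof. by rewrite /coscale; case: cid => v /= ->. Qed.

Lemma coscaleA a b u : coscale a (coscale b u) = coscale (a * b) u.
Proof. by apply: coap_inj => x c; rewrite !coscaleE mulrA. Qed.
Lemma coscale1 : left_id 1 coscale.
Proof. by move=> u; apply: coap_inj => x c; rewrite coscaleE mulr1. Qed.
Lemma coscaleDr : right_distributive coscale +%R.
Proof. by move=> a u v; apply: coap_inj => x c; rewrite coapD !coscaleE coapD. Qed.
Lemma coscaleDl u : {morph coscale^~ u : a b / a + b}.
Proof. by move=> a b; apply: coap_inj => x c; rewrite coapD !coscaleE mulrDr coap_biadd. Qed.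
HB.instance Definition _ := GRing.Zmodule_isLmodule.Build A coinduced
  coscaleA coscale1 coscaleDr coscaleDl.

Lemma coapZ (a : A) (u : coinduced) x b : coap (a *: u) x b = coap u x (b * a).
Proof. exact: coscaleE. Qed.

(** Evaluation at 1 reduces the extension problem to additive maps into Q/Z: for each [x] the map
    [u -> f u x 1] extends to some [h x] on [V], and [v] is sent to the function
    [x, a -> h x (a v)]. *)
Lemma coinduced_injective : injective_module (coinduced : lmodType A).
Proof.
move=> U V i f ii.
have ext x : exists h : {linear zmodule V -> QZ}, forall u : U, h (i u : zmodule V) = coap (f u) x 1.
  have iL : linear (i : zmodule U -> zmodule V).
    by move=> k u v; rewrite linearD !scalezrE raddfMz.
  have fL : linear (fun u : zmodule U => coap (f u) x 1).
    move=> k u v; have fk : f (k *: u + v) = f u *~ k + f v by rewrite linearD scalezrE raddfMz.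
    rewrite fk coapD; congr (_ + _).
    have cL : zmod_morphism (fun w : coinduced => coap w x 1).
      by move=> w z; rewrite coapD; congr (_ + _).
    pose C : {additive coinduced -> QZ} := HB.pack (fun w : coinduced => coap w x 1)
      (GRing.isZmodMorphism.Build _ _ (fun w : coinduced => coap w x 1) cL).
    by rewrite -[LHS]/(C (f u *~ k)) raddfMz -scaler_int intz.
  have [h hE] := @QZ_injective _ _ (mkLinear iL) (mkLinear fL) ii.
  by exists h => u; apply: hE.
have /choice[h hP] := ext.
have gB v : biadd (fun x a => h x (a *: v : zmodule V)).
  by move=> x a b; rewrite scalerDl linearD.
have /choice[g gP] : forall v, exists u, coap u = fun x a => h x (a *: v : zmodule V).
  by move=> v; apply: coap_exists.
have gL : linear g.
  move=> a u v; apply: coap_inj => x b.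
  by rewrite coapD coapZ !gP scalerDr linearD scalerA.
exists (mkLinear gL) => u; apply: coap_inj => x a.
by rewrite /= gP -linearZZ hP linearZZ coapZ mul1r.
Qed.
End Coinduced.

Section EnoughInjectives.
Variable A : comNzRingType.
Implicit Types M K E : lmodType A.

(** The index type [X] consists of all characters of [M], and [y] goes to [c, a -> c (a y)]. The map
    is injective because characters separate points. *)
Lemma enough_injectives M : exists (E : lmodType A) (i : {linear M -> E}),
  injective_module E /\ injective i.
Proof.
pose X := {linear zmodule M -> QZ}.
have B (y : M) : biadd (fun (c : X) (a : A) => c (a *: y : zmodule M)).
  by move=> c a b; rewrite scalerDl linearD.
have /choice[j jP] : forall y, exists u : coinduced A X, coap u = fun c a => c (a *: y : zmodule M).
  by move=> y; apply: coap_exists.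
have jL : linear j.
  by move=> a x y; apply: coap_inj => c b; rewrite coapD coapZ !jP scalerDr linearD scalerA.
exists (coinduced A X), (mkLinear jL); split; first exact: coinduced_injective.
apply: linear_injP => x jx; apply/eqP; apply: contrapT => /negP x0.
have [c /eqP] := QZ_separates x0; apply.
have : coap (j x) c 1 = coap (0 : coinduced A X) c 1 by congr (coap _ c 1).
by rewrite jP scale1r => ->.
Qed.

(** Inside an injective [I] containing [K], let [S] be a maximal essential extension of [K], and [T]
    maximal with [T] meeting [S] in 0. The inclusion of [S] in [I] extends to [h : I / T -> I],
    injective by maximality of [T]. The image of [h] is still essential over [K], so it equals [S];
    hence [S] is a retract of [I]. *)
Lemma injective_envelope_exists K : exists E, is_injective_envelope K E.
Proof.
have [I [i [hI ii]]] := enough_injectives K.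
pose K0 := imS i.
pose P (S : submodule I) := K0 ≤ S /\ forall y, S y -> y <> 0 -> exists2 a : A, a *: y <> 0 & K0 (a *: y).
have [||S [KS Sess] Smax] := @zorn_submodule _ _ P K0.
- by split=> // y Ky y0; exists 1; rewrite scale1r.
- move=> T h _; split; last by move=> y /h[S [_ Se] [Sy _]]; apply: Se.
  by have [S [KS _] [_ ST]] := h 0 (sub0 T); apply: sle_trans ST.
pose P' (T : submodule I) := forall y, T y -> S y -> y = 0.
have [||T T0 Tmax] := @zorn_submodule _ _ P' (botS I).
- by move=> y.
- by move=> T h _ y /h[T' T0 [Ty _]]; apply: T0.
have [h hE] : exists h : {linear qmod T -> I}, forall s : smd S, h (prj T (inc S s)) = inc S s.
  apply: (@injective_extend _ _ _ _ (compL (prj T) (inc S)) (inc S) hI) => s.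
  by move=> /prj0 Ts; apply: T0 => //; apply: incP.
have hinj : injective h.
  apply: linear_injP => y; have [x ->] := prj_onto T y => hx.
  pose T' := preS (compL h (prj T)) (botS I).
  have T'T : T' = T.
    apply: Tmax => [y' /= hy' Sy'|z Tz]; last first.
      by rewrite /= -[_ (_ z)]/(h (prj T z)) (prj0 T z).2 // linear0.
    have [s sE] := inc_onto Sy'.
    by rewrite sE -hE -sE.
  by apply/prj0; rewrite -T'T.
pose S' := imS h.
have SS' : S ≤ S'.
  by move=> x /inc_onto[s ->]; exists (prj T (inc S s)); rewrite // hE.
have PS' : P S'.
  split; first exact: sle_trans SS'.
  move=> y [z _ yE] y0; have [x zE] := prj_onto T z; subst y z.
  have nT : ~ T x by move=> Tx; apply: y0; rewrite (prj0 T x).2 // linear0.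
  have [w [[t [_ [Tt /seq1P[a ->] wE]]] Sw w0]] :
      exists w, [/\ addS T (seqS [:: x]) w, S w & w <> 0].
    apply: contrapT => nex; apply: nT.
    rewrite -(Tmax (addS T (seqS [:: x]))); last exact: le_addl.
      by apply: le_addr; apply: spanP; rewrite inE.
    move=> y Ty Sy; apply: contrapT => y1; apply: nex; by exists y.
  have hw : a *: h (prj T x) = w.
    have [s sE] := inc_onto Sw; rewrite sE -hE -sE wE linearD (prj0 T t).2 // add0r.
    by rewrite !linearZZ.
  have [b b0 Kb] := Sess w Sw w0.
  by exists (b * a); rewrite -scalerA hw.
have hS x : S (h (prj T x)) by rewrite -(Smax S' PS' SS'); exists (prj T x).
have [r rE] := @factor_inj _ _ _ _ (inc S) (compL h (prj T)) (@inc_injective _ _ _)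
  (fun x => inc_onto (hS x)).
have injS : injective_module (smd S).
  apply: (retract_injective (r := r) (s := inc S)) hI => s.
  by apply: inc_injective; exact: etrans (rE _) (hE s).
have [j jE] := @factor_inj _ _ _ _ (inc S) i (@inc_injective _ _ _)
  (fun x => inc_onto (KS _ (ex_intro2 _ _ x Logic.I erefl))).
exists (smd S); split=> //; exists j; split.
  by move=> x y xy; apply: ii; rewrite -!jE xy.
move=> V [y Vy /eqP y0].
have [|a ay0 [x _ xE]] := Sess (inc S y) (incP y).
  by move=> h0; apply: y0; apply: (linear_inj0 (@inc_injective _ _ S)).
have jx : j x = a *: y by apply: inc_injective; rewrite jE -xE linearZZ.
exists x; first by rewrite jx rpredZ.
by apply/eqP => jx0; apply: ay0; rewrite xE -jE jx0 linear0.
Qed.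

Lemma injective_envelopeP K : is_injective_envelope K (injective_envelope K).
Proof.
rewrite /injective_envelope /pick_such; case: pselect => [h|[]]; first by case: cid.
exact: injective_envelope_exists.
Qed.
End EnoughInjectives.

(** * Local cohomology *)

Section ChainMaps.
Variable A : comNzRingType.
Implicit Types M N : lmodType A.

Lemma subL_linear M N (f g : {linear M -> N}) : linear (fun x => f x - g x).
Proof. by move=> a x y /=; rewrite linearP [g _]linearP opprD addrACA -scalerBr. Qed.
Definition subLin M N (f g : {linear M -> N}) : {linear M -> N} := mkLinear (subL_linear f g).

Lemma chain_lift (K J : nat -> lmodType A) (d : forall j, {linear K j -> K j.+1})
    (d' : forall j, {linear J j -> J j.+1}) (b : {linear K 0%N -> J 0%N}) :
  (forall j x, d j.+1 x = 0 -> exists y, x = d j y) ->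
  (forall j x, d' j.+1 (d' j x) = 0) ->
  (forall j, injective_module (J j)) ->
  (forall x, d 0%N x = 0 -> d' 0%N (b x) = 0) ->
  exists phi : forall j, {linear K j -> J j},
    phi 0%N = b /\ forall j x, phi j.+1 (d j x) = d' j (phi j x).
Proof.
move=> Kex d'd' Jinj bP.
have [|phi [phi0 phiP]] := @dependent_choice (fun j => {linear K j -> J j})
  (fun j f => forall x, d j x = 0 -> d' j (f x) = 0)
  (fun j f g => forall x, g (d j x) = d' j (f x)) b bP.
  move=> j f fP; have [g gE] := injective_extend (q := compL (d' j) f) (Jinj j.+1) fP.
  exists g; split=> // x /Kex[y ->]; by rewrite gE /= d'd'.
by exists phi; split=> // j x; case: (phiP j).
Qed.

Lemma null_homotopy (K J : nat -> lmodType A) (d : forall j, {linear K j -> K j.+1})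
    (d' : forall j, {linear J j -> J j.+1}) (phi : forall j, {linear K j -> J j}) :
  (forall j x, d j.+1 x = 0 -> exists y, x = d j y) ->
  (forall j x, d' j.+1 (d' j x) = 0) ->
  (forall j, injective_module (J j)) ->
  (forall j x, phi j.+1 (d j x) = d' j (phi j x)) ->
  (forall x, d 0%N x = 0 -> phi 0%N x = 0) ->
  exists s : forall j, {linear K j.+1 -> J j},
    forall j x, phi j.+1 x = s j.+1 (d j.+1 x) + d' j (s j x).
Proof.
move=> Kex d'd' Jinj phiP phi0.
have [s0 s0E] := injective_extend (q := phi 0%N) (Jinj 0%N) phi0.
have [||s [_ sP]] := @dependent_choice (fun j => {linear K j.+1 -> J j})
  (fun j s => forall x, phi j.+1 (d j x) = d' j (s (d j x)))
  (fun j s t => forall x, phi j.+1 x = t (d j.+1 x) + d' j (s x)) s0.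
- by move=> x; rewrite s0E phiP.
- move=> j s sP.
  have [x /Kex[y ->]|t tE] := injective_extend (p := d j.+1)
    (q := subLin (phi j.+1) (compL (d' j) s)) (Jinj j.+1).
    by rewrite /= sP subrr.
  exists t; split=> x; rewrite tE /=; last by rewrite subrK.
  by rewrite linearB d'd' subr0 phiP.
by exists s => j x; case: (sP j) => _ ->.
Qed.
End ChainMaps.

(** * Injective resolutions and their comparison *)

Section Resolutions.
Variable A : comNzRingType.
Implicit Types M N X Y Z : lmodType A.

Section Props.
Variables (M : lmodType A) (I : injective_resolution M).
Lemma ires_inj j : injective_module (I j). Proof. by case: I. Qed.
Lemma aug_inj : injective (ires_aug I). Proof. by case: I. Qed.
Lemma aug_ker x : ires_d I 0 x = 0 <-> exists y, x = ires_aug I y.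
Proof. by move: x; case: I. Qed.
Lemma ires_ker j x : ires_d I j.+1 x = 0 <-> exists y, x = ires_d I j y.
Proof. by move: j x; case: I. Qed.
Lemma ires_dd j x : ires_d I j.+1 (ires_d I j x) = 0.
Proof. by apply/ires_ker; exists x. Qed.
Lemma ires_daug x : ires_d I 0 (ires_aug I x) = 0.
Proof. by apply/aug_ker; exists x. Qed.
End Props.
Arguments ires_inj {M} I j.
Arguments aug_inj {M} I.

(** Applied to all modules and, in [torsion_acyclic], to torsion modules. The embeddings are chosen
    for every module in advance, with a junk value outside [P], so that the cokernels [C j] can be
    defined by plain recursion. *)
Lemma resolution_in (P : lmodType A -> Prop) :
  (forall N, P N -> exists (E : lmodType A) (i : {linear N -> E}),
     [/\ P E, injective_module E & injective i]) ->
  (forall N (S : submodule N), P N -> P (qmod S)) ->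
  forall M, P M -> exists I : injective_resolution M, forall j, P (I j).
Proof.
move=> Pemb Pquo M PM.
have /choice_dep[E hE] : forall N, exists E : {E : lmodType A & {linear N -> E}},
    P N -> [/\ P (projT1 E), injective_module (projT1 E) & injective (projT2 E)].
  move=> N; case: (pselect (P N)) => PN; last by exists (existT _ N (scal N 1)).
  by have [E [i h]] := Pemb N PN; exists (existT _ E i).
pose C := fix C j : lmodType A := if j is k.+1 then qmod (imS (projT2 (E (C k)))) else M.
have PC j : P (C j) by elim: j => //= j IH; apply: Pquo; case: (hE _ IH).
pose i j : {linear C j -> projT1 (E (C j))} := projT2 (E (C j)).
have iP j : [/\ P (projT1 (E (C j))), injective_module (projT1 (E (C j))) & injective (i j)].
  exact: hE.
pose d j : {linear projT1 (E (C j)) -> projT1 (E (C j.+1))} :=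
  compL (i j.+1) (prj (imS (i j))).
have dk j x : d j x = 0 <-> exists y, x = i j y.
  have [_ _ ii] := iP j.+1.
  split=> [/(linear_inj0 ii)/prj0[y _ ->]|[y ->]]; first by exists y.
  rewrite -[d j _]/(i j.+1 (prj _ _)) (prj0 _ _).2 ?linear0 //; by exists y.
have dI j x : d j.+1 x = 0 <-> exists y, x = d j y.
  rewrite dk; split=> [[y ->]|[y ->]]; last by exists (prj _ y).
  by have [z ->] := prj_onto _ y; exists z.
have h1 j : injective_module (projT1 (E (C j))) by case: (iP j).
have h2 : injective (i 0%N) by case: (iP 0%N).
exists (@InjectiveResolution A M _ (i 0%N) d h1 h2 (dk 0%N) dI) => j /=.
by case: (iP j).
Qed.

Lemma resolution_exists M : exists I : injective_resolution M, True.
Proof.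
have [||//|I _] := @resolution_in (fun=> True) _ _ M; last by exists I.
- by move=> N _; have [E [i [hE ii]]] := enough_injectives N; exists E, i.
- by [].
Qed.
Definition res M : injective_resolution M := projT1 (cid (resolution_exists M)).

Definition lifts M N (I : injective_resolution M) (J : injective_resolution N)
    (f : {linear M -> N}) (phi : forall j, {linear I j -> J j}) :=
  (forall x, phi 0%N (ires_aug I x) = ires_aug J (f x)) /\
  forall j x, phi j.+1 (ires_d I j x) = ires_d J j (phi j x).

Arguments lifts {M N} I J f phi.

Lemma lift_exists M N (I : injective_resolution M) (J : injective_resolution N)
  (f : {linear M -> N}) : exists phi, lifts I J f phi.
Proof.
have [|b bE] := injective_extend (p := ires_aug I) (q := compL (ires_aug J) f) (ires_inj J 0).
  by move=> x /(linear_inj0 (aug_inj I)) ->; rewrite linear0.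
have [||||phi [phi0 phiP]] := @chain_lift A I J (ires_d I) (ires_d J) b.
- by move=> j x /ires_ker.
- exact: ires_dd.
- exact: ires_inj.
- by move=> x /aug_ker[y ->]; rewrite bE; apply: ires_daug.
by exists phi; split=> // x; rewrite phi0 bE.
Qed.

(* The horseshoe resolution, with differential [(u, v) |-> (du + theta v, dv)]. *)
Section Horseshoe.
Variables (X Y Z : lmodType A) (f : {linear X -> Y}) (g : {linear Y -> Z}).
Hypotheses (fi : injective f) (go : onto g) (fg : forall y, g y = 0 <-> exists x, y = f x).
Variables (I : injective_resolution X) (K : injective_resolution Z).

Lemma prod_injective E E' : injective_module E -> injective_module E' ->
  injective_module (E * E' : lmodType A)%type.
Proof.
move=> hE hE' U V i h ii.
have fL : linear (fun u => (h u).1) by move=> a u v; rewrite linearP.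
have sL : linear (fun u => (h u).2) by move=> a u v; rewrite linearP.
have [a aE] := hE U V i (mkLinear fL) ii; have [b bE] := hE' U V i (mkLinear sL) ii.
have pL : linear (fun v => (a v, b v) : (E * E')%type) by move=> c u v; rewrite !linearP.
by exists (mkLinear pL) => u; rewrite /= aE bE /=; case: (h u).
Qed.

(** [alpha] extends the augmentation of [X] to [Y]. The map [- d alpha] vanishes on [X], so it
    factors through [Z], and its lift [theta] is a chain map into the shifted complex with
    differential [- d]; this sign makes the horseshoe differential square to zero. *)
Lemma horseshoe_data : exists (alpha : {linear Y -> I 0%N})
    (theta : forall j, {linear K j -> I j.+1}),
  [/\ forall x, alpha (f x) = ires_aug I x,
      forall y, theta 0%N (ires_aug K (g y)) = - ires_d I 0 (alpha y)
    & forall j v, theta j.+1 (ires_d K j v) = - ires_d I j.+1 (theta j v)].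
Proof.
have [alpha aE] := ires_inj I 0 _ _ f (ires_aug I) fi; exists alpha.
have [|b bE] := injective_extend (p := compL (ires_aug K) g)
  (q := compL (scal _ (-1)) (compL (ires_d I 0) alpha)) (ires_inj I 1).
  move=> y /(linear_inj0 (aug_inj K))/fg[x ->].
  by rewrite /= aE ires_daug scaler0.
have [||||theta [theta0 thetaP]] := @chain_lift A K (fun j => I j.+1) (ires_d K)
  (fun j => compL (scal _ (-1)) (ires_d I j.+1)) b.
- by move=> j x /ires_ker.
- by move=> j x; rewrite /= linearZZ ires_dd !scaler0.
- by move=> j; apply: ires_inj.
- move=> v /aug_ker[z ->]; have [y ->] := go z.
  have /= -> := bE y; rewrite linearZZ ires_dd scaler0 scaler0 //.
exists theta; split=> // [y|j v]; last by rewrite thetaP /= scaleN1r.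
by rewrite theta0; have /= -> := bE y; rewrite scaleN1r.
Qed.

Variables (alpha : {linear Y -> I 0%N}) (theta : forall j, {linear K j -> I j.+1}).
Hypotheses (aE : forall x, alpha (f x) = ires_aug I x)
  (t0 : forall y, theta 0%N (ires_aug K (g y)) = - ires_d I 0 (alpha y))
  (tS : forall j v, theta j.+1 (ires_d K j v) = - ires_d I j.+1 (theta j v)).

Definition hs_mod j : lmodType A := (I j * K j)%type.
Lemma hs_aug_linear : linear (fun y => (alpha y, ires_aug K (g y)) : hs_mod 0).
Proof. by move=> a x y; rewrite !linearP. Qed.
Lemma hs_d_linear j :
  linear (fun w : hs_mod j => (ires_d I j w.1 + theta j w.2, ires_d K j w.2) : hs_mod j.+1).
Proof.
move=> a [u v] [u' v']; rewrite /= !linearP.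
by congr pair; rewrite /= scalerDr addrACA.
Qed.
Definition hs_d j : {linear hs_mod j -> hs_mod j.+1} := mkLinear (@hs_d_linear j).

Lemma hs_d0 j (w : hs_mod j) : hs_d j w = 0 <-> ires_d I j w.1 + theta j w.2 = 0 /\ ires_d K j w.2 = 0.
Proof. by split=> [[]|[h k]] //; rewrite /= h k. Qed.

Lemma hs_inj : injective (mkLinear hs_aug_linear).
Proof.
apply: linear_injP => y /= [ay /(linear_inj0 (aug_inj K))/fg[x yE]].
by move: ay; rewrite yE aE => /(linear_inj0 (aug_inj I)) ->; rewrite linear0.
Qed.
Lemma hs_ker0 (w : hs_mod 0) : hs_d 0 w = 0 <-> exists y, w = mkLinear hs_aug_linear y.
Proof.
rewrite hs_d0; split=> [[h1 /aug_ker[z vE]]|[y ->]] /=; last first.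
  by rewrite t0 subrr ires_daug.
have [y zE] := go z; rewrite vE zE t0 -linearB in h1.
have /aug_ker[x xE] := h1; exists (y + f x) => /=.
case: w vE xE {h1} => u v /= -> uE; rewrite linearD aE -uE addrC subrK.
by rewrite linearD (fg (f x)).2 ?addr0 ?zE //; exists x.
Qed.
Lemma hs_ker j (w : hs_mod j.+1) : hs_d j.+1 w = 0 <-> exists w', w = hs_d j w'.
Proof.
rewrite hs_d0; split=> [[h1 /ires_ker[z vE]]|[[u v] ->]] /=; last first.
  by rewrite linearD ires_dd add0r tS subrr ires_dd.
rewrite vE tS -linearB in h1; have /ires_ker[x xE] := h1; exists (x, z) => /=.
by case: w vE xE {h1} => u v /= -> <-; rewrite subrK.
Qed.
Definition horseshoe : injective_resolution Y :=
  @InjectiveResolution A Y hs_mod (mkLinear hs_aug_linear) hs_d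
    (fun j => prod_injective (ires_inj I j) (ires_inj K j)) hs_inj hs_ker0 hs_ker.
End Horseshoe.
End Resolutions.
Arguments lifts {A M N} I J f phi.
Arguments ires_inj {A M} I j.
Arguments aug_inj {A M} I.

Section LocalCohomology.
Variables (A : comNzRingType) (m : submodClosed A^o) (noethA : noetherian_ring A).
Implicit Types M N X Y Z E V : lmodType A.
Local Notation mm := (ofS m).

Definition tors M (x : M) := exists n, forall a : A, ipow mm A^o n a -> a *: x = 0.

Lemma torsP M (x : M) : x \in @torsion A m M <-> tors x.
Proof.
split=> [/asboolP[n h]|[n h]]; last apply/asboolP; exists n => a ma; apply: h.
  by rewrite -(ofS_ipow m A^o n) in ma.
by rewrite -(ofS_ipow m A^o n).
Qed.

Lemma tors0 M : @tors M 0. Proof. by exists 0%N => a _; rewrite scaler0. Qed.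
Lemma torsL M (a : A) (x y : M) : tors x -> tors y -> tors (a *: x + y).
Proof. by move=> /torsP hx /torsP hy; apply/torsP; rewrite rpredD ?rpredZ. Qed.
Definition torsS M : submodule M := SubM (@tors0 M) (@torsL M).
Lemma tors_lin M N (f : {linear M -> N}) x : tors x -> tors (f x).
Proof. by move=> [n h]; exists n => a ma; rewrite -linearZZ h // linear0. Qed.

Section Cohomology.
Variables (M : lmodType A) (I : injective_resolution M).

Definition cyc j (z : I j) := tors z /\ ires_d I j z = 0.
Definition bnd j (z : I j) := coboundary m z.

Lemma cycL j (a : A) (x y : I j) : cyc x -> cyc y -> cyc (a *: x + y).
Proof.
move=> [tx dx] [ty dy]; split; first exact: torsL.
by rewrite linearP dx dy scaler0 addr0.
Qed.
Lemma cycB j (x y : I j) : cyc x -> cyc y -> cyc (x - y).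
Proof. by move=> hx hy; rewrite addrC -scaleN1r; apply: cycL. Qed.

Lemma bnd0 j : @bnd j 0.
Proof. by case: j => [|j] //; exists 0; rewrite ?linear0 //; apply/torsP/tors0. Qed.

(* [H] is the [j]-th cohomology of the torsion of [I], [cl z] being the class of [z]. *)
Record cohom j (H : lmodType A) (cl : I j -> H) : Prop := Cohom {
  cl_lin : forall (a : A) x y, cyc x -> cyc y -> cl (a *: x + y) = a *: cl x + cl y;
  cl_onto : forall h, exists2 z, cyc z & h = cl z;
  cl_eq0 : forall z, cyc z -> cl z = 0 <-> bnd z }.

Lemma torsion_cohomology_cl j : exists cl, @cohom j (torsion_cohomology m I j) cl.
Proof.
have cP z : z \in @cocycles A m M I j <-> cyc z.
  by split=> [/andP[/torsP tz /eqP dz]|[/torsP tz dz]] //; apply/andP; rewrite dz.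
pose p := proj (@coboundaries A m M I j : submodClosed _).
pose cl z : torsion_cohomology m I j :=
  if pselect (z \in @cocycles A m M I j) is left h then p (Submodule h) else 0.
have clE z (h : z \in @cocycles A m M I j) : cl z = p (Submodule h).
  rewrite /cl; case: pselect => [k|//]; congr (p (Submodule _)); exact: Prop_irrelevance.
exists cl; split.
- move=> a x y /cP hx /cP hy.
  have hz : a *: x + y \in @cocycles A m M I j by rewrite rpredD ?rpredZ.
  rewrite (clE _ hx) (clE _ hy) (clE _ hz) -linearP; congr (p _).
  by apply: val_inj; rewrite linearP.
- move=> h; have [[z hz] ->] := proj_onto h; exists z; first exact/cP.
  by rewrite clE.
- move=> z /cP hz; rewrite (clE _ hz).
  have -> : p (Submodule hz) = 0 <-> kerS p (Submodule hz) by [].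
  by rewrite proj_ker; split=> [/asboolP|h] //; apply/asboolP.
Qed.

Lemma cohom_eq j H cl x y : @cohom j H cl -> cyc x -> cyc y -> bnd (x - y) -> cl x = cl y.
Proof.
move=> [cL _ c0] cx cy; have cxy := cycB cx cy => /(c0 _ cxy).
by rewrite addrC -scaleN1r cL // scaleN1r addrC => /subr0_eq.
Qed.

Lemma cohom_map j H cl V (g : I j -> V) : @cohom j H cl ->
  (forall (a : A) x y, cyc x -> cyc y -> g (a *: x + y) = a *: g x + g y) ->
  (forall z, cyc z -> bnd z -> g z = 0) ->
  exists h : {linear H -> V}, forall z, cyc z -> h (cl z) = g z.
Proof.
move=> [cL cO c0] gL g0; have /choice[s sP] : forall h, exists z, cyc z /\ h = cl z.
  by move=> h; have [z] := cO h; exists z.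
have gB x y : cyc x -> cyc y -> cl x = cl y -> g x = g y.
  move=> hx hy E; have hxy := cycB hx hy.
  have : bnd (x - y).
    apply/(c0 _ hxy); rewrite addrC -scaleN1r cL // E scaleN1r addNr //.
  move/(g0 _ hxy); rewrite addrC -scaleN1r gL // scaleN1r addrC => /subr0_eq //.
have hL : linear (g \o s).
  move=> a x y /=; have [[cx xE] [cy yE]] := (sP x, sP y).
  rewrite -gL //; apply: gB; [exact: (sP _).1 | exact: cycL |].
  by rewrite -(sP _).2 cL // -xE -yE.
exists (mkLinear hL) => z cz /=; apply: gB => //; first exact: (sP _).1.
by rewrite -(sP _).2.
Qed.
End Cohomology.

Lemma lift_cyc M N (I : injective_resolution M) (J : injective_resolution N) f phi j z :
  lifts I J f phi -> @cyc M I j z -> cyc (phi j z).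
Proof. by move=> [_ h] [tz dz]; split; [apply: tors_lin | rewrite -h dz linear0]. Qed.

Lemma lift_bnd M N (I : injective_resolution M) (J : injective_resolution N) f phi j z :
  lifts I J f phi -> @bnd M I j z -> bnd (phi j z).
Proof.
move=> [_ h]; case: j z => [|j] z; first by move=> /= ->; rewrite /bnd /= linear0.
by move=> [y /torsP ty ->]; exists (phi j y); rewrite ?h //; apply/torsP/tors_lin.
Qed.

Lemma lift_uniq M N (I : injective_resolution M) (J : injective_resolution N) f phi psi j z :
  lifts I J f phi -> lifts I J f psi -> @cyc M I j z -> bnd (phi j z - psi j z).
Proof.
move=> [p0 pS] [q0 qS] [tz dz].
have [|||||s sP] := @null_homotopy A I J (ires_d I) (ires_d J) (fun j => subLin (phi j) (psi j)).
- by move=> k x /ires_ker.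
- exact: ires_dd.
- exact: ires_inj.
- by move=> k x; rewrite /= pS qS linearB.
- by move=> x /aug_ker[y ->]; rewrite /= p0 q0 subrr.
case: j z tz dz => [|j] z tz dz.
  have /aug_ker[y ->] := dz; rewrite /bnd /= p0 q0 subrr //.
exists (s j z); first exact/torsP/tors_lin.
by have /= -> := sP j z; rewrite dz linear0 add0r.
Qed.

Lemma lifts_comp M N X (I : injective_resolution M) (J : injective_resolution N)
    (K : injective_resolution X) f g phi psi :
  lifts I J f phi -> lifts J K g psi -> lifts I K (compL g f) (fun j => compL (psi j) (phi j)).
Proof. by move=> [p0 pS] [q0 qS]; split=> [x|j x] /=; rewrite ?p0 ?q0 ?pS ?qS. Qed.
Lemma lifts_scal M (I : injective_resolution M) (f : {linear M -> M}) (a : A) :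
  (forall x, f x = a *: x) -> lifts I I f (fun j => scal (I j) a).
Proof. by move=> h; split=> [x|j x] /=; rewrite ?h linearZZ. Qed.

(** The composites of comparison maps in both directions lift the identity, so on cocycles they
    agree with it up to boundaries ([lift_uniq]). *)
Lemma cohom_transport M (I J : injective_resolution M) j H cl (f : {linear M -> M}) phi :
  (forall x, f x = x) -> lifts I J f phi -> @cohom M J j H cl -> cohom (fun z => cl (phi j z)).
Proof.
move=> fE hphi [cL cO c0].
have [psi hpsi] := lift_exists J I f.
have f1 (x : M) : compL f f x = 1 *: x by rewrite /= !fE scale1r.
have JJ z : cyc z -> bnd (phi j (psi j z) - z).
  move=> cz; have := lift_uniq (lifts_comp hpsi hphi) (lifts_scal J f1) cz.
  by rewrite /= scale1r.
have II z : cyc z -> bnd (psi j (phi j z) - z).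
  move=> cz; have := lift_uniq (lifts_comp hphi hpsi) (lifts_scal I f1) cz.
  by rewrite /= scale1r.
have bD K z w : @bnd M K j z -> bnd w -> bnd (z - w).
  case: (j) z w => [|k] z w; first by move=> /= -> ->; rewrite /bnd /= subrr.
  move=> [y /torsP ty ->] [y' /torsP ty' ->]; exists (y - y'); last by rewrite linearB.
  by apply/torsP; rewrite addrC -scaleN1r; apply: torsL.
split.
- by move=> a x y cx cy; rewrite linearP cL //; apply: (lift_cyc hphi).
- move=> h; have [z cz ->] := cO h; exists (psi j z); first exact: (lift_cyc hpsi).
  have cz' : cyc (phi j (psi j z)) by apply/(lift_cyc hphi)/(lift_cyc hpsi).
  apply/esym/subr0_eq; rewrite addrC -scaleN1r -cL // scaleN1r addrC.
  apply/c0; [exact: cycB | exact: JJ].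
- move=> z cz; rewrite c0; last exact: (lift_cyc hphi).
  split=> [b|]; last exact: (lift_bnd hphi).
  have -> : z = psi j (phi j z) - (psi j (phi j z) - z) by rewrite opprB addrC subrK.
  by apply: bD; [exact: (lift_bnd hpsi b) | exact: II].
Qed.

Definition LC j M : lmodType A := local_cohomology m j M.

(** [local_cohomology] picks its resolution by choice. Transport to [res M] puts all cohomology
    modules on fixed resolutions, where maps between them are induced by lifts. *)
Lemma LC_cohom j M : exists cl, @cohom M (res M) j (LC j M) cl.
Proof.
have [I IE] : exists I : injective_resolution M, LC j M = torsion_cohomology m I j.
  rewrite /LC /local_cohomology /pick_such; case: pselect => [h|[]]; first by case: cid.
  by exists (torsion_cohomology m (res M) j), (res M).
rewrite IE; have [cl hcl] := torsion_cohomology_cl I j.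
have [phi hphi] := lift_exists (res M) I (scal M 1).
exists (fun z => cl (phi j z)); apply: cohom_transport hphi hcl => x /=.
by rewrite scale1r.
Qed.
Definition lcl j M : res M j -> LC j M := projT1 (cid (LC_cohom j M)).
Lemma lclP j M : cohom (@lcl j M).
Proof. exact: (projT2 (cid (LC_cohom j M))). Qed.

Section LongExactSequence.
Variables (X Y Z : lmodType A) (f : {linear X -> Y}) (g : {linear Y -> Z}).
Hypotheses (fi : injective f) (go : onto g) (fg : forall y, g y = 0 <-> exists x, y = f x).

Lemma pair_tors E E' (w : (E * E')%type) : tors w.1 -> tors w.2 -> tors (w : (E * E' : lmodType A)%type).
Proof.
case: w => u v /= [n hn] [k hk]; exists (n + k)%N => a ma.
have h1 : a *: u = 0 by apply: hn; apply: ipow_le ma; rewrite leq_addr.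
have h2 : a *: v = 0 by apply: hk; apply: ipow_le ma; rewrite leq_addl.
by congr pair.
Qed.
Lemma tors_pair E E' (w : (E * E' : lmodType A)%type) : tors w -> tors w.1 /\ tors w.2.
Proof. by move=> [n h]; split; exists n => a /h; case: w {h} => u v []. Qed.

Lemma les : exists (a : forall j, {linear LC j X -> LC j Y})
    (b : forall j, {linear LC j Y -> LC j Z}) (c : forall j, {linear LC j Z -> LC j.+1 X}),
  [/\ forall j (phi : forall j, {linear res X j -> res Y j}), lifts (res X) (res Y) f phi ->
        forall u, cyc u -> a j (lcl u) = lcl (phi j u),
      injective (a 0%N), forall j h, b j h = 0 <-> exists h', h = a j h',
      forall j h, c j h = 0 <-> exists h', h = b j h'
    & forall j h, a j.+1 h = 0 <-> exists h', h = c j h'].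
Proof.
have [alpha [theta [aE t0 tS]]] := horseshoe_data fi go fg (res X) (res Z).
pose J := horseshoe go fg aE t0 tS.
have [psi hpsi] := lift_exists J (res Y) (scal Y 1).
pose clY j (w : J j) := lcl (psi j w).
have hY j : cohom (@clY j).
  by apply: cohom_transport hpsi (lclP j Y) => x /=; rewrite scale1r.
have cJ j (w : J j) : cyc w <-> [/\ tors w.1, tors w.2, ires_d (res X) j w.1 + theta j w.2 = 0
    & ires_d (res Z) j w.2 = 0].
  split=> [[/tors_pair[t1 t2] /hs_d0[d1 d2]]|[t1 t2 d1 d2]] //.
  by split; [apply: pair_tors | apply/hs_d0].
have cA j (u : res X j) : cyc u -> cyc ((u, 0) : J j).
  by move=> [tu du]; apply/cJ; split; rewrite //= ?linear0 ?addr0 //; apply: tors0.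
have cB j (w : J j) : cyc w -> cyc w.2 by move=> /cJ[].
have cC j (v : res Z j) : cyc v -> cyc (theta j v).
  move=> [tv dv]; split; first exact: tors_lin.
  by apply/eqP; rewrite -oppr_eq0 -tS dv linear0.
have ex_a j : exists a : {linear LC j X -> LC j Y}, forall u, cyc u -> a (lcl u) = clY j (u, 0).
  apply: (cohom_map (g := fun u => clY j (u, 0)) (lclP j X)) => [a x y cx cy|z cz bz].
    rewrite -(cl_lin (hY j)); [|exact: cA..].
    by congr (clY j _); congr pair; rewrite /= scaler0 addr0.
  apply/(cl_eq0 (hY j)); first exact: cA.
  case: j z bz {cz} => [|j] z; first by move=> /= ->.
  move=> [y /torsP ty ->]; exists (y, 0); first by apply/torsP/pair_tors => //; apply: tors0.
  by rewrite /= !linear0 addr0.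
have ex_b j : exists b : {linear LC j Y -> LC j Z}, forall w, cyc w -> b (clY j w) = lcl w.2.
  apply: (@cohom_map Y J j _ _ _ (fun w : J j => lcl w.2) (hY j)) => [a x y cx cy|z cz bz].
    by rewrite -(cl_lin (lclP j Z)) //; exact: cB.
  apply/(cl_eq0 (lclP j Z)); first exact: cB.
  case: j z bz {cz} => [|j] z; first by move=> /= ->.
  by move=> [y /torsP/tors_pair[_ ty] ->]; exists y.2 => //; apply/torsP.
have ex_c j : exists c : {linear LC j Z -> LC j.+1 X}, forall v, cyc v -> c (lcl v) = lcl (theta j v).
  apply: (cohom_map (g := fun v => lcl (theta j v)) (lclP j Z)) => [a x y cx cy|z cz bz].
    by rewrite linearP (cl_lin (lclP j.+1 X)) //; exact: cC.
  apply/(cl_eq0 (lclP j.+1 X)); first exact: cC.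
  case: j z bz {cz} => [|j] z.
    by move=> /= ->; rewrite linear0; exists 0; rewrite ?linear0 //; apply/torsP/tors0.
  move=> [y /torsP ty ->]; exists (- theta j y); last by rewrite tS linearN.
  by apply/torsP; rewrite -scaleN1r -[_ *: _]addr0; apply: torsL; [apply: tors_lin | apply: tors0].
have [a aP] := choice_dep ex_a.
have [b bP] := choice_dep ex_b.
have [c cP] := choice_dep ex_c.
exists a, b, c; split.
- move=> j phi hphi u cu; rewrite aP // /clY.
  have iL k : linear (fun u => (u, 0) : J k).
    by move=> e x y; congr pair; rewrite /= scaler0 addr0.
  pose chi k : {linear res X k -> res Y k} := compL (psi k) (mkLinear (iL k)).
  have hchi : lifts (res X) (res Y) f chi.
    split=> [x|k x] /=.
      have -> : (ires_aug (res X) x, 0) = ires_aug J (f x).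
        by congr pair; rewrite /= ?aE // (fg (f x)).2 ?linear0 //; exists x.
      by rewrite hpsi.1 /= scale1r.
    by rewrite -hpsi.2; congr (psi _ _); congr pair; rewrite /= linear0 ?addr0.
  apply: (cohom_eq (lclP j Y)).
  - exact: (lift_cyc hchi).
  - exact: (lift_cyc hphi).
  - exact: (lift_uniq hchi hphi).
- apply: linear_injP => h; have [u cu ->] := cl_onto (lclP 0 X) h.
  rewrite aP // => /(cl_eq0 (hY 0%N) (cA _ _ cu))/(congr1 fst) u0.
  exact: (cl_eq0 (lclP 0 X) cu).2 u0.
- move=> j h; split; last first.
    move=> [h' ->]; have [u cu ->] := cl_onto (lclP j X) h'.
    rewrite aP // bP; last exact: cA.
    apply/(cl_eq0 (lclP j Z)); first exact: (cB _ _ (cA _ _ cu)).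
    exact: bnd0.
  have [w cw ->] := cl_onto (hY j) h; rewrite bP // => /(cl_eq0 (lclP j Z) (cB _ _ cw)) bw.
  case: j w cw bw {h} => [|j] w cw bw.
    have cu : cyc w.1.
      by have /cJ[t1 _ d1 _] := cw; split; rewrite // -d1 bw linear0 addr0.
    by exists (lcl w.1); rewrite aP //; congr (clY _ _); case: w bw {cw cu} => u v /= ->.
  have [y /torsP ty yE] := bw.
  have cy : cyc (hs_d theta j (0, y) : J j.+1).
    split; first by apply: tors_lin; apply: pair_tors => //; apply: tors0.
    exact: (@ires_dd _ _ J j).
  have cu : cyc (w.1 - theta j y).
    have /cJ[t1 _ d1 _] := cycB cw cy.
    rewrite /= linear0 add0r -yE subrr linear0 addr0 in t1 d1; by split.
  exists (lcl (w.1 - theta j y)); rewrite aP //.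
  apply: (cohom_eq (hY j.+1)) => //; first exact: cA.
  exists (0, y); first by apply/torsP/pair_tors => //; apply: tors0.
  rewrite /=; congr pair; rewrite /= ?subr0 //.
  by rewrite opprB addrC subrK linear0 add0r.
- move=> j h; split; last first.
    move=> [h' ->]; have [w cw ->] := cl_onto (hY j) h'.
    rewrite bP // cP; last exact: cB.
    apply/(cl_eq0 (lclP j.+1 X)); first exact/cC/cB.
    have /cJ[t1 _ d1 _] := cw; exists (- w.1).
      by apply/torsP; rewrite -scaleN1r -[_ *: _]addr0; apply: torsL => //; apply: tors0.
    by rewrite linearN; apply/eqP; rewrite -addr_eq0 addrC d1.
  have [v cv ->] := cl_onto (lclP j Z) h; rewrite cP //.
  move=> /(cl_eq0 (lclP j.+1 X) (cC _ _ cv)) [u /torsP tu uE].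
  have cw : cyc ((- u, v) : J j).
    apply/cJ; split; [|by case: cv| |by case: cv].
    - by rewrite /= -scaleN1r -[_ *: _]addr0; apply: torsL => //; apply: tors0.
    - by rewrite /= uE linearN addNr.
  by exists (clY j (- u, v)); rewrite bP.
- move=> j h; split; last first.
    move=> [h' ->]; have [v cv ->] := cl_onto (lclP j Z) h'.
    rewrite cP // aP; last exact: cC.
    apply/(cl_eq0 (hY j.+1)); first exact/cA/cC.
    exists (0, v); first by apply/torsP/pair_tors; [apply: tors0 | case: cv].
    by rewrite /= linear0 add0r cv.2.
  have [u cu ->] := cl_onto (lclP j.+1 X) h; rewrite aP //.
  move=> /(cl_eq0 (hY j.+1) (cA _ _ cu)) [[u' v'] /torsP/tors_pair[/= tu tv] /= [uE /esym vE]].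
  exists (lcl v'); rewrite cP; last by split.
  apply: (cohom_eq (lclP j.+1 X)) => //; first by apply: cC; split.
  exists u'; first exact/torsP.
  by rewrite uE addrK.
Qed.
End LongExactSequence.
End LocalCohomology.

(** * Torsion modules have no higher local cohomology *)

Section Acyclic.
Variables (A : comNzRingType) (m : submodClosed A^o) (noethA : noetherian_ring A).
Implicit Types M N E : lmodType A.
Local Notation mm := (ofS m).

Lemma killS0 M (I : ideal A) (a : A) : I a -> a *: (0 : M) = 0.
Proof. by rewrite scaler0. Qed.
Lemma killSL M (I : ideal A) (b : A) (x y : M) :
  (forall a : A, I a -> a *: x = 0) -> (forall a : A, I a -> a *: y = 0) ->
  forall a : A, I a -> a *: (b *: x + y) = 0.
Proof.
by move=> hx hy a Ia; rewrite scalerDr scalerA mulrC -scalerA hx // hy // scaler0 addr0.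
Qed.
Definition killS M (I : ideal A) : submodule M := SubM (@killS0 M I) (@killSL M I).

(** By Baer's criterion. The image of [f] is finitely generated and torsion, hence killed by some
    [m^n]; by Artin-Rees, [I] meets [m^k] inside [m^n I], where [f] vanishes. So [f] and the zero
    map on [m^k] glue to a map on [I + m^k], and the value at 1 of an extension to [A] is killed by
    [m^k]. *)
Lemma tors_injective E : injective_module E -> injective_module (smd (torsS m E)).
Proof.
move=> hE; apply: baer => I f.
pose fI := compL (inc (torsS m E)) f.
pose U n : submodule (smd I) := preS fI (killS E (ipow mm A^o n)).
have Um n : U n ≤ U n.+1.
  by move=> u hu a /(ipow_le (leqnSn n)); apply: hu.
have [//||n hn] := @fg_le_union _ _ (topS (smd I)) U Um.
- exact/fg_smd/ideal_fg.
- by move=> u _; have [k hk] := incP (f u); exists k.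
have [c hc] := artin_rees noethA mm I (top_fg noethA).
pose k := (c + n)%N.
have pL : linear (fun w : (smd I * smd (ipow mm A^o k))%type => inc _ w.1 + inc _ w.2 : A^o).
  by move=> a x y; rewrite !linearP scalerDr addrACA.
have qL : linear (fun w : (smd I * smd (ipow mm A^o k))%type => fI w.1).
  by move=> a x y; rewrite linearP.
have [[u b] /= ub|g gE] := injective_extend (p := mkLinear pL) (q := mkLinear qL) hE.
  have Ib : smul (ipow mm A^o n) I (inc I u).
    apply: hc; split; first exact: incP.
    have -> : inc I u = - inc (ipow mm A^o k) b by apply/eqP; rewrite -addr_eq0; apply/eqP.
    by apply: subN; apply: incP.
  suff : smul (ipow mm A^o n) (topS (smd I)) ≤ kerS fI.
    apply; suff: imgS (inc I) (smul (ipow mm A^o n) (topS (smd I))) (inc I u).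
      by move=> [v hv /inc_injective ->].
    by rewrite img_smul -[imgS _ _]/(imS (inc I)) im_inc.
  by apply: smul_le => a x ma _; rewrite /kerS /= linearZZ; apply: (hn x).
have gI u : fI u = g (inc I u) by have /= <- := gE (u, 0); rewrite addr0.
have te : torsS m E (g 1).
  exists k => a ma; have [b bE] := inc_onto ma.
  have E0 : g (inc I 0 + inc _ b) = fI 0 := gE (0, b).
  rewrite !linear0 add0r -bE in E0; rewrite -linearZZ -[RHS]E0; congr (g _).
  exact: mulr1.
have [e eE] := inc_onto te; exists e => u; apply: inc_injective.
rewrite linearZZ -eE -[LHS]/(fI u) gI -linearZZ; congr (g _).
by rewrite [RHS]mulr1.
Qed.

Definition torsion_module M := forall x : M, tors m x.

(** A torsion module has a resolution by torsion injectives, on which the torsion functor changes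
    nothing, so every cocycle of positive degree is a boundary. *)
Lemma torsion_acyclic M j (h : LC m j.+1 M) : torsion_module M -> h = 0.
Proof.
move=> tM; have [||//|I tI] := @resolution_in A torsion_module _ _ M.
- move=> N tN; have [E [i [hE ii]]] := enough_injectives N.
  have [i' i'E] := @factor_inj _ _ _ _ (inc (torsS m E)) i (@inc_injective _ _ _)
    (fun x => inc_onto (tors_lin i (tN x) : torsS m E (i x))).
  exists (smd (torsS m E)), i'; split.
  + by move=> x; have [n hn] := incP x; exists n => a ma; apply: inc_injective;
      rewrite linearZZ linear0; apply: hn.
  + exact: tors_injective.
  + by move=> x y xy; apply: ii; rewrite -!i'E xy.
- by move=> N S tN y; have [x ->] := prj_onto S y; apply: tors_lin.
have [phi hphi] := lift_exists I (res M) (scal M 1).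
have hc : cohom m (fun z => lcl m (phi j.+1 z)).
  by apply: cohom_transport hphi (lclP m j.+1 M) => x; rewrite /= scale1r.
have [z cz ->] := cl_onto hc h; apply/(cl_eq0 hc cz).
have [_ /ires_ker[y ->]] := cz; exists y => //; exact/torsP/tI.
Qed.

Lemma LC0 M : isom (smd (torsS m M)) (LC m 0 M).
Proof.
have cP (x : smd (torsS m M)) : cyc m (ires_aug (res M) (inc _ x)).
  have tx : torsS m M (inc _ x) by apply: incP.
  by split; [apply: tors_lin | apply: ires_daug].
have hL : linear (fun x : smd (torsS m M) => lcl m (ires_aug (res M) (inc _ x))).
  by move=> a x y; rewrite !linearP (cl_lin (lclP m 0 M)).
exists (mkLinear hL); split.
  apply: linear_injP => x /(cl_eq0 (lclP m 0 M) (cP x)) /(linear_inj0 (aug_inj _)).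
  exact: (linear_inj0 (@inc_injective _ _ _)).
move=> h; have [z [tz /aug_ker[x zE]] ->] := cl_onto (lclP m 0 M) h.
have tx : torsS m M x.
  by have [n hn] := tz; exists n => a ma; apply: (aug_inj (res M)); rewrite linearZZ linear0 -zE hn.
have [u uE] := inc_onto tx; exists u; rewrite zE uE; by [].
Qed.
End Acyclic.

(** * Matlis duals of local cohomology *)

Section Hom.
Local Notation hom := Defs.hom.
Variable A : comNzRingType.
Implicit Types P Q R U V E : lmodType A.

Lemma happ_linear U V (f : hom U V) : linear (val f).
Proof. by have /asboolP := valP f. Qed.
Definition happ U V (f : hom U V) : {linear U -> V} := mkLinear (happ_linear f).
Lemma hmk_subproof U V (f : {linear U -> V}) : (f : U -> V) \in @linear_maps A U V.
Proof. by apply/asboolP => a x y; rewrite linearP. Qed.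
Definition hmk U V (f : {linear U -> V}) : hom U V := Submodule (hmk_subproof f).
Lemma hmkE U V (f : {linear U -> V}) x : happ (hmk f) x = f x. Proof. by []. Qed.
Lemma hom_ext U V (f g : hom U V) : (forall x, happ f x = happ g x) -> f = g.
Proof. by move=> h; apply: val_inj; apply/funext. Qed.
Lemma happL U V (a : A) (f g : hom U V) x : happ (a *: f + g) x = a *: happ f x + happ g x.
Proof.
have E : val (a *: f + g) = a *: val f + val g by rewrite linearP.
by rewrite -[LHS]/(val (a *: f + g) x) E.
Qed.
Lemma happ0 U V x : happ (0 : hom U V) x = 0. Proof. by []. Qed.
Lemma happZ U V (a : A) (f : hom U V) x : happ (a *: f) x = a *: happ f x.
Proof. by rewrite -[a *: f]addr0 happL happ0 addr0. Qed.

Variables E : lmodType A.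
Hypothesis hE : injective_module E.

Lemma dual_linear P Q (u : {linear P -> Q}) : linear (fun f : hom Q E => hmk (compL (happ f) u)).
Proof. by move=> a f g; apply: hom_ext => x; rewrite happL !hmkE; exact: happL. Qed.
Definition dual P Q (u : {linear P -> Q}) : {linear hom Q E -> hom P E} := mkLinear (dual_linear u).
Lemma dualE P Q (u : {linear P -> Q}) f x : happ (dual u f) x = happ f (u x). Proof. by []. Qed.

Lemma dual_exact P Q R (u : {linear P -> Q}) (v : {linear Q -> R}) :
  (forall q, v q = 0 <-> exists p, q = u p) ->
  forall f, dual u f = 0 <-> exists g, f = dual v g.
Proof.
move=> uv f; split=> [uf|[g ->]]; last first.
  by apply: hom_ext => x; rewrite !dualE (uv (u x)).2 ?linear0 //; exists x.
have [q /uv[p ->]|g gE] := injective_extend (p := v) (q := happ f) hE.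
  by rewrite -dualE uf.
by exists (hmk g); apply: hom_ext => x; rewrite dualE hmkE gE.
Qed.
Lemma dual_onto P Q (u : {linear P -> Q}) : injective u -> onto (dual u).
Proof.
move=> ui f; have [x /(linear_inj0 ui)->|g gE] := injective_extend (p := u) (q := happ f) hE.
  by rewrite linear0.
by exists (hmk g); apply: hom_ext => x; rewrite dualE hmkE gE.
Qed.
Lemma dual_inj P Q (u : {linear P -> Q}) : onto u -> injective (dual u).
Proof.
move=> uo; apply: linear_injP => f uf; apply: hom_ext => y; have [x ->] := uo y.
by rewrite -dualE uf.
Qed.
Lemma dual_isom P Q : isom P Q -> isom (hom Q E) (hom P E).
Proof. by move=> [u [ui uo]]; exists (dual u); split; [apply: dual_inj | apply: dual_onto]. Qed.
Lemma dual_scal P (a : A) (u : {linear P -> P}) f : (forall x, u x = a *: x) -> dual u f = a *: f.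
Proof. by move=> h; apply: hom_ext => x; rewrite dualE happZ h linearZZ. Qed.
End Hom.

Section MatlisDual.
Variables (A : comNzRingType) (m : submodClosed A^o) (noethA : noetherian_ring A).
Implicit Types M N X Y Z : lmodType A.
Local Notation E := (injective_envelope (quotient_mod m)).
Local Notation MD := (matlis_dual_cohomology m).

Lemma E_injective : injective_module E.
Proof. by case: (injective_envelopeP (quotient_mod m)). Qed.

Lemma dual_les X Y Z (f : {linear X -> Y}) (g : {linear Y -> Z}) :
  injective f -> onto g -> (forall y, g y = 0 <-> exists x, y = f x) ->
  exists (a : forall j, {linear MD Y j -> MD X j}) (b : forall j, {linear MD Z j -> MD Y j})
    (c : forall j, {linear MD X j.+1 -> MD Z j}),
  [/\ onto (a 0%N),
      forall j h, a j h = 0 <-> exists h', h = b j h',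
      forall j h, b j h = 0 <-> exists h', h = c j h'
    & forall j h, c j h = 0 <-> exists h', h = a j.+1 h'].
Proof.
move=> fi go fg; have [a [b [c [_ a0 ab bc ca]]]] := les m fi go fg.
exists (fun j => dual _ (a j)), (fun j => dual _ (b j)), (fun j => dual _ (c j)).
split; first exact: (dual_onto E_injective).
- by move=> j; apply: (dual_exact E_injective).
- by move=> j; apply: (dual_exact E_injective).
- by move=> j; apply: (dual_exact E_injective).
Qed.

(** Multiplication by [a] on a resolution lifts multiplication by [a] on [M], so the map that [f]
    induces on local cohomology, and its dual, are again multiplication by [a]. *)
Lemma dual_les_scal M Z (a : A) (f : {linear M -> M}) (g : {linear M -> Z}) :
  (forall x, f x = a *: x) ->
  injective f -> onto g -> (forall y, g y = 0 <-> exists x, y = f x) ->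
  exists (b : forall j, {linear MD Z j -> MD M j}) (c : forall j, {linear MD M j.+1 -> MD Z j}),
  [/\ onto (scal (MD M 0) a),
      forall j h, a *: h = 0 <-> exists h', h = b j h',
      forall j h, b j h = 0 <-> exists h', h = c j h'
    & forall j h, c j h = 0 <-> exists h', h = a *: h'].
Proof.
move=> fa fi go fg; have [a' [b [c [aP a0 ab bc ca]]]] := les m fi go fg.
have a'E j h : a' j h = a *: h.
  have [u cu ->] := cl_onto (lclP m j M) h.
  rewrite (aP j _ (lifts_scal (res M) fa)) //.
  have c0 : cyc m (0 : res M j) by split; [apply: tors0 | rewrite linear0].
  rewrite -[LHS]/(lcl m (a *: u)) -[a *: u]addr0 (cl_lin (lclP m j M)) //.
  by rewrite ((cl_eq0 (lclP m j M) c0).2 (bnd0 m (res M) j)) addr0.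
exists (fun j => dual _ (b j)), (fun j => dual _ (c j)).
have dE j h : dual E (a' j) h = a *: h by apply: dual_scal => x; apply: a'E.
split.
- move=> h; have [h' ->] := dual_onto E_injective a0 h; exists h'; exact: dE.
- move=> j h; rewrite -dE; exact: (dual_exact E_injective).
- by move=> j; apply: (dual_exact E_injective).
- move=> j h; rewrite (dual_exact E_injective (ca j)).
  by split=> -[h' ->]; exists h'; rewrite ?dE // -dE.
Qed.

Lemma MD_torsion M j : torsion_module m M -> forall x : MD M j.+1, x = 0.
Proof. by move=> tM x; apply: hom_ext => h; rewrite (torsion_acyclic noethA h tM) linear0. Qed.

Lemma cohom_isom M (I : injective_resolution M) j H H' cl cl' :
  @cohom A m M I j H cl -> @cohom A m M I j H' cl' -> isom H H'.
Proof.
move=> hc hc'; have [h hE] := cohom_map hc (cl_lin hc') (fun z cz => (cl_eq0 hc' cz).2).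
exists h; split; last by move=> y; have [z cz ->] := cl_onto hc' y; exists (cl z); rewrite hE.
apply: linear_injP => x; have [z cz ->] := cl_onto hc x.
by rewrite hE // => /(cl_eq0 hc' cz)/(cl_eq0 hc cz).
Qed.

Lemma LC_isom M N j : isom M N -> isom (LC m j M) (LC m j N).
Proof.
move=> [f [fi fo]].
have ai : injective (compL (ires_aug (res N)) f) by move=> x y /= /(aug_inj _)/fi.
have a0 x : ires_d (res N) 0 x = 0 <-> exists y, x = compL (ires_aug (res N)) f y.
  rewrite aug_ker; split=> [[y ->]|[y ->]]; last by exists (f y).
  by have [z ->] := fo y; exists z.
pose I := @InjectiveResolution A M (res N) (compL (ires_aug (res N)) f) (ires_d (res N))
  (ires_inj (res N)) ai a0 (@ires_ker _ _ (res N)).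
have hI : @cohom A m M I j (LC m j N) (@lcl A m j N).
  by have [h1 h2 h3] := lclP m j N; split.
have [phi hphi] := lift_exists (res M) I (scal M 1).
apply: cohom_isom (lclP m j M) (cohom_transport _ hphi hI) => x /=.
by rewrite scale1r.
Qed.
Lemma MD_isom M N j : isom M N -> isom (MD M j) (MD N j).
Proof. by move=> h; apply: (dual_isom E_injective); apply/isom_sym/LC_isom. Qed.
End MatlisDual.

Section FiniteLengthMore.
Variables (A : comNzRingType) (m : submodClosed A^o) (H : noeth_local m).
Implicit Types M N : lmodType A.
Local Notation mm := (ofS m).
Let noethA := nl_noeth H.

Lemma covers_cyclic M (S T : submodule M) : covers S T ->
  exists2 x, T x /\ ~ S x & T = addS S (seqS [:: x]).
Proof.
move=> [ST TS cov]; have [x Tx Sx] : exists2 x, T x & ~ S x.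
  by apply: contrapT => h; apply: TS => x Tx; apply: contrapT => Sx; apply: h; exists x.
exists x => //; have le : addS S (seqS [:: x]) ≤ T.
  by apply: add_le => //; apply: span_le => y; rewrite inE => /eqP->.
apply: sle_anti => //; have [h|//] := cov _ (@le_addl _ _ S (seqS [:: x])) le.
by case: Sx; apply: h; apply: le_addr; apply: spanP; rewrite inE.
Qed.

Lemma finl_fg M : finl M -> fg (topS M).
Proof.
move=> [n]; have : fg (botS M) by exists [::]; rewrite seqS_nil.
elim: n (botS M) => [|n IH] S fS /=; first by move=> <-.
move=> [U cU /IH]; apply; have [x _ ->] := covers_cyclic cU.
by apply: add_fg => //; exists [:: x].
Qed.

Lemma len_mquo_mker M a : finl M -> len (mquo M a) = len (mker M a).
Proof.
move=> fM; have [_ ->] := len_qmod (imS (scal M a)); have [_ ->] := len_smd (kerS (scal M a)).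
have h1 := ilen_add fM (@sle_bot _ _ (kerS (scal M a))) (fun _ _ => Logic.I).
have h2 := ilen_add fM (@sle_bot _ _ (imS (scal M a))) (fun _ _ => Logic.I).
have h3 : ilen (kerS (scal M a)) (topS M) = ilen (botS M) (imS (scal M a)).
  by rewrite /kerS ilen_ker add_bot.
lia.
Qed.

Lemma torsion_killed M : fg (topS M) -> torsion_module m M -> killed m M.
Proof.
move=> fM tM; pose U n := killS M (ipow mm A^o n).
have Um n : U n ≤ U n.+1 by move=> u hu a /(ipow_le (leqnSn n)); apply: hu.
have [//||n hn] := @fg_le_union _ _ (topS M) U Um.
  by move=> x _; have [k hk] := tM x; exists k.
by exists n => a ma x; apply: hn.
Qed.
Lemma killed_torsion M : killed m M -> torsion_module m M.
Proof. by move=> [r hr] x; exists r => a ma; apply: hr. Qed.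

Definition gam M : lmodType A := smd (torsS m M).
Definition bar M : lmodType A := qmod (torsS m M).

Lemma gam_fg M : fg (topS M) -> fg (topS (gam M)).
Proof. by move=> fM; apply: fg_smd; apply: (le_fg noethA fM). Qed.
Lemma gam_torsion M : torsion_module m (gam M).
Proof.
move=> x; have [n hn] := incP x; exists n => a ma; apply: inc_injective.
by rewrite linearZZ linear0; apply: hn.
Qed.
Lemma gam_killed M : fg (topS M) -> killed m (gam M).
Proof. by move=> fM; apply: torsion_killed (gam_fg fM) (@gam_torsion M). Qed.
Lemma gam_finl M : fg (topS M) -> finl (gam M).
Proof. by move=> fM; apply: (killed_finl H (gam_fg fM) (gam_killed fM)). Qed.

Lemma torsion_ext M N (p : {linear M -> N}) x : fg (topS M) ->
  (forall y, p y = 0 -> tors m y) -> tors m (p x) -> tors m x.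
Proof.
move=> fM pk [n hn]; have fK : fg (topS (smd (kerS p))) by apply: fg_smd; apply: (le_fg noethA fM).
have [|r hr] := torsion_killed fK.
  move=> y; have [k hk] : tors m (inc _ y) by apply: pk; exact: (incP y).
  by exists k => a ma; apply: inc_injective; rewrite linearZZ linear0; apply: hk.
exists (r + n)%N; suff h : ipow mm A^o (r + n) ≤ preS (actL x) (botS M) by [].
rewrite ipow_smul; apply: smul_le => a b ma mb; rewrite /= -scalerA.
have [u ->] : exists u : smd (kerS p), b *: x = inc _ u.
  by apply: inc_onto; rewrite /= linearZZ; apply: hn.
by rewrite -linearZZ hr // linear0.
Qed.

Lemma bar_torsionfree M (x : bar M) : fg (topS M) -> tors m x -> x = 0.
Proof.
move=> fM; have [y ->] := prj_onto (torsS m M) x => ty; apply/prj0.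
by apply: (torsion_ext fM (p := prj (torsS m M))) => // z /prj0.
Qed.
Lemma bar_fg M : fg (topS M) -> fg (topS (bar M)).
Proof. exact: fg_onto (prj_onto _). Qed.

Lemma bar_regular M (a : A) : fg (topS M) -> killed m (mker M a) -> injective (scal (bar M) a).
Proof.
move=> fM kM; apply: linear_injP => x; have [y ->] := prj_onto (torsS m M) x.
rewrite -[scal _ _ _]/(a *: _) -linearZZ => /prj0 tay; apply/prj0.
apply: (torsion_ext fM (p := scal M a)) => // z az.
have [u ->] : exists u : mker M a, z = inc _ u by apply: inc_onto.
apply: tors_lin; exact: killed_torsion.
Qed.
End FiniteLengthMore.

(** * Matlis duals of modules of finite length and of torsion submodules *)

Section Matlis.
Variables (A : comNzRingType) (m : submodClosed A^o) (H : noeth_local m).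
Implicit Types M N X Y : lmodType A.
Local Notation mm := (ofS m).
Local Notation E := (injective_envelope (quotient_mod m)).
Local Notation MD := (matlis_dual_cohomology m).
Local Notation hom := Defs.hom.
Let noethA := nl_noeth H.
Let hE := @E_injective A m.

Lemma mm_covers : covers mm (topS A^o).
Proof.
split=> // [h|U mU _]; first exact: (mm_proper H (h 1 Logic.I)).
case: (pselect (U 1)) => U1; [right | left; exact: (proper_le H)].
by move=> a _; rewrite -[a]mulr1; apply: (subZ (S := U)).
Qed.

Lemma residue_isom : isom (qmod mm) (quotient_mod m).
Proof.
apply: (isom_prj (p := proj m)) => [|x]; first exact: proj_onto.
by rewrite -[_ = 0]/(kerS (proj m) x) proj_ker.
Qed.

Lemma simple_isom M : covers (botS M) (topS M) -> isom (qmod mm) M.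
Proof.
move=> cM; have [_ _ cov] := cM; have [x [_ x0] xE] := covers_cyclic cM.
rewrite add_bot in xE.
apply: (isom_prj (p := actL x)) => [y|a].
  by have : topS M y by []; rewrite xE => /seq1P.
split=> [ax|ma].
  by apply: (proper_le H (I := kerS (actL x))) => //=; rewrite scale1r.
apply: contrapT => ax; case: (cov (seqS [:: actL x a]) (@sle_bot _ _ _) (fun _ _ => Logic.I)) => h.
  by apply: ax; apply: (h (actL x a)); apply: spanP; rewrite inE.
have /seq1P[b bE] := h x Logic.I.
have [|c cE] := @unit_mm _ _ H (1 - b * (a : A)).
  move=> mb; apply: (mm_proper H); rewrite -(subrK (b * (a : A)) 1); apply: (subD (S := mm)) => //.
  exact: (subZ (S := mm)).
have bE' : x = b *: ((a : A) *: x) := bE.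
apply: x0; rewrite /= -[x]scale1r -cE -scalerA scalerBl scale1r -scalerA -bE' subrr scaler0 //.
Qed.

Lemma len_residue : finl (qmod mm) /\ len (qmod mm) = 1%N.
Proof.
have [h ->] := len_qmod mm; have c : clen 1 mm (topS A^o) by exists (topS A^o) => //; apply: mm_covers.
by split; [apply/h; exists 1%N | apply: clenE].
Qed.

Lemma hom_residue : isom (qmod mm) (hom (quotient_mod m) E).
Proof.
have [_ [iota [ii ess]]] := injective_envelopeP (quotient_mod m).
have one0 : proj m 1 <> 0.
  by rewrite -[_ = 0]/(kerS (proj m) 1) proj_ker; apply: (mm_proper H).
apply: (isom_prj (p := actL (hmk iota))) => [f|a]; last first.
  split=> [fa|ma].
    have : happ (a *: hmk iota) (proj m 1) = 0 by rewrite -[a *: _]/(actL (hmk iota) a) fa.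
    rewrite happZ hmkE -linearZZ => /(linear_inj0 ii); rewrite -linearZZ.
    by rewrite -[_ = 0]/(kerS (proj m) (a * 1)) proj_ker mulr1.
  apply: hom_ext => x; rewrite happZ hmkE; have [b ->] := proj_onto x.
  rewrite -linearZZ -[a *: _]linearZZ.
  have -> : proj m (a *: (b : A^o)) = 0; last by rewrite linear0.
  rewrite -[_ = 0]/(kerS (proj m) (a * b)) proj_ker mulrC; exact: (subZ (S := mm)).
pose y := happ f (proj m 1).
suff [b bE] : exists b : A, y = b *: iota (proj m 1).
  exists b; apply: hom_ext => x; have [c ->] := proj_onto x.
  have cE : proj m c = (c : A) *: proj m 1 by rewrite -linearZZ; congr (proj m _); rewrite [RHS]mulr1.
  by rewrite cE [LHS]linearZZ [RHS]linearZZ happZ hmkE -/y bE.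
have my (a : A) : mm a -> a *: y = 0.
  move=> ma; rewrite -linearZZ -linearZZ.
  have -> : proj m (a *: (1 : A^o)) = 0; last by rewrite linear0.
  by rewrite -[_ = 0]/(kerS (proj m) (a * 1)) proj_ker mulr1.
case: (pselect (y = 0)) => y0; first by exists 0; rewrite y0 scale0r.
(* By essentiality a nonzero multiple [a *: y] comes from the residue field. Since [m] kills [y],
   the multiplier [a] is a unit and [y] itself comes from there. *)
have [|x /toSP/seq1P[a aE] x0] := ess (toS (seqS [:: y])).
  by exists y; [apply/toSP/spanP; rewrite inE | apply/eqP].
have [|b ba] := @unit_mm _ _ H a.
  by move=> /my ay; move/eqP: x0; apply; rewrite aE.
have [c xE] := proj_onto x.
have yE : y = b *: iota x by rewrite aE scalerA ba scale1r.
have cE : proj m c = (c : A) *: proj m 1 by rewrite -linearZZ; congr (proj m _); rewrite [RHS]mulr1.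
by exists (b * (c : A)); rewrite yE xE cE linearZZ scalerA.
Qed.

(** Induction along a composition series: the dual functor is exact and sends the residue field to a
    copy of itself. *)
Lemma len_hom M : finl M -> finl (hom M E) /\ len (hom M E) = len M.
Proof.
have [n nE] : exists n, len M = n by exists (len M).
elim: n M nE => [|n IH] M nE fM.
  have M0 := len0P fM nE.
  have [f ->] : finl (hom M E) /\ len (hom M E) = 0%N by apply: zero_finl => f; apply: hom_ext => x; rewrite (M0 x) !linear0.
  by rewrite nE.
have := ilenP fM; rewrite -/(len M) nE => -[U cU clU].
have cS : covers (botS (smd U)) (topS (smd U)).
  have [bU Ub cov] := cU; split=> // [h|V _ _].
    by apply: Ub => x /inc_onto[u ->]; rewrite (h u Logic.I) linear0.
  case: (cov (imgS (inc U) V)) => [|x [v _ ->]|h|h].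
  - exact: sle_bot.
  - exact: incP.
  - by left => v Vv; apply: (linear_inj0 (@inc_injective _ _ U)); apply: h; exists v.
  - by right => u _; have [v Vv /inc_injective ->] := h _ (incP u).
have iU : isom (hom (smd U) E) (qmod mm).
  apply: isom_trans (isom_sym hom_residue); apply: (dual_isom hE).
  exact: isom_trans (isom_sym residue_isom) (simple_isom cS).
have [f1 l1] := len_isom iU; have [f2 l2] := len_residue.
have [fq lq] := len_qmod U.
have fqU : finl (qmod U) by apply/fq; exists n.
have [fh] := IH (qmod U) (etrans lq (clenE clU)) fqU.
rewrite lq (clenE clU) => lh.
have ex : forall x, dual E (inc U) x = 0 <-> exists u, x = dual E (prj U) u.
  apply: (dual_exact hE) => q; rewrite prj0; split=> [/inc_onto//|[p ->]]; exact: incP.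
have [h1 h2] := len_exact (dual_inj (prj_onto U)) (dual_onto hE (@inc_injective _ _ U)) ex.
have fM' : finl (hom M E) by apply/h1; split=> //; apply/f1.
by split=> //; rewrite h2 // lh l1 l2 addn1.
Qed.

Lemma hom_killed M : killed m M -> killed m (hom M E).
Proof. by move=> [r hr]; exists r => a ma f; apply: hom_ext => x; rewrite happZ -linearZZ hr // linear0. Qed.

Lemma MD0_isom M : isom (MD M 0) (hom (gam m M) E).
Proof. exact: (dual_isom hE (LC0 m M)). Qed.
Lemma MD0_len M : fg (topS M) -> finl (MD M 0) /\ len (MD M 0) = len (gam m M).
Proof.
move=> fM; have [f l] := len_isom (MD0_isom M).
have [f' l'] := len_hom (gam_finl H fM).
by rewrite f l l'.
Qed.
Lemma killed_isom M N : isom M N -> killed m M -> killed m N.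
Proof. by move=> [f [_ fo]]; apply: killed_onto fo. Qed.
Lemma MD0_killed M : fg (topS M) -> killed m (MD M 0).
Proof.
move=> fM; apply: (killed_isom (isom_sym (MD0_isom M))).
exact: (hom_killed (gam_killed H fM)).
Qed.

Lemma MD_onto_isom X Y (p : {linear X -> Y}) j : onto p ->
  (forall x, p x = 0 -> tors m x) -> isom (MD Y j.+1) (MD X j.+1).
Proof.
move=> po pk; pose W := smd (kerS p).
have tW : torsion_module m W.
  move=> x; have [n hn] := pk _ (incP x); exists n => a ma; apply: inc_injective.
  by rewrite linearZZ linear0; apply: hn.
have [|a [b [c [_ ab bc ca]]]] := @dual_les _ m _ _ _ (inc (kerS p)) p (@inc_injective _ _ _) po.
  by move=> y; split=> [h|[x ->]]; [apply: inc_onto | apply: (incP x)].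
exists (b j.+1); split.
  apply: linear_injP => h /bc[h' ->]; by rewrite (MD_torsion noethA tW h') linear0.
by move=> h; have [|h' ->] := (ab _ h).1; [exact: (MD_torsion noethA tW) | exists h'].
Qed.
Lemma MD_bar M j : isom (MD (bar m M) j.+1) (MD M j.+1).
Proof. by apply: (MD_onto_isom _ (prj_onto _)) => x /prj0. Qed.

(** Every local cohomology class [h] is killed by some [m^n], so each functional in [m^n M_j]
    vanishes at [h]. This is the separatedness that [complete_fg] asks for. *)
Lemma MD_separated M j (f : MD M j) : (forall n, ipow mm (MD M j) n f) -> f = 0.
Proof.
move=> hf; apply: hom_ext => h.
have [z cz hE'] := cl_onto (lclP m j M) h; have [[n hn] _] := cz.
have c0 : cyc m (0 : res M j) by split; [apply: tors0 | rewrite linear0].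
have hh (b : A) : ipow mm A^o n b -> b *: h = 0.
  move=> mb; have := cl_lin (lclP m j M) b cz c0; rewrite addr0 hn //.
  by rewrite ((cl_eq0 (lclP m j M) c0).2 (bnd0 m _ j)) addr0 -hE' => ->.
have L0 : happ (0 : MD M j) h = 0 by [].
have LL (a : A) (x y : MD M j) : happ x h = 0 -> happ y h = 0 -> happ (a *: x + y) h = 0.
  by move=> hx hy; rewrite happL hx hy scaler0 addr0.
suff le : ipow mm (MD M j) n ≤ SubM L0 LL by exact: (le f (hf n)).
rewrite ipowE; apply: smul_le => b g mb _.
suff : happ (b *: g) h = 0 by [].
by rewrite happZ -linearZZ hh // linear0.
Qed.
End Matlis.

(** * Finite generation of the duals over a complete ring, and their behaviour under a cut *)

Section Complete.
Variables (A : comNzRingType) (m : submodClosed A^o) (H : noeth_local m).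
Hypothesis C : adically_complete m.
Implicit Types M N X Z : lmodType A.
Local Notation mm := (ofS m).
Local Notation MD := (matlis_dual_cohomology m).
Let noethA := nl_noeth H.

Lemma isom_inv M N : isom M N -> exists (f : {linear M -> N}) (g : {linear N -> M}),
  (forall x, g (f x) = x) /\ forall y, f (g y) = y.
Proof.
move=> [f [fi fo]]; have [g gE] := factor_inj (f := scal N 1) fi (fun x => fo _).
have fg y : f (g y) = y by rewrite gE /= scale1r.
by exists f, g; split=> // x; apply: fi; rewrite fg.
Qed.

Lemma mquo_isom M N a : isom M N -> isom (mquo M a) (mquo N a).
Proof.
move=> [f [fi fo]]; apply: (isom_prj (p := compL (prj _) f)) => [y|x].
  by have [z ->] := prj_onto _ y; have [x ->] := fo z; exists x.
rewrite -[compL _ _ _]/(prj _ (f x)) prj0; split=> [[z _]|[z _ ->]]; last first.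
  by exists (f z); rewrite //= linearZZ.
by have [u ->] := fo z; rewrite -[scal _ _ _]/(a *: _) -linearZZ => /fi ->; exists u.
Qed.

Lemma killed_mm_mprimary : mprimary m mm.
Proof. by split=> //; exists 1%N; rewrite ipow1. Qed.

(** Successive approximation: [x] is a combination of lifted generators plus [a x'], and the same
    applies to [x']. The partial sums [u n i] of the coefficients converge in [A], and [x] minus the
    limit combination lies in every [m^n N]. *)
Lemma complete_fg N (a : A) : mm a -> fg (topS (mquo N a)) ->
  (forall x, (forall n, ipow mm N n x) -> x = 0) -> fg (topS N).
Proof.
move=> ma [t tE] sepN.
have [s sE] : exists s, t = map (mquo_prj N a) s.
  elim: t {tE} => [|y t [s ->]]; first by exists [::].
  by have [x ->] := prj_onto _ y; exists (x :: s).
have step x : exists cx : ('I_(size s) -> A) * N, x = \sum_i cx.1 i *: s`_i + a *: cx.2.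
  have : seqS t (mquo_prj N a x) by rewrite -tE.
  rewrite sE -img_seqS => -[y /seqS_sumP[c yE] /prjE[z _ xyE]].
  by exists (c, z); rewrite -yE -[a *: _]xyE addrC subrK.
have /choice[F FE] := step.
exists s; apply: sle_anti => // x _.
pose X n := iter n (fun y => (F y).2) x.
pose c n i := (F (X n)).1 i.
pose u n i := \sum_(k < n) a ^+ k * c k i.
have XE n : x = \sum_i u n i *: s`_i + a ^+ n *: X n.
  elim: n => [|n IH].
    rewrite expr0 scale1r [X in X + _]big1 ?add0r // => i _.
    by rewrite /u big_ord0 scale0r.
  rewrite [LHS]IH {1}(FE (X n)) scalerDr scalerA -exprSr addrA; congr (_ + _).
  rewrite scaler_sumr -big_split; apply: eq_bigr => i _ /=.
  by rewrite /u big_ord_recr /= scalerDl scalerA.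
have am n : ipow mm A^o n (a ^+ n).
  by elim: n => [|n IH] //; rewrite exprS; apply: (ipowM (M := A^o)).
have /choice[b bP] : forall i, exists bi : A, forall n, ipow mm A^o n (bi - u n i).
  move=> i; have [|bi hb] := C.2 (fun n => u n i).
    move=> n; have : ipow mm A^o n (u n.+1 i - u n i).
      rewrite /u big_ord_recr /= [X in X - _]addrC addrK mulrC.
      exact: (subZ (S := ipow mm A^o n) _ (am n)).
    by rewrite -(ofS_ipow m A^o n).
  by exists bi => n; rewrite -(ofS_ipow m A^o n); apply: hb.
have -> : x = \sum_i b i *: s`_i; last exact: seqS_sum.
apply/esym/subr0_eq/sepN => n; rewrite {1}(XE n) opprD addrA -sumrB.
have Z (b0 : A) y : ipow mm A^o n b0 -> ipow mm N n (b0 *: y).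
  by move=> hb; have := ipowZ (k := 0) hb (Logic.I : ipow mm N 0 y); rewrite addn0.
apply: subB; last exact: Z.
by apply: sub_sum => i _; rewrite -scalerBl; apply: Z.
Qed.

Section Regular.
Variables (N : lmodType A) (a : A).
Hypotheses (fN : fg (topS N)) (kN : killed m (mker N a)).
Local Notation L := (mquo (bar m N) a).

Lemma bar_quo : exists q : {linear mquo N a -> L},
  onto q /\ forall x, q (prj _ x) = prj _ (prj _ x).
Proof.
have [|q qE] := factor_onto (p := mquo_prj N a) (f := compL (prj _) (prj (torsS m N)))
  (N := L) (prj_onto _).
  move=> x /prj0[z _ ->]; apply/prj0; exists (prj _ z) => //.
  by rewrite -[RHS]/(a *: prj _ z) -linearZZ.
exists q; split=> // y; have [x ->] := prj_onto _ y; have [z ->] := prj_onto _ x.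
by exists (mquo_prj N a z); rewrite qE.
Qed.

Lemma bar_quo_ker (q : {linear mquo N a -> L}) : (forall x, q (prj _ x) = prj _ (prj _ x)) ->
  forall x, q x = 0 -> exists2 w, tors m w & x = prj _ w.
Proof.
move=> qE x; have [y ->] := prj_onto _ x; rewrite qE => /prj0[z' _].
have [z ->] := prj_onto _ z'; rewrite -[scal _ _ _]/(a *: _) -linearZZ => /prjE ty.
by exists (y - a *: z) => //; apply/prjE; exists z; rewrite //= opprB addrC subrK.
Qed.

Lemma bar_les : exists (b : forall j, {linear MD L j -> MD (bar m N) j})
    (c : forall j, {linear MD (bar m N) j.+1 -> MD L j}),
  [/\ forall j h, a *: h = 0 <-> exists h', h = b j h',
      forall j h, b j h = 0 <-> exists h', h = c j h'
    & forall j h, c j h = 0 <-> exists h', h = a *: h'].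
Proof.
have reg := bar_regular H fN kN.
have [||b [c [_ h1 h2 h3]]] := @dual_les_scal A m (bar m N) L a (scal _ a) (prj _) _ reg (prj_onto _).
- by [].
- by move=> y; rewrite prj0; split=> [[x _ ->]|[x ->]]; exists x.
by exists b, c.
Qed.

Lemma mquo_MD_inj j : exists i : {linear mquo (MD (bar m N) j.+1) a -> MD L j}, injective i.
Proof.
have [b [c [_ _ h3]]] := bar_les.
have [|i iE] := factor_onto (p := mquo_prj (MD (bar m N) j.+1) a) (f := c j) (prj_onto _).
  by move=> x /prj0[z _ ->]; apply/h3; exists z.
exists i; apply: linear_injP => y; have [x ->] := prj_onto _ y.
by rewrite iE => /h3[z ->]; apply/prj0; exists z.
Qed.
End Regular.

Lemma generic_bar N : fg (topS N) -> exists2 a : A, mm a & killed m (mker N a).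
Proof.
move=> fN; have [a ma sa] := generic_ex H (generic_superficial H mm fN).
exists a => //; exact: (superficial_killed H killed_mm_mprimary fN ma sa).
Qed.

Lemma fg_isom M N : isom M N -> fg (topS M) -> fg (topS N).
Proof. by move=> [f [_ fo]]; apply: fg_onto fo. Qed.
Lemma dim_le_isom M N n : isom M N -> dim_le M n -> dim_le N n.
Proof. by move=> [f [_ fo]]; apply: dim_le_onto fo. Qed.

(** Modulo torsion, which leaves the dual in degree [j + 1] unchanged, a generic [a] is regular, and
    that dual modulo [a] embeds in the degree [j] dual of [L = bar N / a bar N]. By induction this
    quotient is finitely generated of dimension at most [j]; completeness lifts the first property,
    and a cut lowers the dimension by at most one. *)
Lemma MD_fg_dim j N : fg (topS N) -> fg (topS (MD N j)) /\ dim_le (MD N j) j.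
Proof.
elim: j N => [|j IH] N fN.
  split; first by apply: finl_fg; case: (MD0_len H fN).
  exact: (killed_dim0 H (MD0_killed H fN)).
have [a ma kN] := generic_bar fN.
have fB := bar_fg m fN; have fL := mquo_fg a fB.
have [fD dD] := IH _ fL; have [i ii] := mquo_MD_inj fN kN j.
have fq : fg (topS (mquo (MD (bar m N) j.+1) a)) by apply: (fg_inj noethA ii).
have fM : fg (topS (MD (bar m N) j.+1)).
  by apply: complete_fg ma fq _ => x; apply: MD_separated.
have iso := MD_bar H N j.
split; first exact: fg_isom fM.
apply: (dim_le_isom iso).
exact: (dim_le_mquo_ge H killed_mm_mprimary fM ma (dim_le_inj ii dD)).
Qed.
Lemma MD_fg j N : fg (topS N) -> fg (topS (MD N j)).
Proof. by move=> fN; case: (MD_fg_dim j fN). Qed.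
Lemma MD_dim j N : fg (topS N) -> dim_le (MD N j) j.
Proof. by move=> fN; case: (MD_fg_dim j fN). Qed.

Section Sections.
Variables (N : lmodType A) (a : A).
Hypotheses (fN : fg (topS N)) (kN : killed m (mker N a)).

Lemma MD_quo_isom j : isom (MD (mquo (bar m N) a) j.+1) (MD (mquo N a) j.+1).
Proof.
have [q [qo qE]] := bar_quo N a; apply: (MD_onto_isom H _ qo) => x.
by move/(bar_quo_ker qE) => [w tw ->]; apply: tors_lin.
Qed.

(** The sequence is first obtained on [bar N], where [a] is regular. The maps from [N] to [bar N]
    and from [N / aN] to [bar N / a bar N] have torsion kernels, so they change no dual of positive
    degree; this is why the degrees start at 1. *)
Lemma MD_section j : exists (i : {linear mquo (MD N j.+2) a -> MD (mquo N a) j.+1})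
    (p : {linear MD (mquo N a) j.+1 -> mker (MD N j.+1) a}),
  [/\ injective i, onto p & forall x, p x = 0 <-> exists u, x = i u].
Proof.
have [b [c [h1 h2 h3]]] := bar_les fN kN.
have [k [k' [kK kK']]] := isom_inv (MD_quo_isom j).
have [f1 [g1 [fK1 gK1]]] := isom_inv (MD_bar H N j.+1).
have [f0 [g0 [fK0 gK0]]] := isom_inv (MD_bar H N j).
have [|i iE] := factor_onto (p := mquo_prj (MD N j.+2) a)
  (f := compL k (compL (c j.+1) g1)) (prj_onto _).
  move=> x /prj0[z _ ->]; rewrite -[scal _ _ _]/(a *: _) /= linearZZ.
  have -> : c j.+1 (a *: g1 z) = 0 by apply/h3; exists (g1 z).
  by rewrite linear0.
have [|p pE] := factor_inj (i := inc (kerS (scal (MD N j.+1) a)))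
  (f := compL f0 (compL (b j.+1) k')) (@inc_injective _ _ _).
  move=> x; apply: inc_onto; rewrite /= -linearZZ.
  have -> : a *: b j.+1 (k' x) = 0 by apply/h1; exists (k' x).
  by rewrite linear0.
exists i, p; split.
- apply: linear_injP => y; have [x ->] := prj_onto _ y; rewrite iE /= => e.
  have : c j.+1 (g1 x) = 0 by rewrite -(kK (c _ _)) e linear0.
  move=> /h3[z g1x]; apply/prj0; exists (f1 z) => //=.
  by rewrite -linearZZ -g1x gK1.
- move=> y; have ay := incP y; rewrite /= in ay.
  have : a *: g0 (inc _ y) = 0 by rewrite -linearZZ ay linear0.
  move=> /h1[x xE]; exists (k x); apply: inc_injective.
  by rewrite pE /= kK -xE gK0.
- move=> x; split=> [px|[u ->]].
    have : f0 (b j.+1 (k' x)) = 0 by rewrite -[LHS]/(compL f0 (compL (b j.+1) k') x) -pE px linear0.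
    move=> /(congr1 g0); rewrite fK0 linear0 => /h2[z zE].
    by exists (mquo_prj _ a (f1 z)); rewrite iE /= fK1 -zE kK'.
  have [v ->] := prj_onto _ u; apply: inc_injective; rewrite pE linear0 iE /= kK.
  have -> : b j.+1 (c j.+1 (g1 v)) = 0 by apply/h2; exists (g1 v).
  by rewrite linear0.
Qed.

(** With [W = gam N], [B = bar N] and [L = B / aB] there is an exact sequence [0 -> W / aW -> gam (N
    / aN) -> gam L -> 0]. As [W] has finite length and contains [(0 :_N a)], the first length is
    [l(0 :_N a)]. The last is that of [L_0], which is [B_1 / a B_1] because [B_0 = 0]. *)
Lemma gam_mquo_len : len (gam m (mquo N a)) = (len (mquo (MD N 1) a) + len (mker N a))%N.
Proof.
pose W := gam m N; pose B := bar m N; pose L := mquo B a.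
have fB : fg (topS B) by apply: bar_fg.
have fL : fg (topS L) by apply: mquo_fg.
have -> : len (mquo (MD N 1) a) = len (gam m L).
  have [_ <-] := len_isom (mquo_isom a (MD_bar H N 0)).
  have [_ <-] := MD0_len H fL; have [b [c [h1 h2 h3]]] := bar_les fN kN.
  have g0 (x : gam m B) : x = 0.
    apply: inc_injective; rewrite linear0; apply: (bar_torsionfree H) => //; exact: (incP x).
  have B0 (x : MD B 0) : x = 0.
    apply: hom_ext => y; have [f [_ fo]] := LC0 m B; have [z ->] := fo y.
    by rewrite (g0 z) !linear0.
  suff : isom (mquo (MD B 1) a) (MD L 0) by move/len_isom => [].
  apply: (isom_prj (p := c 0%N)) => [y|x].
    by apply/h2; apply: B0.
  by rewrite h3; split=> [[z ->]|[z _ ->]]; exists z.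
have <- : len (mquo W a) = len (mker N a).
  rewrite (len_mquo_mker a (gam_finl H fN)); apply/esym.
  have [i iE] := factor_inj (i := inc (torsS m N)) (f := inc (kerS (scal N a)))
    (@inc_injective _ _ _) (fun x => inc_onto (tors_lin (inc _) (killed_torsion kN x) : torsS m N _)).
  suff : isom (mker N a) (mker W a) by move/len_isom => [].
  apply: (isom_inc (i := i)) => [x y e|x].
    by apply: (@inc_injective _ _ (kerS (scal N a))); rewrite -!iE e.
  split=> [ax|[u ->]]; last first.
    rewrite -[kerS _ _]/(a *: i u = 0); apply: inc_injective; rewrite linear0 linearZZ iE.
    exact: (incP u).
  have [u uE] : exists u : mker N a, inc _ x = inc _ u.
    apply: inc_onto; rewrite -[kerS _ _]/(a *: inc _ x = 0) -linearZZ.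
    by rewrite (_ : a *: x = 0) // linear0.
  by exists u; apply: inc_injective; rewrite iE.
have [q [qo qE]] := bar_quo N a.
have iP (w : W) : exists u : gam m (mquo N a), compL (mquo_prj N a) (inc _) w = inc _ u.
  by apply: inc_onto; apply: (tors_lin (mquo_prj N a)); exact: (incP w).
have [i0 i0E] := factor_inj (@inc_injective _ _ _) iP.
have [|i iE] := factor_onto (p := mquo_prj W a) (f := i0) (prj_onto _).
  move=> x /prj0[z _ ->]; apply: inc_injective; rewrite linear0 i0E.
  by apply/prj0; exists (inc _ z) => //; rewrite -[RHS]/(a *: inc _ z) -linearZZ.
have pP (u : gam m (mquo N a)) : exists v : gam m L, compL q (inc _) u = inc _ v.
  by apply: inc_onto; apply: (tors_lin q); exact: (incP u).
have [p pE] := factor_inj (@inc_injective _ _ _) pP.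
have fin : finl (gam m (mquo N a)) by apply: (gam_finl H); apply: mquo_fg.
have [||| _ hlen] := @len_exact _ _ _ _ i p.
- apply: linear_injP => y; have [w ->] := prj_onto _ y; rewrite iE => w0.
  have : inc _ (i0 w) = 0 by rewrite w0 linear0.
  rewrite i0E => /prj0[z _ wE]; apply/prj0.
  have tz : torsS m N z.
    apply: (torsion_ext H fN (p := scal N a)) => [x ax|]; last first.
      by have := incP w; rewrite wE.
    have [u ->] : exists u : mker N a, x = inc _ u by apply: inc_onto.
    by apply: tors_lin; apply: killed_torsion.
  have [z' zE] := inc_onto tz; exists z' => //; apply: inc_injective.
  by rewrite wE zE -[RHS]/(inc _ (a *: z')) linearZZ.
- move=> v; have [y yE] := qo (inc _ v).
  have ty : torsS m (mquo N a) y.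
    apply: (torsion_ext H (mquo_fg a fN) (p := q)) => [x /(bar_quo_ker qE)[w tw ->]|].
      exact: tors_lin.
    by rewrite -yE; exact: (incP v).
  have [u uE] := inc_onto ty; exists u; apply: inc_injective.
  by rewrite pE yE uE.
- move=> x; split=> [px|[y ->]].
    have : q (inc _ x) = 0 by rewrite -[LHS]/(compL q (inc _) x) -pE px linear0.
    move=> /(bar_quo_ker qE)[w tw xE]; have [w' wE] : exists w' : W, w = inc _ w' by apply: inc_onto.
    by exists (mquo_prj W a w'); apply: inc_injective; rewrite iE i0E xE wE.
  have [w ->] := prj_onto _ y; apply: inc_injective.
  rewrite pE linear0 -[LHS]/(q (inc _ (i (prj _ w)))) iE i0E qE.
  by rewrite (prj0 (torsS m N) (inc _ w)).2 ?linear0 //; exact: (incP w).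
by rewrite hlen // addnC.
Qed.
End Sections.
End Complete.

(** * Homological degree *)

Section HomologicalDegree.
Variables (A : comNzRingType) (m : submodClosed A^o) (H : noeth_local m).
Hypothesis C : adically_complete m.
Variable (d0 : nat).
Hypothesis dA : dim_le A^o d0.
Implicit Types M N X Y Z : lmodType A.
Local Notation mm := (ofS m).
Local Notation MD := (matlis_dual_cohomology m).
Let noethA := nl_noeth H.

Lemma dim_le_all M : dim_le M d0.
Proof.
apply: dim_le_ann dA => a ha x.
by have := ha (1 : A); rewrite [_ *: _]mulr1 => ->; rewrite scale0r.
Qed.

Variables (I : submodClosed A^o).
Local Notation Q := (ofS I).
Hypothesis Qm : mprimary m Q.
Local Notation hd := (hdeg m I).
Local Notation MDd := (MD_dim H C).
Local Notation MDf := (MD_fg H C).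

Lemma hdeg_rec_fuel k l N : fg (topS N) -> (ndim N <= k)%N -> (ndim N <= l)%N ->
  hdeg_rec m I k N = hdeg_rec m I l N.
Proof.
move=> fN; have h0 k' : (ndim N <= 0)%N -> hdeg_rec m I k'.+1 N = fine (module_length N).
  move=> n0 /=; case: ifP => // /negP h; exfalso; apply: h.
  apply/(mdim_le0 (@dim_le_all N)); move: n0; rewrite leqn0 => /eqP n0.
  by have := dim_le_ndim (@dim_le_all N); rewrite n0.
elim: k l N fN h0 => [|k IH] [|l] N fN h0 nk nl //.
- by rewrite h0.
- by rewrite h0.
rewrite /=; case: ifP => // _; congr (_ + _); apply: eq_bigr => -[j /= jn] _; congr (_ * _).
have jd : (ndim (MD N j) <= j)%N by apply: ndim_le; apply: MDd.
apply: IH; first exact: MDf.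
- move=> k' n0 /=; case: ifP => // /negP h; exfalso; apply: h.
  apply/(mdim_le0 (@dim_le_all _)); move: n0; rewrite leqn0 => /eqP n0.
  by have := dim_le_ndim (@dim_le_all (MD N j)); rewrite n0.
- by apply: leq_trans jd _; rewrite -ltnS; apply: leq_trans nk.
- by apply: leq_trans jd _; rewrite -ltnS; apply: leq_trans nl.
Qed.

Lemma ndim_exact N s : dim_le N s.+1 -> ~ dim_le N s -> ndim N = s.+1.
Proof.
move=> h nh; have := ndim_le h; rewrite leq_eqVlt => /orP[/eqP//|].
by rewrite ltnS => le; case: nh; apply: dim_le_mono le (dim_le_ndim h).
Qed.

Lemma hdeg_0 N : fg (topS N) -> dim_le N 0 -> hd N = (len N)%:Z.
Proof.
move=> fN h; rewrite /hdeg; have -> : ndim N = 0%N by apply/eqP; rewrite -leqn0; apply: ndim_le.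
by rewrite /= module_lengthE //; apply: (killed_finl H fN (dim0_killed H fN h)).
Qed.

Lemma hdeg_S N s : fg (topS N) -> dim_le N s.+1 -> ~ dim_le N s ->
  hd N = hcoef I s.+1 N 0 + \sum_(j < s.+1) 'C(s, j)%:Z * hd (MD N j).
Proof.
move=> fN h nh; have ns := ndim_exact h nh; rewrite /hdeg ns /=.
case: ifP => [/(mdim_le0 h) h0|_].
  by case: nh; apply: dim_le_mono h0.
rewrite (hilbert_coefE H Qm fN h ns) // ns; congr (_ + _); apply: eq_bigr => -[j /= jn] _.
congr (_ * _); apply: hdeg_rec_fuel => //; first exact: MDf.
by rewrite -ltnS; apply: leq_ltn_trans jn; apply: ndim_le; apply: MDd.
Qed.

Lemma hcoef_isom s M N i : fg (topS M) -> dim_le M s -> isom M N -> (i <= s)%N ->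
  hcoef I s M i = hcoef I s N i.
Proof.
move=> fM dM iso lis; apply/esym/hcoefE => //.
have [K hK] := hcoefP H Qm fM dM; exists K => n /hK <-.
by congr (_%:Z); apply/esym/hsf_isom.
Qed.

Lemma hdeg_isom M N : fg (topS M) -> isom M N -> hd M = hd N.
Proof.
suff h s M' N' : fg (topS M') -> dim_le M' s -> isom M' N' -> hd M' = hd N'.
  by move=> fM; apply: h (@dim_le_all _).
elim/ltn_ind: s M' N' => -[|s] IH {}M {}N fM dM iso.
  rewrite !hdeg_0 //; first by have [_ ->] := len_isom iso.
    exact: fg_isom iso fM.
  exact: dim_le_isom iso dM.
case: (pselect (dim_le M s)) => dMs; first exact: (IH s).
have dNs : ~ dim_le N s by move/(dim_le_isom (isom_sym iso)).
rewrite (hdeg_S fM dM dMs) (hdeg_S (fg_isom iso fM) (dim_le_isom iso dM) dNs).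
rewrite (hcoef_isom fM dM iso) //; congr (_ + _); apply: eq_bigr => -[j /= js] _; congr (_ * _).
apply: (IH j) => //; [exact: MDf | exact: MDd | exact: MD_isom].
Qed.

Lemma len_gam_le M : finl M -> (len (gam m M) <= len M)%N.
Proof. by move=> fM; case: (finl_inj (@inc_injective _ _ (torsS m M)) fM). Qed.

Lemma len_gam_killed M : killed m M -> len (gam m M) = len M.
Proof.
move=> kM; have [_ ->] := len_smd (torsS m M).
suff -> : torsS m M = topS M by [].
by apply: sle_anti => // x _; apply: killed_torsion.
Qed.

Lemma hdeg_MD0 M : fg (topS M) -> hd (MD M 0) = (len (gam m M))%:Z.
Proof.
move=> fM; rewrite hdeg_0; [|exact: MDf|exact: MDd].
by have [_ ->] := MD0_len H fM.
Qed.

(** In positive dimension the term [j = 0] of the recursion is [hdeg M_0], which equals this length,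
    and the other terms are nonnegative by induction. *)
Lemma hdeg_ge_gam M : fg (topS M) -> (len (gam m M))%:Z <= hd M.
Proof.
suff h s M' : fg (topS M') -> dim_le M' s -> (len (gam m M'))%:Z <= hd M'.
  by move=> fM; apply: h (@dim_le_all _).
elim/ltn_ind: s M' => -[|s] IH {}M fM dM.
  rewrite hdeg_0 // lez_nat; apply: len_gam_le.
  exact: (killed_finl H fM (dim0_killed H fM dM)).
case: (pselect (dim_le M s)) => dMs; first exact: (IH s).
rewrite (hdeg_S fM dM dMs) big_ord_recl /= bin0 mul1r hdeg_MD0 //.
have h1 := hcoef_ge0 H Qm fM dM.
have h2 : 0 <= \sum_(i < s) 'C(s, bump 0 i)%:Z * hd (MD M (bump 0 i)).
  apply: sumr_ge0 => -[j /= js] _; apply: mulr_ge0 => //.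
  have h := IH j.+1 js _ (MDf j.+1 fM) (MDd fM).
  by apply: le_trans h.
by apply: le_trans (lerD h1 (lerD (lexx _) h2)); rewrite add0r addr0.
Qed.

Section Extension.
Variables (X Y Z : lmodType A) (i : {linear X -> Y}) (p : {linear Y -> Z}).
Hypotheses (fX : fg (topS X)) (fY : fg (topS Y)).
Hypotheses (ii : injective i) (po : onto p).
Hypothesis ip : forall y, p y = 0 <-> exists x, y = i x.
Hypothesis kZ : killed m Z.

Let fZ : fg (topS Z). Proof. exact: fg_onto po fY. Qed.
Let finZ : finl Z. Proof. exact: (killed_finl H fZ kZ). Qed.
Let kip : kerS p = imS i.
Proof. by apply: subm_eq => y; rewrite -[kerS p y]/(p y = 0) ip; split=> [[x ->]|[x _ ->]]; exists x. Qed.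

(** Insert [Q^n Y + X]: above it lies a quotient of [Z], below it a quotient of [X / Q^n X]. *)
Lemma hsf_ext_le n : (hsf Q Y n <= hsf Q X n + len Z)%N.
Proof.
rewrite /hsf (ilen_add (flen_ipow H Qm n fY) (@le_addl _ _ _ (imS i)) (fun _ _ => Logic.I)).
apply: leq_add.
  rewrite -ilen_ker; apply: ilen_mono (flen_ipow H Qm n fX) _ _ _ => // x; exact: map_ipow.
have [h ->] := len_onto po; rewrite -kip; apply: ilen_mono (h.1 finZ) _ _ _ => //; exact: le_addr.
Qed.

Lemma ext_cokernel : exists r, forall a : A, ipow mm A^o r a -> forall y, exists x, a *: y = i x.
Proof. by have [r hr] := kZ; exists r => a ma y; apply/ip; rewrite linearZZ hr. Qed.

(** If [m^r] kills [Z], then [Q^r Y ≤ X] and therefore [Q^(n+r) Y ≤ Q^n X]. *)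
Lemma hsf_ext_ge : exists r, forall n, (hsf Q X n <= hsf Q Y (n + r))%N.
Proof.
have [r hr] := ext_cokernel; exists r => n.
have Yi : ipow Q Y r ≤ imS i.
  apply: (sle_trans (ipow_mono Qm.1)); rewrite ipowE; apply: smul_le => a y ma _.
  by have [x ->] := hr a ma y; exists x.
have h : preS i (ipow Q Y (n + r)) ≤ ipow Q X n.
  move=> x /= hx; have : imgS i (ipow Q X n) (i x).
    move: hx; rewrite ipow_smul; apply: (smul_le _) => a y Qa /Yi[x' _ ->].
    by exists (a *: x'); [rewrite -[n]addn0; apply: ipowZ | rewrite linearZZ].
  by move=> [x' hx' /ii ->].
rewrite /hsf; apply: (@leq_trans (ilen (preS i (ipow Q Y (n + r))) (topS X))).
  apply: ilen_mono (flen_ge_ipow (n := (n + r)%N) H Qm fX _ _) h _ _ => // x; exact: map_ipow.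
by rewrite ilen_ker; apply: ilen_mono (flen_ipow H Qm _ fY) _ _ _ => //; apply: le_addl.
Qed.

Lemma dim_le_extE n : dim_le X n <-> dim_le Y n.
Proof. by split=> h; [apply: (dim_le_ext H ext_cokernel h) | apply: dim_le_inj ii h]. Qed.

Lemma hcoef0_ext_le s : dim_le Y s.+1 -> hcoef I s.+1 Y 0 <= hcoef I s.+1 X 0.
Proof.
move=> dY; have dX := (dim_le_extE _).2 dY; rewrite -subr_ge0.
have [K hK] := hcoefP H Qm fX dX; have [L hL] := hcoefP H Qm fY dY.
apply: (@hpS_ge0 s (fun j => hcoef I s.+1 X j - hcoef I s.+1 Y j) (- (len Z)%:Z)).
exists (maxn K L) => n; rewrite geq_max => /andP[/hK h1 /hL h2].
rewrite -hpB -h1 -h2; have := hsf_ext_le n.+1; lia.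
Qed.

(** In dimension one the shift by [r] changes the Hilbert polynomial of [Y] only by the constant
    [r e_0], so the difference of the two polynomials is bounded below. *)
Lemma hcoef0_ext_ge1 : dim_le Y 1 -> hcoef I 1 X 0 <= hcoef I 1 Y 0.
Proof.
move=> dY; have dX := (dim_le_extE _).2 dY; rewrite -subr_ge0.
have [K hK] := hcoefP H Qm fX dX; have [L hL] := hcoefP H Qm fY dY; have [r hr] := hsf_ext_ge.
apply: (@hpS_ge0 0 (fun j => hcoef I 1 Y j - hcoef I 1 X j) (- (r%:Z * hcoef I 1 Y 0))).
exists (maxn K L) => n; rewrite geq_max => /andP[/hK h1 Ln].
have h2 := hL _ Ln; have h3 := hL _ (leq_trans Ln (leq_addr r n)).
have E : hp 1 (hcoef I 1 Y) (n + r)%N = hp 1 (hcoef I 1 Y) n + r%:Z * hcoef I 1 Y 0.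
  elim: r {hr h3} => [|r IH]; first by rewrite addn0 mul0r addr0.
  by have := hpS 0 (hcoef I 1 Y) (n + r)%N; rewrite hp0 addnS; lia.
rewrite -hpB -h1; have := hr n.+1; rewrite addSn; lia.
Qed.

Lemma len_gam_ext_le : (len (gam m X) <= len (gam m Y))%N.
Proof.
have [f fE] := factor_inj (f := compL i (inc (torsS m X))) (@inc_injective _ _ (torsS m Y))
  (fun x : gam m X => inc_onto (tors_lin i (incP x) : torsS m Y _)).
have fi : injective f.
  by move=> x y e; apply/inc_injective/ii; have := fE x; rewrite e fE.
by case: (finl_inj fi (gam_finl H fY)).
Qed.

Lemma hdeg_ext_le1 : dim_le Y 1 -> hd X <= hd Y.
Proof.
move=> dY; have dX := (dim_le_extE _).2 dY.
case: (pselect (dim_le Y 0)) => dY0.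
  have dX0 := (dim_le_extE _).2 dY0; rewrite !hdeg_0 // lez_nat.
  by case: (finl_inj ii (killed_finl H fY (dim0_killed H fY dY0))).
have dX0 : ~ dim_le X 0 by move/dim_le_extE.
rewrite (hdeg_S fX dX dX0) (hdeg_S fY dY dY0) !big_ord1 /= !bin0 !mul1r !hdeg_MD0 //.
by have := hcoef0_ext_ge1 dY; have := len_gam_ext_le; lia.
Qed.
End Extension.

(* As [Z] is torsion, the Matlis duals of [X] and [Y] agree in degrees [>= 2] and that of
   [Y] embeds in that of [X] in degree [1], with torsion cokernel. *)
Lemma hdeg_ext_le X Y Z (i : {linear X -> Y}) (p : {linear Y -> Z}) :
  fg (topS X) -> fg (topS Y) -> injective i -> onto p ->
  (forall y, p y = 0 <-> exists x, y = i x) -> killed m Z ->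
  hd Y <= hd X + (len Z)%:Z.
Proof.
move=> fX fY ii po ip kZ.
suff h s : dim_le Y s -> hd Y <= hd X + (len Z)%:Z by apply: h (@dim_le_all _).
elim: s => [|s IH] dY.
  have dX := (dim_le_extE ii ip kZ _).2 dY; rewrite !hdeg_0 // -PoszD lez_nat.
  have [_ ->//] := len_exact ii po ip; exact: (killed_finl H fY (dim0_killed H fY dY)).
case: (pselect (dim_le Y s)) => dYs; first exact: IH.
have dX := (dim_le_extE ii ip kZ _).2 dY.
have dXs : ~ dim_le X s by move/(dim_le_extE ii ip kZ).
rewrite (hdeg_S fX dX dXs) (hdeg_S fY dY dYs).
have he := hcoef0_ext_le fX fY ii po ip kZ dY.
have tZ := killed_torsion kZ; have fZ : fg (topS Z) by apply: fg_onto po fY.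
have [a [b [c [a0 ab bc ca]]]] := dual_les m ii po ip.
have ainj j : injective (a j.+1).
  by apply: linear_injP => h /ab[h' ->]; rewrite (MD_torsion noethA tZ h') linear0.
(* The right end of the dual sequence: the kernel of [Y_0 -> X_0] is a quotient of [Z_0], whose
   length is that of [Z]. *)
have gamZ : (len (gam m Y) <= len (gam m X) + len Z)%N.
  have [_ lY] := MD0_len H fY; have [_ lX] := MD0_len H fX; have [fZ0 lZ] := MD0_len H fZ.
  have [bo bE] := factor_inj (f := b 0%N) (@inc_injective _ _ (kerS (a 0%N)))
    (fun h : MD Z 0 => inc_onto ((ab _ _).2 (ex_intro _ h erefl) : kerS (a 0%N) _)).
  have bon : onto bo.
    move=> k; have [h hE] := (ab _ _).1 (incP k : a 0%N _ = 0).
    by exists h; apply: inc_injective; rewrite bE.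
  have [fk lk] := finl_onto bon fZ0.
  have kE x : a 0%N x = 0 <-> exists u, x = inc (kerS (a 0%N)) u.
    by split=> [h|[u ->]]; [apply: inc_onto | apply: (incP u)].
  have [_ ex] := len_exact (@inc_injective _ _ (kerS (a 0%N))) a0 kE.
  have [fY0 _] := MD0_len H fY.
  rewrite -lY -lX ex // addnC leq_add2l; apply: leq_trans lk _.
  by rewrite lZ len_gam_killed.
suff h j : (j < s)%N -> hd (MD Y j.+1) <= hd (MD X j.+1).
  rewrite !big_ord_recl /= !bin0 !mul1r !hdeg_MD0 //.
  have hs : \sum_(i0 < s) 'C(s, bump 0 i0)%:Z * hd (MD Y (bump 0 i0)) <=
         \sum_(i0 < s) 'C(s, bump 0 i0)%:Z * hd (MD X (bump 0 i0)).
    by apply: ler_sum => -[j /= js] _; apply: ler_wpM2l => //; apply: h.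
  have hg : (len (gam m Y))%:Z <= (len (gam m X))%:Z + (len Z)%:Z by rewrite -PoszD lez_nat.
  by apply: le_trans (lerD he (lerD hg hs)) _; rewrite -!addrA lerD2l lerD2l addrC.
case: j => [|j] _; last first.
  have aon : onto (a j.+2).
    by move=> h; have [|h' ->] := (ca _ h).1; [exact: (MD_torsion noethA tZ) | exists h'].
  by rewrite (hdeg_isom (MDf _ fY) (ex_intro _ (a j.+2) (conj (@ainj _) aon))).
have kE x : compL (prj (imS (a 1%N))) (scal _ 1) x = 0 <-> exists u, x = a 1%N u.
  rewrite -[compL _ _ _]/(prj (imS (a 1%N)) (1 *: x)) scale1r prj0.
  by split=> [[u _ ->]|[u ->]]; exists u.
have pon : onto (compL (prj (imS (a 1%N))) (scal (MD X 1) 1)).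
  by move=> y; have [x ->] := prj_onto _ y; exists x; rewrite -[RHS]/(prj _ (1 *: x)) scale1r.
(* In degree 1 the cokernel of [Y_1 -> X_1] embeds in [Z_0], which has finite length, and [X_1] has
   dimension at most one. *)
apply: (hdeg_ext_le1 (MDf _ fY) (MDf _ fX) (@ainj 0%N) kE) (MDd fX).
have [|f fE] := factor_onto (p := compL (prj (imS (a 1%N))) (scal (MD X 1) 1)) (f := c 0%N) pon.
  by move=> x /kE h; apply/ca.
have fi : injective f.
  apply: linear_injP => y; have [x ->] := pon y; rewrite fE => /ca h.
  exact/kE.
exact: killed_inj fi (MD0_killed H fZ).
Qed.

Lemma hcoef_dim0 M : fg (topS M) -> dim_le M 0 -> hcoef I 0 M 0 = (len M)%:Z.
Proof.
move=> fM dM; rewrite (@hcoefE A I 0 M (fun=> (len M)%:Z)) //.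
have [c hc] := hsf_killed Qm fM (dim0_killed H fM dM).
by exists c => n cn; rewrite hp0 hc // leqW.
Qed.

Lemma mker_len_gam M a : fg (topS M) -> killed m (mker M a) -> (len (mker M a) <= len (gam m M))%N.
Proof.
move=> fM kM; have h (x : mker M a) : tors m (inc (kerS (scal M a)) x).
  by apply: tors_lin; apply: killed_torsion.
have [f fE] := factor_inj (f := inc (kerS (scal M a))) (@inc_injective _ _ (torsS m M)) (fun x => inc_onto (h x : torsS m M _)).
have fi : injective f by move=> x y e; apply: inc_injective; have := fE x; rewrite e fE.
by case: (finl_inj fi (gam_finl H fM)).
Qed.

Section HyperplaneSection.
Variables (N : lmodType A) (a : A).
Hypotheses (fN : fg (topS N)) (kN : killed m (mker N a)).

Lemma hdeg_MD_mquo j : killed m (mker (MD N j.+1) a) ->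
  hd (mquo (MD N j.+2) a) <= hd (MD N j.+2) ->
  hd (MD (mquo N a) j.+1) <= hd (MD N j.+2) + hd (MD N j.+1).
Proof.
move=> kj hj; have [i [p [ii po ip]]] := MD_section H fN kN j.
have fq := mquo_fg a (MDf j.+2 fN).
have := hdeg_ext_le fq (MDf j.+1 (mquo_fg a fN)) ii po ip kj.
have := mker_len_gam (MDf j.+1 fN) kj; have := hdeg_ge_gam (MDf j.+1 fN).
lia.
Qed.

(** The degree 0 case, through [gam_mquo_len]: since [N_1] has dimension at most one, [N_1 / a N_1]
    has finite length, which is its [hdeg]. *)
Lemma hdeg_MD_mquo0 : killed m (mker (MD N 1) a) ->
  hd (mquo (MD N 1) a) <= hd (MD N 1) ->
  hd (MD (mquo N a) 0) <= hd (MD N 1) + (len (mker N a))%:Z.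
Proof.
move=> k1 h1; rewrite hdeg_MD0; last exact: mquo_fg.
rewrite (gam_mquo_len H fN kN) PoszD lerD2r.
rewrite -(hdeg_0 (mquo_fg a (MDf 1 fN))) //.
exact: (dim_le_mquo H k1 (MDd fN)).
Qed.
End HyperplaneSection.

Lemma pascal_sum n (h : nat -> int) :
  \sum_(i < n.+1) 'C(n, i)%:Z * (h i.+1 + h i) = \sum_(i < n.+2) 'C(n.+1, i)%:Z * h i.
Proof.
under eq_bigr do rewrite mulrDr.
rewrite big_split /= [RHS]big_ord_recl /= bin0 mul1r.
rewrite [X in _ + X]big_ord_recl /= bin0 mul1r addrCA; congr (_ + _).
under [RHS]eq_bigr => i _ do rewrite /bump /= add1n binS PoszD mulrDl.
rewrite big_split /= addrC; congr (_ + _).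
rewrite big_ord_recr /= (_ : 'C(n, n.+1) = 0%N) ?mul0r ?addr0 //.
by rewrite bin_small.
Qed.

(** Induction on the dimension, with the claim also imposed on the duals [N_j], which have smaller
    dimension. The multiplicity does not change, and the two recursion formulas are compared term by
    term after [pascal_sum]. *)
Lemma generic_hdeg N : fg (topS N) -> generic Q (fun a => hd (mquo N a) <= hd N).
Proof.
suff h s N' : fg (topS N') -> dim_le N' s -> generic Q (fun a => hd (mquo N' a) <= hd N').
  by move=> fN; apply: h (@dim_le_all _).
elim/ltn_ind: s N' => s IH {}N fN dN.
case: s IH dN => [|s] IH dN.
  apply: generic_all => a Qa; rewrite !hdeg_0 //; last 2 first.
  - exact: mquo_fg.
  - exact: dim_le_onto (prj_onto _) dN.
  by rewrite lez_nat; case: (finl_onto (prj_onto (imS (scal N a))) (killed_finl H fN (dim0_killed H fN dN))).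
case: (pselect (dim_le N s)) => dNs; first exact: (IH s).
have G1 := generic_superficial H Q fN.
have G2 : generic Q (fun a => forall j, (j < s.+1)%N ->
    superficial Q (MD N j) a /\ hd (mquo (MD N j) a) <= hd (MD N j)).
  apply: generic_forall => j js; apply: generic_and; first exact: (generic_superficial H Q (MDf j fN)).
  by apply: (IH j) => //; [exact: MDf | exact: MDd].
apply: generic_weak (generic_and G1 G2) => a Qa [sa hj].
have kN := superficial_killed H Qm fN Qa sa.
have kj j : (j < s.+1)%N -> killed m (mker (MD N j) a).
  by move=> /hj[sj _]; apply: (superficial_killed H Qm (MDf j fN) Qa sj).
have dq := dim_le_mquo H kN dN; have [e1 e2] := hcoef_mquo H Qm fN dN Qa sa.
rewrite (hdeg_S fN dN dNs).
have gN := mker_len_gam fN kN.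
(* In dimension one [N / aN] has length [e_0 + l(0 :_N a)], while [hdeg N] is [e_0] plus the length
   of the torsion submodule, which contains [(0 :_N a)]. *)
case: s {IH G1 G2} dN dNs hj kj dq e1 e2 => [|s] dN dNs hj kj dq e1 e2.
  rewrite hdeg_0 //; last exact: mquo_fg.
  rewrite -(hcoef_dim0 (mquo_fg a fN) dq) e2 big_ord1 /= bin0 mul1r hdeg_MD0 // ?expr0 mul1r.
  by rewrite lerD2l.
have dqs : ~ dim_le (mquo N a) s by move/(dim_le_mquo_ge H Qm fN Qa).
rewrite (hdeg_S (mquo_fg a fN) dq dqs) e1 // lerD2l -(pascal_sum s (fun j => hd (MD N j))).
apply: ler_sum => -[j /= js] _; apply: ler_wpM2l => //.
case: j js => [|j] js.
  have [_ h1] := hj 1%N isT.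
  have := hdeg_MD_mquo0 fN kN (kj 1%N isT) h1; rewrite (hdeg_MD0 fN); lia.
by apply: hdeg_MD_mquo => //; [apply: kj; lia | apply: (hj _ _).2; lia].
Qed.
End HomologicalDegree.

(** * Dimension one and two *)

Section LengthInequalities.
Variable A : comNzRingType.
Implicit Types M N F : lmodType A.
Local Notation im M a := (imS (scal M a)).

Lemma ilen_addS1 M (S T U : submodule M) : S ≤ T -> flen S T ->
  flen (addS S U) (addS T U) /\ (ilen (addS S U) (addS T U) <= ilen S T)%N.
Proof.
move=> ST fl; have -> : addS T U = addS (addS S U) T.
  apply: sle_anti; first by apply: add_le; [apply: le_addr | move=> x Ux; apply/le_addl/le_addr].
  by apply: add_le; [apply: addS_mono | apply: le_addl].
have Sc : S ≤ capS (addS S U) T by move=> x Sx; split; [apply: le_addl | apply: ST].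
have cT : capS (addS S U) T ≤ T by move=> x [].
rewrite -ilen_diamond; split; last exact: ilen_mono fl Sc cT _.
by apply/flen_diamond; apply: flen_sub fl Sc cT _.
Qed.

Lemma ilen_addS M (S1 T1 S2 T2 : submodule M) : S1 ≤ T1 -> S2 ≤ T2 -> flen S1 T1 -> flen S2 T2 ->
  (ilen (addS S1 S2) (addS T1 T2) <= ilen S1 T1 + ilen S2 T2)%N.
Proof.
move=> h1 h2 f1 f2; have [g1 l1] := ilen_addS1 S2 h1 f1; have [g2 l2] := ilen_addS1 T1 h2 f2.
rewrite !(addSC _ T1) in g2 l2.
by rewrite (ilen_cat g1 g2) leq_add.
Qed.

Lemma pre_img M N (f : {linear M -> N}) (S : submodule M) : preS f (imgS f S) = addS S (kerS f).
Proof.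
apply: sle_anti => [x [s Ss /= E]|_ [s [k [Ss /= fk ->]]]].
  by exists s, (x - s); split=> //=; [rewrite linearB E subrr | rewrite addrC subrK].
by exists s; rewrite // linearD fk addr0.
Qed.

Lemma ilen_img M N (f : {linear M -> N}) (S T : submodule M) : S ≤ T -> flen S T ->
  flen (imgS f S) (imgS f T) /\ (ilen (imgS f S) (imgS f T) <= ilen S T)%N.
Proof.
move=> ST fl; have Tf : imgS f T ≤ imS f by move=> _ [x _ ->]; exists x.
have STf : imgS f S ≤ imgS f T by move=> _ [x Sx ->]; exists x => //; apply: ST.
have [h k] := ilen_addS1 (kerS f) ST fl.
by rewrite -(ilen_pre Tf STf) !pre_img; split=> //; apply/(flen_pre Tf STf); rewrite !pre_img.
Qed.

Lemma mquo2_len M (a b : A) :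
  (finl (mquo (mquo M a) b) <-> flen (addS (im M a) (im M b)) (topS M)) /\
  len (mquo (mquo M a) b) = ilen (addS (im M a) (im M b)) (topS M).
Proof.
pose p := compL (prj (im (mquo M a) b)) (prj (im M a)).
have po : onto p.
  by move=> y; have [z ->] := prj_onto _ y; have [x ->] := prj_onto _ z; exists x.
have -> : addS (im M a) (im M b) = kerS p; last exact: len_onto po.
apply: sle_anti => [x|x /prj0[z']].
  move=> [_ [_ [[u _ ->] [v _ ->] ->]]]; apply/prj0; exists (prj _ v) => //.
  rewrite -[RHS]/(b *: prj _ v) -linearZZ; apply/prjE; exists u => //.
  by rewrite -[scal M b v]/(b *: v) addrK.
have [z ->] := prj_onto _ z'; rewrite -[scal _ _ _]/(b *: _) -linearZZ => _ /prjE[u _ E].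
by exists (a *: u), (b *: z); split; [exists u | exists z | rewrite -[a *: u]E subrK].
Qed.

(** Multiplication by [c] identifies [cF / bcF] with [F / (bF + (0 :_F c))], whose length is at
    least [l(F / bF) - l(0 :_F c)]. *)
Lemma colon_len F (b c : A) : flen (im F (b * c)) (topS F) -> finl (mker F c) ->
  (ilen (im F b) (topS F) + ilen (im F c) (topS F) <=
   ilen (im F (b * c)) (topS F) + len (mker F c))%N.
Proof.
move=> fl fk; have bcc : im F (b * c) ≤ im F c.
  by move=> _ [x _ ->]; exists (b *: x); rewrite //= scalerA mulrC.
rewrite (ilen_add fl bcc) // addnAC leq_add2r.
have E : addS (im F (b * c)) (im F c) = im F c.
  by apply: sle_anti; [apply: add_le | apply: le_addr].
have pre : preS (scal F c) (im F (b * c)) = addS (im F b) (kerS (scal F c)).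
  apply: sle_anti => [x [y _ /= xE]|_ [_ [k [[y _ ->] /= ck ->]]]].
    exists (b *: y), (x - b *: y); split; [by exists y | | by rewrite addrC subrK].
    by rewrite /= scalerBr xE scalerA mulrC subrr.
  by exists y; rewrite //= scalerDr ck addr0 scalerA mulrC.
have h := ilen_ker (scal F c) (im F (b * c)); rewrite E pre in h.
have flb : flen (im F b) (topS F).
  apply: flen_sub fl _ _ _ => // _ [x _ ->].
  by exists (c *: x); rewrite //= scalerA.
rewrite (ilen_add flb (@le_addl _ _ _ (kerS (scal F c)))) // h addnC leq_add2l.
have [fk' ->] := len_smd (kerS (scal F c)).
rewrite -ilen_diamond; apply: ilen_mono (fk'.1 fk) _ _ _ => //; last by move=> x [].
exact: sle_bot.
Qed.

(** Multiplication by [a] maps [M / (a^k M + bM)] onto the quotient of [aM + bM] by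
    [a^(k+1) M + bM]. *)
Lemma im_exp_len M (a b : A) k : (forall n, flen (addS (im M (a ^+ n)) (im M b)) (topS M)) ->
  (ilen (addS (im M (a ^+ k)) (im M b)) (topS M) <=
   k * ilen (addS (im M a) (im M b)) (topS M))%N.
Proof.
move=> fl; elim: k => [|k IH].
  have -> : addS (im M (a ^+ 0)) (im M b) = topS M; last by rewrite ilen_refl.
  by apply: sle_anti => // x _; apply: le_addl; exists x; rewrite //= expr0 scale1r.
have le : im M (a ^+ k.+1) ≤ im M a.
  by move=> _ [x _ ->]; exists (a ^+ k *: x); rewrite //= scalerA exprS.
have le2 : addS (im M (a ^+ k.+1)) (im M b) ≤ addS (im M a) (im M b) by apply: addS_mono.
rewrite (ilen_add (fl _) le2) // mulSn addnC leq_add2l; apply: leq_trans IH.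
have -> : addS (im M a) (im M b) = addS (addS (im M (a ^+ k.+1)) (im M b)) (im M a).
  apply: sle_anti; last by apply: add_le => //; apply: le_addl.
  by apply: add_le; [apply: le_addr | move=> x bx; apply/le_addl/le_addr].
rewrite -ilen_ker; apply: ilen_mono (fl k) _ _ _ => //.
apply: add_le => _ [x _ ->].
  by apply: le_addl; exists x; rewrite //= scalerA exprS.
by apply: le_addr; exists (a *: x); rewrite //= !scalerA mulrC.
Qed.
End LengthInequalities.

(** * Exchanging generators of [Q] modulo an annihilator *)

Section SystemsOfGenerators.
Variables (A : comNzRingType) (m : submodClosed A^o) (H : noeth_local m).
Implicit Types M N F : lmodType A.
Implicit Types Q T : ideal A.
Local Notation mm := (ofS m).
Local Notation im M a := (imS (scal M a)).
Let noethA := nl_noeth H.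

(* The determinant trick. *)
Lemma prime_ann_mquo F (z : A) (p : ideal A) : fg (topS F) -> prime p -> annS F ≤ p -> p z ->
  annS (mquo F z) ≤ p.
Proof.
move=> [s sE] pp Fp pz b hb; apply: contrapT => pb.
have [y ys|c pc hc] := @nakayama_prime A p F s b pp pb.
  have : im F z (b *: y) by apply/prj0; rewrite linearZZ; apply: hb.
  by move=> [w _ ->]; apply: smulP => //; rewrite -sE.
by apply: pc; apply: Fp; apply: (@annS_seq _ F s c sE hc).
Qed.

Lemma mker_killed F (z : A) : fg (topS F) -> killed m (mquo F z) -> killed m (mker F z).
Proof.
move=> fF [r hr]; apply: (dim0_killed H (mker_fg H z fF)) => -[|k] G // [Gp Gl] aG.
have [le nle] := Gl 0%N isT; have G0 := Gp 0%N isT; case: nle => x G1x.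
apply: (prime_ipow (n := r) (I := mm) G0); last exact: (prime_le_mm H (Gp 1%N isT)).
move=> b mb; apply: (prime_ann_mquo fF G0) (hr b mb).
  by move=> c Fc; apply: aG => u; apply: inc_injective; rewrite linearZZ linear0 Fc.
by apply: aG => u; apply: inc_injective; rewrite linearZZ linear0; exact: (incP u).
Qed.

(** Write [a = c b + u + t] with [b] the first generator. If [c] is a unit, [a] replaces [b];
    otherwise [c b] lies in [m] times the generators, and by induction [a - c b] replaces one of the
    others. *)
Lemma exchange (l : seq A^o) (a : A^o) T : addS (seqS l) T a -> ~ addS (smul mm (seqS l)) T a ->
  exists l' : seq A^o, [/\ (size l').+1 = size l, {subset l' <= l} &
    seqS l ≤ addS (seqS l') (addS (seqS [:: a]) T)].
Proof.
elim: l a => [|b l IH] a.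
  move=> [u [t []]]; rewrite {1}seqS_nil => -> Tt -> na; case: na; rewrite add0r.
  exact: le_addr.
rewrite {1}seqS_cons => -[_ [t [[_ [u [/seq1P[c ->] lu ->]] Tt aE]]]] na.
case: (pselect (mm c)) => mc; last first.
  have [d dc] := unit_mm H mc; exists l; split=> //; first by move=> x xl; rewrite inE xl orbT.
  rewrite seqS_cons; apply: add_le; last exact: le_addl.
  apply: span_le => y; rewrite inE => /eqP->.
  have -> : b = d * (a - t - u).
    have -> : a - t - u = c * b by rewrite aE addrK addrK.
    by rewrite mulrA dc mul1r.
  apply: (subZ (S := addS (seqS l) (addS (seqS [:: a]) T))); apply: subB; last exact: le_addl.
  apply: le_addr; apply: subB; last exact: le_addr.
  by apply: le_addl; apply: spanP; rewrite inE.
have bl : smul mm (seqS [:: b]) (c *: (b : A^o)) by apply: smulP => //; apply: spanP; rewrite inE.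
have [||l' [sl' ll' le]] := IH (u + t).
- by exists u, t.
- move=> [v [t' [hv Tt' E]]]; apply: na; exists (c *: (b : A^o) + v), t'; split=> //.
    apply: subD; first by apply: smul_mono bl => //; rewrite (seqS_cons b l); apply: le_addl.
    by apply: smul_mono hv => //; rewrite (seqS_cons b l); apply: le_addr.
  by rewrite aE -!addrA; congr (_ + _).
exists (b :: l'); split=> /=; first by rewrite sl'.
  by move=> x; rewrite !inE => /orP[->//|/ll' ->]; rewrite orbT.
rewrite (seqS_cons b l) (seqS_cons b l'); apply: add_le.
  by move=> x hx; apply/le_addl/le_addl.
apply: (sle_trans le); apply: add_le; first by move=> x hx; apply/le_addl/le_addr.
apply: add_le; last by move=> x hx; apply/le_addr/le_addr.
apply: span_le => y; rewrite inE => /eqP->.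
have -> : u + t = a - c *: (b : A^o) by apply/eqP; rewrite eq_sym subr_eq aE -addrA addrC.
apply: subB; first by apply/le_addr/le_addl/spanP; rewrite inE.
by apply/le_addl/le_addl/subZ/spanP; rewrite inE.
Qed.

(** Working modulo [annS M] makes the condition pass to quotients of [M], and lets [s] drop by one
    on [mquo M a], where [a] acts as zero. *)
Definition param Q s M := exists l : seq A^o,
  [/\ size l = s, forall x, x \in l -> Q x & Q ≤ addS (seqS l) (annS M)].

Lemma param_onto Q s M N (p : {linear M -> N}) : onto p -> param Q s M -> param Q s N.
Proof.
move=> po [l [sl lQ Ql]]; exists l; split=> //; apply: (sle_trans Ql).
apply: addS_mono => // a Ma y; have [x ->] := po y.
by rewrite -linearZZ Ma linear0.
Qed.

Lemma mquo_ann M (a : A) : annS (mquo M a) a.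
Proof.
by move=> y; have [x ->] := prj_onto _ y; rewrite -linearZZ; apply/prj0; exists x.
Qed.

(** If [Q] were contained in [m (l) + Ann M], then [QM ≤ m QM], so [QM = 0] and a power of [m] would
    kill [M]. Hence a generic [a] lies outside and can be exchanged against one of the
    generators. *)
Lemma generic_param Q s M : fg (topS M) -> mprimary m Q -> ~ killed m M ->
  param Q s.+1 M -> generic Q (fun a => param Q s (mquo M a)).
Proof.
move=> fM Qm nk [l [sl lQ Ql]].
have lQ' : seqS l ≤ Q by apply: span_le.
have out : exists2 x, Q x & ~ addS (smul mm (seqS l)) (annS M) x.
  apply: contrapT => h; apply: nk.
  have QM : smul Q (topS M) = botS M.
    apply: (nakayama H); first exact: (le_fg noethA fM).
    apply: smul_le => a x Qa _.
    have [u [t [hu ht ->]]] : addS (smul mm (seqS l)) (annS M) a.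
      by apply: contrapT => na; apply: h; exists a.
    rewrite scalerDl ht addr0.
    suff : smul mm (seqS l) ≤ preS (actL x) (smul mm (smul Q (topS M))) by apply.
    apply: smul_le => b c mb /lQ' Qc; rewrite /= -scalerA.
    by apply: smulP => //; apply: smulP.
  have [r hr] := Qm.2; exists r => a /hr Qa x.
  by have : smul Q (topS M) (a *: x); [apply: smulP | rewrite QM].
apply: generic_weak (generic_out out) => a Qa na.
have [l' [sl' ll' le]] := exchange (Ql _ Qa) na.
exists l'; split.
- by apply: succn_inj; rewrite sl' sl.
- by move=> x /ll'/lQ.
have Ma : annS M ≤ annS (mquo M a).
  by move=> b Mb y; have [x ->] := prj_onto _ y; rewrite -linearZZ Mb linear0.
apply: (sle_trans Ql); apply: add_le; last by move=> b /Ma; apply: le_addr.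
apply: (sle_trans le); apply: addS_mono => //; apply: add_le => //.
by apply: span_le => y; rewrite inE => /eqP->; apply: mquo_ann.
Qed.

Lemma param1P Q M : param Q 1 M ->
  exists2 y : A, Q y & forall (a : A) (z : M), Q a -> exists w, a *: z = y *: w.
Proof.
move=> [[|y [|? ?]] [//= _ lQ Ql]]; exists y; first by apply: lQ; rewrite inE.
move=> a z /Ql[_ [t [/seq1P[c ->] ht ->]]]; exists (c *: z).
by rewrite scalerDl ht addr0 scalerA mulrC.
Qed.
End SystemsOfGenerators.

Section LowDimension.
Variables (A : comNzRingType) (m : submodClosed A^o) (H : noeth_local m).
Implicit Types M N L F : lmodType A.
Local Notation MD := (matlis_dual_cohomology m).
Local Notation im M a := (imS (scal M a)).
Let noethA := nl_noeth H.
Variables (I : submodClosed A^o).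
Local Notation Q := (ofS I).
Hypothesis Qm : mprimary m Q.

Lemma hp1E e n : hp 1 e n = e 0%N * n.+1%:Z - e 1%N.
Proof.
elim: n => [|n IH]; last by have := hpS 0 e n; rewrite hp0; lia.
rewrite hp_last big_ord1; have -> : 'C(0 + 1 - @ord0 0, 1 - @ord0 0) = 1%N by [].
by rewrite /= expr0 expr1; lia.
Qed.
(** Doubled to clear the denominator of the binomial coefficient. *)
Lemma hp2E e n : hp 2 e n * 2 =
  e 0%N * (n.+2 * n.+1)%:Z - e 1%N * (2 * n.+1)%:Z + e 2%N * 2.
Proof.
elim: n => [|n IH]; last by have := hpS 1 e n; rewrite hp1E; lia.
rewrite hp_last !big_ord_recl big_ord0; have -> : 'C(0 + 2 - @ord0 1, 2 - @ord0 1) = 1%N by [].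
have -> : 'C(0 + 2 - lift ord0 (@ord0 0), 2 - lift ord0 (@ord0 0)) = 1%N by [].
by rewrite /= /bump /= addn0 expr0 expr1 sqrrN expr1n; lia.
Qed.

Section DimOne.
Variables (N : lmodType A) (y : A).
Hypotheses (fN : fg (topS N)) (dN : dim_le N 1) (Qy : Q y).
Hypothesis Ny : forall (a : A) (z : N), Q a -> exists w, a *: z = y *: w.

Lemma ipow_img n : ipow Q N n.+1 = imgS (scal N y) (ipow Q N n).
Proof.
elim: n => [|n IH]; last by rewrite ipowS {1}IH -img_smul.
apply: sle_anti => [|_ [w _ ->]]; last exact: ipowM.
by apply: smul_le => a z Qa _; have [w ->] := Ny z Qa; exists w.
Qed.

Lemma ipow_exp n : ipow Q N n = im N (y ^+ n).
Proof.
elim: n => [|n IH].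
  by apply: sle_anti => // x _; exists x; rewrite //= expr0 scale1r.
rewrite ipow_img IH; apply: sle_anti => [_ [_ [w _ ->] ->]|_ [w _ ->]].
  by exists w; rewrite //= scalerA exprS.
by exists (y ^+ n *: w); [exists w | rewrite /= scalerA exprS].
Qed.

(* [l(y^n N / y^(n+1) N)] is nonincreasing in [n] and eventually equal to [e_0]. *)
Lemma hsf_dim1 n : (hsf Q N n)%:Z <= hcoef I 1 N 0 * n%:Z - hcoef I 1 N 1.
Proof.
pose dl n := ilen (ipow Q N n.+1) (ipow Q N n).
have step k : hsf Q N k.+1 = (dl k + hsf Q N k)%N.
  by apply: ilen_add => //; [exact: (flen_ipow H Qm) | exact: ipow_le].
have dec k : (dl k.+1 <= dl k)%N.
  rewrite /dl ipow_img [in X in ilen _ X]ipow_img.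
  have le : ipow Q N k.+1 ≤ ipow Q N k by apply: ipow_le.
  by have [] := ilen_img (scal N y) le (flen_sub (flen_ipow H Qm k.+1 fN) (@sle_refl _ _ _) le (fun _ _ => Logic.I)).
have decn k j : (dl (k + j) <= dl k)%N.
  by elim: j => [|j IH]; rewrite ?addn0 // addnS; apply: leq_trans (dec _) IH.
have [K hK] := hcoefP H Qm fN dN.
have dl0 k : hcoef I 1 N 0 <= (dl k)%:Z.
  have h1 := decn k K.+1; have h2 := step (k + K.+1)%N.
  have h3 := hK (k + K)%N (leq_addl _ _); have h4 := hK (k + K).+1 (leqW (leq_addl _ _)).
  move: h1 h2; rewrite !addnS; rewrite !hp1E in h3 h4; lia.
have up k : (hsf Q N n)%:Z + hcoef I 1 N 0 * k%:Z <= (hsf Q N (n + k))%:Z.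
  elim: k => [|k IH]; first by rewrite addn0 mulr0 addr0.
  have := dl0 (n + k)%N; have := step (n + k)%N; rewrite addnS; lia.
have h3 := hK (n + K)%N (leq_addl _ _); have := up K.+1.
rewrite addnS hp1E in h3 *; lia.
Qed.
End DimOne.

Lemma gen_pow L (c b : A) k : (exists r, ipow Q L r ≤ addS (im L c) (im L b)) ->
  exists r, ipow Q L r ≤ addS (im L (c ^+ k)) (im L b).
Proof.
move=> [r0 h0]; elim: k => [|k [r hr]].
  by exists 0%N => x _; apply: le_addl; exists x; rewrite //= expr0 scale1r.
exists (r + r0)%N; rewrite ipow_smul; apply: smul_le => a z Qa /h0[_ [_ [[u _ ->] [v _ ->] ->]]].
have [_ [_ [[u' _ ->] [v' _ ->] E]]] : addS (im L (c ^+ k)) (im L b) (a *: u).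
  by apply: hr; rewrite ipowE; apply: smulP.
exists (c ^+ k.+1 *: u'), (b *: (c *: v' + a *: v)); split; [by exists u' | by eexists | ].
rewrite /= !scalerDr !scalerA [a * c]mulrC -(scalerA c a) E /= scalerDr !scalerA -exprS.
by rewrite -!addrA [c * b]mulrC [a * b]mulrC.
Qed.

Section DimTwo.
Variables (L : lmodType A) (x y : A).
Hypotheses (fL : fg (topS L)) (dL : dim_le L 2) (tL : forall z : L, tors m z -> z = 0).
Hypotheses (Qx : Q x) (Qy : Q y) (sx : superficial Q L x).
Hypothesis Ly : forall (a : A) (z : mquo L x), Q a -> exists w, a *: z = y *: w.
Local Notation e := (hcoef I 2 L).

Let kx : killed m (mker L x). Proof. exact: (superficial_killed H Qm fL Qx sx). Qed.
Let x_reg (z : L) : x *: z = 0 -> z = 0.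
Proof.
move=> xz; apply: tL; have [u ->] : exists u : mker L x, z = inc _ u by apply: inc_onto.
by apply: tors_lin; apply: killed_torsion.
Qed.
Let xn_reg n (z : L) : x ^+ n *: z = 0 -> z = 0.
Proof.
elim: n z => [|n IH] z; first by rewrite expr0 scale1r.
by rewrite exprSr -scalerA => /IH/x_reg.
Qed.
Let len_mker n : len (mker L (x ^+ n)) = 0%N.
Proof.
apply: (zero_finl _).2 => u; apply: inc_injective; rewrite linear0; apply: (@xn_reg n).
exact: (incP u).
Qed.
Let fN1 : fg (topS (mquo L x)). Proof. exact: mquo_fg. Qed.
Let dN1 : dim_le (mquo L x) 1. Proof. exact: (dim_le_mquo H kx dL). Qed.

Let hN1 n : (hsf Q (mquo L x) n)%:Z <= e 0%N * n%:Z - e 1%N.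
Proof.
have [e0 e1] := hcoef_mquo H Qm fL dL Qx sx.
have := hsf_dim1 fN1 dN1 Qy Ly n; rewrite e0 // e1 -{2}[x]expr1 len_mker; lia.
Qed.

Let e1_le0 : e 1%N <= 0.
Proof. by have := hN1 0%N; rewrite /hsf ilen_refl; lia. Qed.

(** The polynomial [hp 2 e n - e_2] is the sum of [e_0 t - e_1] for [t] from 1 to [n + 1], which
    bounds [l(L / Q^(n+1) L)]; for large [n] the latter is [hp 2 e n]. *)
Lemma hcoef2_le0 : e 2%N <= 0.
Proof.
have up n : (hsf Q L n.+1)%:Z <= hp 2 e n - e 2%N.
  elim: n => [|n IH].
    have h1 := hsf_step_le H Qm 0 fL Qx; have h2 := hN1 1%N; have h3 := hp2E e 0.
    move: h1; rewrite {2}/hsf ilen_refl; lia.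
  have h1 := hsf_step_le H Qm n.+1 fL Qx; have h2 := hN1 n.+2; have h3 := hpS 1 e n.
  rewrite hp1E in h3; lia.
have [K hK] := hcoefP H Qm fL dL.
by have := up K; rewrite hK //; lia.
Qed.

Let gen_xy k l : exists r, ipow Q L r ≤ addS (im L (x ^+ k)) (im L (y ^+ l)).
Proof.
apply: gen_pow; rewrite addSC; apply: gen_pow; exists 1%N.
apply: smul_le => a z Qa _; have [w' E] := Ly (prj _ z) Qa.
have [w wE] := prj_onto _ w'; move: E; rewrite wE -!linearZZ => /prjE[u _ E].
by exists (y *: w), (x *: u); split; [exists w | exists u | rewrite -[x *: u]E addrC subrK].
Qed.
Let fl_xy k l : flen (addS (im L (x ^+ k)) (im L (y ^+ l))) (topS L).
Proof. by have [r hr] := gen_xy k l; apply: (flen_ge_ipow H Qm fL hr). Qed.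

Let g k l := ilen (addS (im L (x ^+ k)) (im L (y ^+ l))) (topS L).

Let kF k l : killed m (mker (mquo L (x ^+ k)) (y ^+ l)).
Proof.
apply: (mker_killed H (mquo_fg _ fL)); have [r hr] := gen_xy k l.
have [R hR] := mprimary_ipow r Qm; exists R => a ma z'.
have [z'' ->] := prj_onto _ z'; have [z ->] := prj_onto _ z''.
have [_ [_ [[u _ ->] [v _ ->] E]]] : addS (im L (x ^+ k)) (im L (y ^+ l)) (a *: z).
  by apply/hr/hR; rewrite ipowE; apply: smulP.
rewrite -!linearZZ E; apply/prj0; exists (prj _ v) => //.
rewrite -[RHS]/(y ^+ l *: prj _ v) -linearZZ; apply/prjE; exists u => //.
by rewrite -[scal L _ v]/(y ^+ l *: v) addrK.
Qed.

(** At most [k] times [l(L / (xL + y^t L))], which is a value of the Hilbert function of [L / xL],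
    since [Q^t] acts on that module as [y^t] does. *)
Let g_le k t : (g k t)%:Z <= k%:Z * (e 0%N * t%:Z - e 1%N).
Proof.
have h1 := @im_exp_len A L x (y ^+ t) k (fun n => fl_xy n t).
have [_ h2] := mquo2_len L x (y ^+ t).
have h3 := hN1 t; rewrite /hsf (ipow_exp Qy Ly) in h3.
have [_ h4] := len_qmod (im (mquo L x) (y ^+ t)); rewrite -/(mquo _ _) h2 in h4.
rewrite -h4 in h3; apply: le_trans (_ : (k * _)%N%:Z <= _); first exact: h1.
by rewrite PoszM; apply: ler_wpM2l.
Qed.

(* With [F = L / x^l L] and [h t = l(F / y^t F)], each step [t -> t + l] raises [h] by at least
   [h l - l(0 :_F y^l)], while [h t] grows at most like [l e_0 t]. *)
Let g_diag l : (g l l)%:Z <= l%:Z * l%:Z * e 0%N + (len (mker (mquo L (x ^+ l)) (y ^+ l)))%:Z.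
Proof.
set F := mquo L (x ^+ l); set kap := len _.
have gE t : g l t = ilen (im F (y ^+ t)) (topS F).
  by rewrite /g; have [_ <-] := mquo2_len L (x ^+ l) (y ^+ t); case: (len_qmod (im F (y ^+ t))).
have flF t : flen (im F (y ^+ t)) (topS F).
  have [h _] := mquo2_len L (x ^+ l) (y ^+ t); have [h' _] := len_qmod (im F (y ^+ t)).
  by apply/h'/h; apply: fl_xy.
have fk : finl (mker F (y ^+ l)).
  by apply: (killed_finl H (mker_fg H _ (mquo_fg _ fL)) (kF l l)).
have step t : (g l t + g l l <= g l (t + l) + kap)%N.
  by rewrite !gE exprD; apply: colon_len => //; rewrite -exprD.
have h n : (n * g l l <= g l (n * l) + n * kap)%N.
  elim: n => [|n IH]; first by rewrite !mul0n.
  have := step (n * l)%N; rewrite addnC -mulSnr; lia.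
rewrite leNgt; apply/negP => lt.
have h4 : l%:Z * e 1%N <= 0 by apply: mulr_ge0_le0.
(* If the bound fails, [h] and [g_le] give [n (l^2 e_0 + kap + 1) <= l (e_0 n l - e_1) + n kap],
   that is [n <= - l e_1], which this [n] violates. *)
have [n h5] : exists n : nat, n%:Z = 1 - l%:Z * e 1%N.
  by exists (absz (1 - l%:Z * e 1%N)%R); lia.
have h1 := h n; have h2 := g_le l (n * l).
have h3 : n%:Z * (l%:Z * l%:Z * e 0%N + kap%:Z + 1) <= n%:Z * (g l l)%:Z.
  by apply: ler_wpM2l => //; lia.
rewrite PoszM in h2.
have h6 : n%:Z * (g l l)%:Z <= l%:Z * (e 0%N * (n%:Z * l%:Z) - e 1%N) + n%:Z * kap%:Z by lia.
have := le_trans h3 h6; clear -h5; nia.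
Qed.

(* [Q^(2k+1) L] contains [x^(k+1) Q^k L + y^(k+1) Q^k L], and these two submodules are images
   of [Q^k L]. *)
Let hsf_split k : (hsf Q L (k.+1 + k) <= g k.+1 k.+1 + 2 * hsf Q L k)%N.
Proof.
pose S c := imgS (scal L c) (ipow Q L k); pose W := addS (S (x ^+ k.+1)) (S (y ^+ k.+1)).
have Qn (c : A) n : Q c -> ipow Q A^o n (c ^+ n).
  by move=> Qc; elim: n => [|n IH] //; rewrite exprS; apply: (ipowM (M := A^o)).
have WQ : W ≤ ipow Q L (k.+1 + k).
  by apply: add_le => _ [z Qz ->]; apply: ipowZ => //; apply: Qn.
have [r hr] := gen_xy k.+1 k.+1.
have QW : ipow Q L (k + r) ≤ W.
  rewrite ipow_smul; apply: smul_le => a z Qa /hr[_ [_ [[u _ ->] [v _ ->] ->]]].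
  rewrite scalerDr -[scal _ _ u]/(x ^+ k.+1 *: u) -[scal _ _ v]/(y ^+ k.+1 *: v).
  exists (x ^+ k.+1 *: (a *: u)), (y ^+ k.+1 *: (a *: v)); split.
  - by exists (a *: u) => //; rewrite ipowE; apply: smulP.
  - by exists (a *: v) => //; rewrite ipowE; apply: smulP.
  - by rewrite !scalerA ![a * _]mulrC.
have flW : flen W (topS L) by apply: (flen_ge_ipow H Qm fL QW).
apply: (@leq_trans (ilen W (topS L))); first exact: ilen_mono flW WQ _ _.
have le c : S c ≤ im L c by move=> _ [z _ ->]; exists z.
rewrite (ilen_add flW (T := addS (im L (x ^+ k.+1)) (im L (y ^+ k.+1)))) //; last exact: addS_mono.
rewrite addnC leq_add2l mul2n -addnn.
have t c := ilen_img (scal L c) (fun _ _ => Logic.I : topS L _) (flen_ipow H Qm k fL).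
have [f1 l1] := t (x ^+ k.+1); have [f2 l2] := t (y ^+ k.+1).
by apply: leq_trans (ilen_addS (le _) (le _) f1 f2) (leq_add l1 l2).
Qed.

(** With [k = K + 1] and [l = k + 1] one has [hp 2 e (2k) - 2 hp 2 e (k - 1) = l^2 e_0 - e_1 - e_2]:
    this is why [hsf_split] compares [Q^(2k+1)] with twice [Q^k]. Bounding [g l l] by [g_diag]
    leaves [e_2 >= - e_1 - l(0 :_F y^l)], and [e_1 <= 0]. The last length is at most that of
    [gam F], which is [l(L_1 / x^l L_1)] because [x^l] is regular. *)
Lemma hcoef2_ge : finl (MD L 1) -> - (len (MD L 1))%:Z <= e 2%N.
Proof.
move=> fD; have [K hK] := hcoefP H Qm fL dL.
pose l := K.+2; pose F := mquo L (x ^+ l).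
have kl : killed m (mker L (x ^+ l)).
  exists 0%N => a _ u; apply: inc_injective; rewrite linear0; apply: (@xn_reg l).
  exact: (incP (a *: u)).
have h1 : (len (mker F (y ^+ l)) <= len (MD L 1))%N.
  apply: leq_trans (mker_len_gam H (mquo_fg _ fL) (kF l l)) _.
  rewrite (gam_mquo_len H fL kl) len_mker addn0.
  by case: (finl_onto (prj_onto (im (MD L 1) (x ^+ l))) fD).
have h2 := g_diag l; rewrite -/F in h2.
have h3 := hsf_split K.+1.
have h4 := hK K (leqnn _).
have h5 : (hsf Q L (K.+2 + K.+1))%:Z = hp 2 e (K + K).+2.
  by rewrite -hK ?addSn ?addnS //; lia.
have h6 := hp2E e K; have h7 := hp2E e (K + K).+2; have h8 := e1_le0.
rewrite -/l in h3; move: h2 h3; set gg := g l l; set kap := len (mker F _) in h1 *.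
rewrite /l in h1 *; move=> h2 h3.
nia.
Qed.
End DimTwo.

(** By Artin-Rees, [gam N] meets [Q^n N] in 0 for large [n], so the two Hilbert functions differ by
    the constant [l(gam N)], which enters only the last coefficient. *)
Lemma hcoef_bar s N : fg (topS N) -> dim_le N s ->
  hcoef I s N s = hcoef I s (bar m N) s + (-1) ^+ s * (len (gam m N))%:Z.
Proof.
move=> fN dN; have fB := bar_fg m fN; have dB : dim_le (bar m N) s by apply: dim_le_onto (prj_onto _) dN.
set e := hcoef I s (bar m N).
suff h : hilb I s N (fun i => if i == s then e s + (-1) ^+ s * (len (gam m N))%:Z else e i).
  by rewrite (hcoefE h) ?eqxx.
have [K hK] := hcoefP H Qm fB dB.
have [r hr] := gam_killed H fN; have [c hc] := artin_rees noethA Q (torsS m N) fN.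
have bot n : (c + r <= n)%N -> capS (ipow Q N n) (torsS m N) = botS N.
  move=> cn; apply: sle_anti; last exact: sle_bot.
  move=> z [/(ipow_le cn) Qz tz]; have : smul (ipow Q A^o r) (torsS m N) z by apply: hc.
  suff le : smul (ipow Q A^o r) (torsS m N) ≤ botS N by move/le.
  apply: smul_le => a w /(ipow_mono Qm.1) ma tw; have [u ->] := inc_onto tw.
  by rewrite -[botS N _]/(_ = 0) -linearZZ hr // linear0.
exists (maxn K (c + r)) => n; rewrite geq_max => /andP[Kn cn].
have E : hsf Q N n.+1 = (len (gam m N) + hsf Q (bar m N) n.+1)%N.
  rewrite (hsf_onto _ _ (prj_onto (torsS m N))); have [_ ->] := len_smd (torsS m N).
  have -> : kerS (prj (torsS m N)) = torsS m N by apply: subm_eq => z; apply: prj0.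
  rewrite /hsf (ilen_add (flen_ipow H Qm n.+1 fN) (@le_addl _ _ _ (torsS m N))) //.
  by rewrite -ilen_diamond bot // leqW.
rewrite E PoszD hK // !hp_last eqxx mulrDr mulrA -expr2 sqrr_sign mul1r addrC addrA.
by congr (_ + _ + _); apply: eq_bigr => -[i /= lis] _; rewrite ltn_eqF.
Qed.

Lemma hcoef2_bounds N : fg (topS N) -> dim_le N 2 -> ~ killed m N -> param Q 2 N ->
  hcoef I 2 N 2 <= (len (gam m N))%:Z /\
  (finl (MD N 1) -> (len (gam m N))%:Z - (len (MD N 1))%:Z <= hcoef I 2 N 2).
Proof.
move=> fN dN nk pN; pose L := bar m N; have fL : fg (topS L) by apply: bar_fg.
have dL : dim_le L 2 by apply: dim_le_onto (prj_onto _) dN.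
have nkL : ~ killed m L.
  move=> kL; apply: nk; apply: killed_ext (inc (torsS m N)) (prj _) _ (gam_killed H fN) kL.
  by move=> z /prj0/inc_onto.
have tL z : tors m z -> z = 0 :> L by move=> tz; apply: (bar_torsionfree H).
have pL : param Q 2 L by apply: param_onto (prj_onto _) pN.
have [x Qx [sx px]] := generic_ex H (generic_and (generic_superficial H Q fL)
  (generic_param H fL Qm nkL pL)).
have [y Qy Ly] := param1P px.
have h1 := hcoef2_le0 fL dL tL Qx Qy sx Ly.
have h2 := hcoef2_ge fL dL tL Qx Qy sx Ly.
have [fi li] := len_isom (MD_bar H N 0).
rewrite (hcoef_bar fN dN) -/L sqrrN expr1n mul1r; split; first lia.
by move=> /fi/h2; rewrite li; lia.
Qed.
End LowDimension.

(** * The second Hilbert coefficient *)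

Section SecondCoefficient.
Variables (A : comNzRingType) (m : submodClosed A^o) (H : noeth_local m).
Hypothesis C : adically_complete m.
Variable (d0 : nat).
Hypothesis dA : dim_le A^o d0.
Implicit Types M N : lmodType A.
Local Notation MD := (matlis_dual_cohomology m).
Variables (I : submodClosed A^o).
Local Notation Q := (ofS I).
Hypothesis Qm : mprimary m Q.
Local Notation hd := (hdeg m I).
Local Notation MDd := (MD_dim H C).
Local Notation MDf := (MD_fg H C).

Section Step.
Variables (M : lmodType A) (s : nat).
Hypotheses (fM : fg (topS M)) (dM : dim_le M s.+1) (ndM : ~ dim_le M s) (pM : param Q s.+1 M).

Lemma good_element n : exists a : A, [/\ Q a, superficial Q M a, param Q s (mquo M a) &
  forall j, (j < n)%N -> killed m (mker (MD M j) a) /\ hd (mquo (MD M j) a) <= hd (MD M j)].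
Proof.
have nk : ~ killed m M by move=> /(killed_dim0 H)/(dim_le_mono (leq0n s)).
have G1 := generic_superficial H Q fM; have G2 := generic_param H fM Qm nk pM.
have G3 : generic Q (fun a => forall j, (j < n)%N ->
    superficial Q (MD M j) a /\ hd (mquo (MD M j) a) <= hd (MD M j)).
  apply: generic_forall => j _; apply: generic_and.
    exact: (generic_superficial H Q (MDf j fM)).
  exact: (generic_hdeg H C dA Qm (MDf j fM)).
have [a Qa [[sa pa] ha]] := generic_ex H (generic_and (generic_and G1 G2) G3).
exists a; split=> // j /ha[sj hj]; split=> //.
exact: (superficial_killed H Qm (MDf j fM) Qa sj).
Qed.

Lemma mquo_dim (a : A) : Q a -> superficial Q M a ->
  [/\ killed m (mker M a), dim_le (mquo M a) s & forall t, (t < s)%N -> ~ dim_le (mquo M a) t].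
Proof.
move=> Qa sa; have kM := superficial_killed H Qm fM Qa sa.
split=> //; first exact: (dim_le_mquo H kM dM).
by move=> t ts /(dim_le_mquo_ge H Qm fM Qa)/(dim_le_mono ts).
Qed.
End Step.

Lemma hcoef2_le k M : fg (topS M) -> dim_le M k.+3 -> ~ dim_le M k.+2 -> param Q k.+3 M ->
  hcoef I k.+3 M 2 <= \sum_(i < k.+1) 'C(k, i)%:Z * hd (MD M i.+1).
Proof.
elim: k M => [|k IH] M fM dM ndM pM.
  have [a [Qa sa pa ha]] := good_element fM ndM pM 3.
  have [kM dN ndN] := mquo_dim fM dM ndM Qa sa.
  have [_ e2] := hcoef_mquo H Qm fM dM Qa sa; rewrite sqrrN expr1n mul1r in e2.
  have nk : ~ killed m (mquo M a) by move=> /(killed_dim0 H); apply: ndN.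
  have [h1 _] := hcoef2_bounds H Qm (mquo_fg a fM) dN nk pa.
  have [k1 h2] := ha 1%N isT; rewrite (gam_mquo_len H fM kM) in h1.
  rewrite (hdeg_0 H I (mquo_fg a (MDf 1 fM)) (dim_le_mquo H k1 (MDd fM))) in h2.
  rewrite big_ord1 /= bin0 mul1r; lia.
have [a [Qa sa pa ha]] := good_element fM ndM pM k.+4.
have [kM dN ndN] := mquo_dim fM dM ndM Qa sa.
have [e2 _] := hcoef_mquo H Qm fM dM Qa sa.
rewrite -(e2 2%N) //; apply: le_trans (IH _ (mquo_fg a fM) dN (ndN _ (ltnSn _)) pa) _.
rewrite -(pascal_sum k (fun i => hd (MD M i.+1))); apply: ler_sum => -[i /= ik] _.
apply: ler_wpM2l => //; apply: (hdeg_MD_mquo H C dA Qm fM kM).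
  by apply: (ha _ _).1; lia.
by apply: (ha _ _).2; lia.
Qed.

Lemma hcoef2_lower k M : fg (topS M) -> dim_le M k.+3 -> ~ dim_le M k.+2 -> param Q k.+3 M ->
  (forall j, (j < k.+2)%N -> dim_le (MD M j.+1) j) ->
  - (\sum_(i < k.+1) 'C(k, i)%:Z * hd (MD M i.+2)) <= hcoef I k.+3 M 2.
Proof.
elim: k M => [|k IH] M fM dM ndM pM cM.
  have [a [Qa sa pa ha]] := good_element fM ndM pM 3.
  have [kM dN ndN] := mquo_dim fM dM ndM Qa sa.
  have [_ e2] := hcoef_mquo H Qm fM dM Qa sa; rewrite sqrrN expr1n mul1r in e2.
  have nk : ~ killed m (mquo M a) by move=> /(killed_dim0 H); apply: ndN.
  have [_ h1] := hcoef2_bounds H Qm (mquo_fg a fM) dN nk pa.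
  have [k1 _] := ha 1%N isT; have [k2 h2] := ha 2%N isT.
  have fin1 : finl (MD M 1).
    by apply: (killed_finl H (MDf 1 fM)); apply: (dim0_killed H (MDf 1 fM)); apply: cM.
  have d2 : dim_le (mquo (MD M 2) a) 0 by apply: (dim_le_mquo H k2); apply: cM.
  have f2 := mquo_fg a (MDf 2 fM).
  rewrite (hdeg_0 H I f2 d2) in h2.
  have fin2 := killed_finl H f2 (dim0_killed H f2 d2).
  have [i [p [ii po ip]]] := MD_section H fM kM 0.
  have [fN lN] := len_exact ii po ip.
  have fk := killed_finl H (mker_fg H a (MDf 1 fM)) k1.
  have finN : finl (MD (mquo M a) 1) by apply/fN.
  (* As [M_1] has finite length, [l(0 :_(M_1) a) = l(M_1 / a M_1)]; this term of [l(N_1)] cancels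
     against the same one in [l(gam N)], and so does [l(0 :_M a)]. *)
  have := h1 finN; rewrite (gam_mquo_len H fM kM) lN // (len_mquo_mker a fin1).
  rewrite big_ord1 /= bin0 mul1r; lia.
have [a [Qa sa pa ha]] := good_element fM ndM pM k.+4.
have [kM dN ndN] := mquo_dim fM dM ndM Qa sa.
have [e2 _] := hcoef_mquo H Qm fM dM Qa sa.
rewrite -(e2 2%N) //.
(* The dual in degree [j + 1] of [M / aM] contains [M_(j+2) / a M_(j+2)] with a cokernel killed by a
   power of [m], and the cut brings [dim M_(j+2) <= j + 1] down to [j]. *)
have cN j : (j < k.+2)%N -> dim_le (MD (mquo M a) j.+1) j.
  move=> jk; have [i [p [ii po ip]]] := MD_section H fM kM j.
  have [kj _] := ha j.+1 (leqW jk); have [kj2 _] := ha j.+2 jk.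
  have dq : dim_le (mquo (MD M j.+2) a) j by apply: (dim_le_mquo H kj2); apply: cM.
  exact: (dim_le_ext H (ext_cokernel ip kj) dq).
apply: le_trans (IH _ (mquo_fg a fM) dN (ndN _ (ltnSn _)) pa cN).
rewrite lerN2 -(pascal_sum k (fun i => hd (MD M i.+2))); apply: ler_sum => -[i /= ik] _.
apply: ler_wpM2l => //; apply: (hdeg_MD_mquo H C dA Qm fM kM).
  by apply: (ha _ _).1; lia.
by apply: (ha _ _).2; lia.
Qed.
End SecondCoefficient.

(** * Unmixed modules and the dimensions of their duals *)

Section Unmixed.
Variables (A : comNzRingType) (m : submodClosed A^o) (H : noeth_local m).
Hypothesis C : adically_complete m.
Implicit Types M N : lmodType A.
Local Notation mm := (ofS m).
Local Notation MD := (matlis_dual_cohomology m).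
Let noethA := nl_noeth H.

Lemma prime_annihilator M (J : ideal A) (z : M) : z <> 0 -> J ≤ kerS (actL z) ->
  exists z' : M, J ≤ kerS (actL z') /\ prime (kerS (actL z')).
Proof.
move=> z0 Jz.
have [|T _||P [z' [z'0 Jz' PE]] Pmax] := @acc_sup _ _ (topS A^o)
  (fun T => exists z' : M, [/\ z' <> 0, J ≤ kerS (actL z') & T = kerS (actL z')]).
- exact: (fg_acc noethA (ideal_fg noethA _)).
- by [].
- by exists (kerS (actL z)), z.
exists z'; split=> //; split; first by move=> /= h; apply: z'0; rewrite -[z']scale1r.
move=> a b /= abz; case: (pselect (a *: z' = 0)) => az; [by left | right].
have le : kerS (actL z') ≤ kerS (actL (a *: z')).
  by move=> c /= cz; rewrite scalerA mulrC -scalerA cz scaler0.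
have : kerS (actL (a *: z')) b by rewrite /= scalerA mulrC.
rewrite (Pmax (kerS (actL (a *: z')))) ?PE //.
by exists (a *: z'); split=> //; apply: sle_trans Jz' le.
Qed.

Lemma ipow_annihilator M (J : ideal A) c (z : M) : z <> 0 ->
  (forall a : A, ipow J A^o c a -> a *: z = 0) ->
  exists2 z' : M, z' <> 0 & J ≤ kerS (actL z').
Proof.
elim: c z => [|c IH] z z0 hz; first by case: z0; rewrite -[z]scale1r; apply: hz.
case: (pselect (J ≤ kerS (actL z))) => [|nJ]; first by exists z.
have [b Jb bz] : exists2 b : A, J b & b *: z <> 0.
  by apply: contrapT => h; apply: nJ => b Jb /=; apply: contrapT => bz; apply: h; exists b.
apply: IH bz _ => a ha; rewrite scalerA mulrC; apply: hz.
exact: (ipowM (M := A^o)).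
Qed.

(** Let [x] in [p] be superficial for [p], and [x *: w = 0] with [w] nonzero. The elements of
    [p^c w] lie in [p^c M] and are killed by [x], so they vanish; then some nonzero element is
    killed by [p], and [p] lies in an associated prime. *)
Lemma regular_or_associated M (p : ideal A) : fg (topS M) -> p ≤ mm ->
  (exists2 x : A, p x & injective (scal M x)) \/
  exists z : M, p ≤ kerS (actL z) /\ prime (kerS (actL z)).
Proof.
move=> fM pm; have [x px sx] := generic_ex H (generic_superficial H p fM).
have [c hc] := superficial_ann H fM pm sx.
case: (pselect (injective (scal M x))) => [ix|nx]; [by left; exists x | right].
have [w w0 xw] : exists2 w : M, w <> 0 & x *: w = 0.
  apply: contrapT => h; apply: nx; apply: linear_injP => w xw.
  by apply: contrapT => w0; apply: h; exists w.
have [|z z0 pz] := @ipow_annihilator M p c w w0; last exact: prime_annihilator z0 pz.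
move=> a pa; apply: hc; first by rewrite ipowE; apply: smulP.
by rewrite scalerA mulrC -scalerA xw scaler0.
Qed.

(* Let [p] be a prime containing the annihilator of [D = MD M j.+1]. If [p] has an [M]-regular
   element [x], then [D / xD] embeds in [MD (M / xM) j]; otherwise [p] lies in an associated
   prime of [M], so [dim A / p >= d > j.+1 >= dim D], which is absurd. *)
Lemma unmixed_MD_dim M d j : fg (topS M) -> mdim M = d%:Z%:E -> unmixed M -> (j.+1 < d)%N ->
  dim_le (MD M j.+1) j.
Proof.
move=> fM dM uM jd k F Fc aF; have F0 := Fc.1 0%N isT.
have fD := MD_fg H C j.+1 fM; have dD := MD_dim H C (j := j.+1) fM.
case: (regular_or_associated fM (prime_le_mm H F0)) => [[x Fx ix]|[z [Fz pz]]]; last first.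
  have ass : associated_prime M (toS (kerS (actL z))).
    by split; [apply/prime_toS | exists z => a; split=> [/toSP|h]; [|apply/toSP]].
  have := uM _ ass; rewrite dM => /mdim_fin[[G [Gc aG]] _ _].
  suff : (d <= j.+1)%N by rewrite leqNgt jd.
  apply: (dD d G Gc) => b /aF/Fz bz; apply: aG => y'; have [y ->] := proj_onto y'.
  rewrite -linearZZ -[_ = 0]/(kerS (proj _) (b *: y)) proj_ker.
  apply/toSP; have bzE : b *: z = 0 := bz.
  suff : ((b : A) * (y : A)) *: z = 0 by [].
  by rewrite mulrC -scalerA bzE scaler0.
have [||b [c [_ h1 h2 h3]]] := @dual_les_scal A m M (mquo M x) x (scal _ x) (prj _) _ ix (prj_onto _).
- by [].
- by move=> y; rewrite prj0; split=> [[u _ ->]|[u ->]]; exists u.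
have [|i iE] := factor_onto (p := mquo_prj (MD M j.+1) x) (f := c j) (prj_onto _).
  by move=> y /prj0[u _ ->]; apply/h3; exists u.
have ii : injective i.
  apply: linear_injP => y; have [u ->] := prj_onto _ y.
  by rewrite iE => /h3[v ->]; apply/prj0; exists v.
apply: (dim_le_inj ii (MD_dim H C (mquo_fg x fM)) Fc).
exact: (prime_ann_mquo fD F0 aF Fx).
Qed.
End Unmixed.

(** * Parameter ideals, and the two inequalities *)

Section ParameterIdeals.
Variables (A : comNzRingType) (m : submodClosed A^o) (H : noeth_local m).
Implicit Types M : lmodType A.

Lemma span_fg M : finitely_generated (whole M) -> fg (topS M).
Proof.
move=> [s sE]; exists s; apply: sle_anti => // x _.
have : x \in whole M by []; rewrite sE => /asboolP/(_ (toS (seqS s))) h.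
by apply/toSP; apply: h => y ys; apply/toSP; apply: spanP.
Qed.

Lemma parameter_mprimary d (I : submodClosed A^o) : parameter_ideal m d I -> mprimary m (ofS I).
Proof.
move=> [_ h]; split; first by move=> a Ia; apply/h; exists 1%N; rewrite expr1.
by apply: (pow_generate H) => a /h.
Qed.

Lemma parameter_param d (I : submodClosed A^o) M : parameter_ideal m d I -> param (ofS I) d M.
Proof.
move=> [[x xE] _]; exists x; split; first exact: size_tuple.
  by move=> y yx; rewrite /= xE; apply/asboolP => S; apply.
move=> a Ia; apply: le_addl; have : a \in I by []; rewrite xE => /asboolP/(_ (toS (seqS x))) h.
by apply/toSP; apply: h => y yx; apply/toSP; apply: spanP.
Qed.
End ParameterIdeals.

Theorem theorem1p3 (A : comNzRingType) (m : submodClosed A^o)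
    (A_noeth : noetherian_ring A) (A_local : local_ring m)
    (A_complete : adically_complete m)
    (A_res_inf : infinite_set [set: quotient_mod m]%classic)
    (d : nat) (d_ge3 : (3 <= d)%N) (dimA : mdim A^o = d%:Z%:E)
    (M : lmodType A) (M_fg : finitely_generated (whole M))
    (dimM : mdim M = d%:Z%:E) :
  (forall Q : submodClosed A^o, parameter_ideal m d Q ->
     hilbert_coef Q M 2 <= htorsion m Q 2 M) /\
  (unmixed M ->
   forall Q : submodClosed A^o, parameter_ideal m d Q ->
     - (\sum_(2 <= j < d)
          'C(d - 3, j - 2)%:Z * hdeg m Q (matlis_dual_cohomology m M j))
     <= hilbert_coef Q M 2).
Proof.
have H := NoethLocal A_noeth A_local A_res_inf.
have fM := span_fg M_fg; have [_ dA _] := mdim_fin dimA; have [abM dM nM] := mdim_fin dimM.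
case: d d_ge3 dimA dimM dA abM dM nM => [|[|[|k]]] // _ _ dimM dA abM dM nM.
have ndM : ~ dim_le M k.+2 by move=> /dim_leP/(_ _ abM); rewrite ltnn.
split=> [Q pQ|uM Q pQ]; have Qm := parameter_mprimary H pQ.
  rewrite (hilbert_coefE H Qm fM dM nM) //.
  apply: le_trans (hcoef2_le H A_complete dA Qm fM dM ndM (parameter_param M pQ)) _.
  rewrite /htorsion nM (_ : (k.+3 - 2 = k.+1)%N) // (_ : (k.+1 - 1 = k)%N) ?subn1 // big_add1 big_mkord.
  by apply: ler_sum => i _; rewrite ?subSS ?subn0.
rewrite (hilbert_coefE H Qm fM dM nM) //.
have cM j : (j < k.+2)%N -> dim_le (matlis_dual_cohomology m M j.+1) j.
  by move=> jk; apply: (unmixed_MD_dim H A_complete fM dimM uM).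
apply: le_trans (hcoef2_lower H A_complete dA Qm fM dM ndM (parameter_param M pQ) cM).
rewrite lerN2 !big_add1 /= big_mkord; apply: ler_sum => i _.
by rewrite ?subSS ?subn0.
Qed.
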